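(* Let $G=\langle f_1,\dots,f_u\rangle$ be a TNR rational semigroup. Fix $R\in(0,R_*(G))$ and $\kappa\in(1,2)$. Let $S$ be a finite aperiodic set with $$\mathrm{Crit}_*(f)\subset S\subset J(G)\setminus B_2(\mathrm{PCV}(G),8R).$$ Then for every $r\in(0,R]$ small enough there exists a nice family of sets $\mathcal U_S(\kappa,r)=\{U_s(\kappa,r)\}_{s\in S}$ for $\tilde f$, associated to the set $S$, such that: (A) $\Sigma_u\times B_2(s,r)\subset U_s(\kappa,r)\subset\Sigma_u\times B_2(s,\kappa r)$ for each $s\in S$. (B) If $a,b\in S$, $\rho\in \mathrm{HIB}(b)$ with $\|\rho\|\ge1$, and $\tilde f_\rho^{-\|\rho\|}(U_b(\kappa,r))\subset U_a(\kappa,r)$, then $|(f_\rho^{-1})'(z)|\le \frac14$ for all $z\in B_2(b,2R)\supset p_2(U_b(\kappa,r))$.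
   Context: Let $u\ge 1$, let $f=(f_1,\dots,f_u)$ be a $u$-tuple of non-constant rational maps of $\hat{\mathbb C}$, and $G=\langle f_1,\dots,f_u\rangle$ the semigroup generated under composition. $F(G)$ is the set of points having a neighbourhood on which $G$ is normal, $J(G)=\hat{\mathbb C}\setminus F(G)$. Fundamental Assumption (standing): some $g\in G$ has degree $\ge2$; every Möbius element of $G$ is loxodromic; $F(G)\ne\emptyset$ and, after a Möbius change of coordinates, $\infty\in F(G)$, so $J(G)\subset\mathbb C$. $\Sigma_u=\{1,\dots,u\}^{\mathbb N}$ with shift $\sigma$; for a finite word $\omega=(\omega_1,\dots,\omega_n)$, $|\omega|=n$, $f_\omega=f_{\omega_n}\circ\dots\circ f_{\omega_1}$, and $[\omega]\subset\Sigma_u$ is the cylinder of sequences beginning with $\omega$. Skew product: $\tilde f(\omega,z)=(\sigma(\omega),f_{\omega_1}(z))$ on $\Sigma_u\times\hat{\mathbb C}$; $p_2(\omega,z)=z$. $B_2(z,r)$ is the Euclidean ball and $B_2(A,r)$ the Euclidean $r$-neighbourhood of $A$. $\mathrm{Crit}(f)=\bigcup_i\mathrm{Crit}(f_i)$; $\mathrm{Crit}_*(f)=\bigcup_{i=1}^u\{c\in\mathrm{Crit}(f_i): f_i(c)\in J(G)\}$; $\mathrm{PCV}(G)=\overline{\{g(c):g\in G,\ g'(c)=0\}}$. $G$ (satisfying the Fundamental Assumption) is totally non-recurrent (TNR) if (i) each $z\in J(G)$ has a neighbourhood $U$ such that for any sequence $g_n\in G$, any domain $V\subset\hat{\mathbb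 C}$ and any $\zeta\in U$, $(g_n)$ does not converge to $\zeta$ locally uniformly on $V$; and (ii) $\mathrm{Crit}_*(f)\cap\mathrm{PCV}(G)=\emptyset$. $R_*(G)$ is a fixed number in $\big(0,\tfrac1{16}\min\{\mathrm{dist}(\mathrm{Crit}_*(f),\mathrm{PCV}(G)),\ \min\{|c_2-c_1|: c_1\ne c_2 \text{ critical points of the generators}\}\}\big)$, so small that the Exponential Shrinking Property holds with radius $R_*(G)$: there are $C,\alpha>0$ such that for all $x\in J(G)$ and finite words $\omega$, each component $V$ of $f_\omega^{-1}(B_2(x,R_*(G)))$ is simply connected with diameter $\le Ce^{-\alpha|\omega|}$. $S\subset\mathbb C$ is aperiodic if $S\cap G(S)=\emptyset$, where $G(S)=\bigcup_{g\in G}g(S)$. Inverse branches: for $b\in S$ the ball $B_2(b,4R)$ is disjoint from $\mathrm{PCV}(G)$. $\mathrm{HIB}(b)$ is the set of all $\rho=(\tilde\rho,f_\rho^{-1})$ where $\tilde\rho$ is a finite word (possibly empty), and $f_\rho^{-1}$ is a holomorphic inverse branch of $f_{\tilde\rho}$ defined on $B_2(b,4R)$; $\|\rho\|:=|\tilde\rho|$ and $\tilde f_\rho^{-\|\rho\|}(\omega,z):=(\tilde\rho\omega,f_\rho^{-1}(z))$. A collection $\{U_s\}_{s\in S}$ of open subsets of $\Sigma_u\times\mathbb C$ is a nice family for $\tilde f$ if: (a) the sets $U_s$ are mutually disjoint; (b) $p_2(U_s)\subset B_2(s,2R)$ for each $s\in S$; (c) for any $a,b\in S$ and $\rho\in\mathrm{HIB}(b)$,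 either $U_a\cap\tilde f_\rho^{-\|\rho\|}(U_b)=\emptyset$ or $\tilde f_\rho^{-\|\rho\|}(U_b)\subset U_a$. *)

(* Defs.v *)
From HB Require Import structures.
From mathcomp Require Import all_boot all_order all_algebra.
From mathcomp Require Import all_classical all_reals all_analysis.
From mathcomp Require Import complex.

Set Implicit Arguments.
Unset Strict Implicit.
Unset Printing Implicit Defensive.

Import Order.TTheory GRing.Theory Num.Theory.
Import numFieldNormedType.Exports.

Local Open Scope classical_set_scope.
Local Open Scope ring_scope.

(** * The Riemann sphere *)

(* Canonical topology and normed module structure on [K[i]] over itself. *)
HB.instance Definition _ (K : realType) := NormedModule.copy K[i] K[i]^o.

(* The complex plane is [K[i]] for a real field [K], with the topology and
   differential calculus of a normed field; derivatives are thus complex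
   derivatives. *)
Notation sphere K := (one_point_compactification K[i]).

Section Sphere.
Variable K : realType.
Local Notation C := K[i].

Definition fin (z : C) : sphere K := Some z.
Definition infty : sphere K := None.

(* Left inverse of [fin]; the value at infinity is irrelevant. *)
Definition finpart (z : sphere K) : C := if z is Some w then w else 0.

Definition cmod (z : C) : K := complex.Re `|z|.

Definition chordal (x y : sphere K) : K :=
  match x, y with
  | Some z, Some w => 2 * cmod (z - w) /
      (Num.sqrt (1 + cmod z ^+ 2) * Num.sqrt (1 + cmod w ^+ 2))
  | Some z, None | None, Some z => 2 / Num.sqrt (1 + cmod z ^+ 2)
  | None, None => 0
  end.

Definition B2 (z : C) (r : K) : set C := ball z (r%:C)%C.

Definition B2_nbhd (A : set (sphere K)) (r : K) : set C :=
  \bigcup_(a in fin @^-1` A) B2 a r.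

Definition dist2 (A B : set (sphere K)) : \bar K :=
  ereal_inf [set x | exists a b, [/\ A (fin a), B (fin b)
                                   & x = (cmod (a - b))%:E]].

Definition domain (V : set (sphere K)) :=
  [/\ open V, connected V & V !=set0].

Definition component (A V : set (sphere K)) :=
  exists2 x, A x & V = connected_component A x.

Definition I01 : set K := [set t | 0 <= t <= 1].

Definition path_in (V : set (sphere K)) (g : K -> sphere K) :=
  {within I01, continuous g} /\ (forall t, I01 t -> V (g t)).

Definition simply_connected (V : set (sphere K)) :=
  (forall x y, V x -> V y -> exists2 g, path_in V g & g 0 = x /\ g 1 = y) /\
  (forall g, path_in V g -> g 0 = g 1 ->
    exists H : K * K -> sphere K,
      [/\ {within I01 `*` I01, continuous H},
          forall p, (I01 `*` I01) p -> V (H p),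
          forall t, I01 t -> H (0, t) = g t,
          forall t, I01 t -> H (1, t) = g 0 &
          forall s, I01 s -> H (s, 0) = g 0 /\ H (s, 1) = g 0]).

(* Local coordinate at [a] ([z] at a finite point, [1/z] at infinity) and its
   local inverse.  Away from a neighbourhood of [a] the values are junk. *)
Definition chart (a z : sphere K) : C :=
  if a is Some _ then finpart z
  else if z is Some w then w^-1 else 0.

Definition chart_inv (a : sphere K) (w : C) : sphere K :=
  if a is Some _ then fin w
  else if w == 0 then infty else fin w^-1.

(* Continuity is required separately because [chart] is junk far from its
   base point. *)
Definition holomorphic_at (h : C -> sphere K) (z : C) :=
  {for z, continuous h} /\ derivable (chart (h z) \o h : C -> C) z 1.

(* [d] is the derivative at [a] of [g] read in the coordinates at [a] and
   [g a].  Its vanishing, and its value when [g a = a], do not depend on the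
   choice of coordinates. *)
Definition chart_derivative (g : sphere K -> sphere K) (a : sphere K) (d : C) :=
  is_derive (chart a a) 1 (chart (g a) \o g \o chart_inv a : C -> C) d.

Definition critical (g : sphere K -> sphere K) : set (sphere K) :=
  [set c | chart_derivative g c 0].

(** * Rational maps *)

Record ratmap := Ratmap {
  ratnum : {poly C};
  ratden : {poly C};
  _ : coprimep ratnum ratden }.

Definition degree (F : ratmap) : nat :=
  (maxn (size (ratnum F)) (size (ratden F))).-1.

(* At infinity, evaluate at [1 : 0] the homogenisation in degree [degree F]
   of the numerator and of the denominator. *)
Definition ratfun (F : ratmap) (z : sphere K) : sphere K :=
  let p := if z is Some w then (ratnum F).[w] else (ratnum F)`_(degree F) in
  let q := if z is Some w then (ratden F).[w] else (ratden F)`_(degree F) in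
  if q == 0 then infty else fin (p / q).

Definition has_degree (g : sphere K -> sphere K) (d : nat) :=
  exists2 F : ratmap, g = ratfun F & degree F = d.

(* For a Moebius map: exactly two fixed points, the multiplier at one of them
   (hence also at the other) being off the unit circle. *)
Definition loxodromic (g : sphere K -> sphere K) :=
  exists a b, [/\ a <> b, [set z | g z = z] = [set a; b] &
    exists2 m, chart_derivative g a m & cmod m <> 1].

(** * Normality, Fatou and Julia sets *)

Definition loc_unif_cvg (g : nat -> sphere K -> sphere K)
    (h : sphere K -> sphere K) (V : set (sphere K)) :=
  forall z, V z -> exists2 N, nbhs z N &
    forall e : K, 0 < e ->
      \forall n \near \oo, forall w, (N `&` V) w -> chordal (g n w) (h w) < e.

Definition normal_on (G : set (sphere K -> sphere K)) (U : set (sphere K)) :=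
  forall g : nat -> sphere K -> sphere K, (forall n, G (g n)) ->
    exists2 k : nat -> nat, {homo k : m n / (m < n)%N} &
      exists h, loc_unif_cvg (g \o k) h U.

Definition Fatou (G : set (sphere K -> sphere K)) : set (sphere K) :=
  [set z | exists2 U, open_nbhs z U & normal_on G U].

Definition Julia (G : set (sphere K -> sphere K)) : set (sphere K) :=
  ~` Fatou G.

End Sphere.

Arguments infty {K}.

(** * Rational semigroups *)

Section Semigroup.
Variables (K : realType) (u : nat).
Local Notation C := K[i].
Implicit Type f : 'I_u -> ratmap K.

(* [f_w = f_(w_n) \o ... \o f_(w_1)] for [w = (w_1, ..., w_n)]. *)
Definition word_map f (w : seq 'I_u) (z : sphere K) : sphere K :=
  foldl (fun y i => ratfun (f i) y) z w.

Definition semigroup f : set (sphere K -> sphere K) :=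
  [set word_map f w | w in [set w | w <> [::]]].

Definition F_ f := Fatou (semigroup f).
Definition J_ f := Julia (semigroup f).

Definition Crit f : set (sphere K) := \bigcup_i critical (ratfun (f i)).

Definition Crit_star f : set (sphere K) :=
  \bigcup_i [set c | critical (ratfun (f i)) c /\ J_ f (ratfun (f i) c)].

Definition PCV f : set (sphere K) :=
  closure (\bigcup_(g in semigroup f) (g @` critical g)).

(* The last clause is the normalisation of the coordinate; it contains
   the nonemptiness of the Fatou set. *)
Definition fundamental_assumption f :=
  [/\ exists2 g, semigroup f g & exists2 d, has_degree g d & (2 <= d)%N,
      forall g, semigroup f g -> has_degree g 1 -> loxodromic g,
      F_ f !=set0 &
      F_ f infty].

Definition TNR f :=
  [/\ fundamental_assumption f,
      forall z, J_ f z -> exists2 U, nbhs z U &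
        forall g : nat -> sphere K -> sphere K, (forall n, semigroup f (g n)) ->
        forall V zeta, domain V -> U zeta -> ~ loc_unif_cvg g (cst zeta) V &
      Crit_star f `&` PCV f = set0].

(* Diameters are chordal, as the components live in the sphere. *)
Definition exponential_shrinking f (R : K) :=
  exists c alpha : K, [/\ 0 < c, 0 < alpha &
    forall x, J_ f (fin x) -> forall (w : seq 'I_u) (V : set (sphere K)),
      component (word_map f w @^-1` (@fin K @` B2 x R)) V ->
      simply_connected V /\
      forall y z, V y -> V z -> chordal y z <= c * expR (- alpha * (size w)%:R)].

(* Smallest Euclidean distance between distinct finite critical points of the
   generators. *)
Definition crit_gap f : \bar K :=
  ereal_inf [set x | exists c1 c2, [/\ Crit f (fin c1), Crit f (fin c2),
                                     c1 <> c2 & x = (cmod (c2 - c1))%:E]].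

Definition admissible_Rstar f (Rstar : K) :=
  [/\ 0 < Rstar,
      (Rstar%:E < (16^-1)%:E *
         Order.min (dist2 (Crit_star f) (PCV f)) (crit_gap f))%E &
      exponential_shrinking f Rstar].

Definition aperiodic f (S : set C) :=
  (@fin K @` S) `&` \bigcup_(g in semigroup f) (g @` (@fin K @` S)) = set0.

(** * Inverse branches and nice families *)

Definition Sigma := prod_topology (fun _ : nat => discrete_topology 'I_u).

Definition prepend (w : seq 'I_u) (omega : Sigma) : Sigma :=
  fun n => nth (omega (n - size w)%N) w n.

(* [rho = (w, h)]: the finite word and the inverse branch of [f_w].  Only the
   values of [h] on [B2 b (4 * R)] matter. *)
Definition HIB f (R : K) (b : C) : set (seq 'I_u * (C -> sphere K)) :=
  [set rho | forall z, B2 b (4 * R) z ->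
     holomorphic_at rho.2 z /\ word_map f rho.1 (rho.2 z) = fin z].

Definition pull_back (rho : seq 'I_u * (C -> sphere K)) (U : set (Sigma * C)) :
    set (Sigma * sphere K) :=
  [set (prepend rho.1 x.1, rho.2 x.2) | x in U].

Definition in_sphere (U : set (Sigma * C)) : set (Sigma * sphere K) :=
  [set (x.1, fin x.2) | x in U].

Definition nice_family f (R : K) (S : set C) (U : C -> set (Sigma * C)) :=
  [/\ forall s, S s -> open (U s),
      trivIset S U,
      forall s, S s -> snd @` U s `<=` B2 s (2 * R) &
      forall a b rho, S a -> S b -> HIB f R b rho ->
        in_sphere (U a) `&` pull_back rho (U b) = set0 \/
        pull_back rho (U b) `<=` in_sphere (U a)].

End Semigroup.

(* Main.v *)
Require Import Defs.
From mathcomp Require Import all_boot all_order all_algebra.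
From mathcomp Require Import all_classical all_reals all_analysis.
From mathcomp Require Import complex ring lra zify.
Import Order.TTheory GRing.Theory Num.Theory.
Import numFieldNormedType.Exports.
Local Open Scope classical_set_scope.
Local Open Scope ring_scope.

(** The nice set around [s] is grown from [Sigma x B(s, r)]: at each stage one
adjoins the pull-backs, along inverse branches of positive length, of the sets
already built around the points of [S], provided that they meet
[Sigma x B(s, r)] ([stage], [nice_set]).

These sets stay inside [Sigma x B(s, kappa r)] because every branch over
[B(b, R)] that comes close to a point [a] of [S] contracts strongly.  Its word
cannot be short: by aperiodicity a word of positive length moves [a] off [S],
so by continuity it sends no point near [a] to a point near [b] ([short_word]).
For a long word, exponential shrinking makes the image of [B(b, R)] tiny
([long_branch_near]), and the Schwarz lemma turns this into a small Lipschitz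
constant ([branch_lip]).  So an adjoined pull-back has diameter less than
[(kappa - 1) r], and it touches [B(s, r)] itself: no error accumulates from one
stage to the next ([stage_bound]).

They are nested for the following reason.  Suppose that a pull-back meets the
nice set of [a] at a point that was itself adjoined along another branch.  The
longer of the two branches factors through the shorter one ([branch_factor]):
the two lifts agree at a point, hence on the whole disc, since branches over a
disc that avoids the post-critical set avoid the critical points
([branch_unique]).  Cancelling the shorter word leaves a meeting of sets of
earlier stages, and induction applies ([pull_back_nested]).

The derivative in (B) has to be bounded on [B(b, 2 R)], whereas shrinking only
controls [B(b, R)].  The passage is a Koebe distortion theorem on [B(b, 4 R)]
with a non-sharp constant ([distortion]).  A branch [h] over [B(b, 4 R)] takes
values in the sphere, but it omits some point: [G] has an element of degree at
least two, hence a critical value [p], and all images of [p] lie in the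
post-critical set, far from [b].  So [1 / (h - p)], or [h] when [p] is
infinity, is a univalent function ([HIB_coordinate], [HIB_contraction]).

The function theory rests on second-order expansions
[F (z + h) = F z + a h + b h ^ 2 + O (h ^ 3)] ([jet]) and not on integrals.
All the functions that occur are local inverses of rational maps, or are built
from such by algebraic operations and square roots, so they have such
expansions.  Averaging [|F| ^ 2] over the points [z + t], [z - t], [z + i t],
[z - i t] gives the maximum principle, hence the Schwarz lemma.  For the
distortion theorem, let [H] be univalent and [c] an almost closest omitted
value.  On the disc [H - c] has a square root [S], and [S] and [- S] have
disjoint images; so [S] avoids a disc around [- S z0], the function
[(S - S z0) / (S + S z0)] is bounded, and the Schwarz lemma bounds
[|H' z0|] by a multiple of [|H z0 - c|] over the radius ([covering]).  At all points of a
smaller disc this is a differential inequality for [|H - c|], which Gronwall's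
argument integrates. *)

Set Implicit Arguments.
Unset Strict Implicit.
Unset Printing Implicit Defensive.

(** * The modulus as a real number *)

Section Modulus.
Variable K : realType.
Implicit Types (z w x y : K[i]) (r s e : K).

Lemma normE z : `|z| = (cmod z)%:C%C.
Proof. by rewrite /cmod normc_def. Qed.

Lemma cmod_ge0 z : 0 <= cmod z.
Proof. by rewrite -ler0c -normE normr_ge0. Qed.

Lemma cmodM z w : cmod (z * w) = cmod z * cmod w.
Proof. by apply/complexI; rewrite rmorphM -!normE normrM. Qed.

Lemma cmodD z w : cmod (z + w) <= cmod z + cmod w.
Proof. by rewrite -lecR rmorphD -!normE ler_normD. Qed.

Lemma cmodN z : cmod (- z) = cmod z.
Proof. by apply/complexI; rewrite -!normE normrN. Qed.

Lemma cmodBC z w : cmod (z - w) = cmod (w - z).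
Proof. by rewrite -cmodN opprB. Qed.

Lemma cmod0 : cmod (0 : K[i]) = 0.
Proof. by apply/complexI; rewrite -normE normr0. Qed.

Lemma cmod1 : cmod (1 : K[i]) = 1.
Proof. by apply/complexI; rewrite -normE normr1. Qed.

Lemma cmod_eq0 z : (cmod z == 0) = (z == 0).
Proof. by rewrite -[RHS]normr_eq0 normE -(inj_eq (@complexI K)). Qed.

Lemma cmod_gt0 z : (0 < cmod z) = (z != 0).
Proof. by rewrite lt_neqAle cmod_ge0 andbT eq_sym cmod_eq0. Qed.

Lemma cmodV z : cmod z^-1 = (cmod z)^-1.
Proof. by apply/complexI; rewrite fmorphV -!normE normfV. Qed.

Lemma cmodX z n : cmod (z ^+ n) = cmod z ^+ n.
Proof. by apply/complexI; rewrite rmorphXn -!normE normrX. Qed.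

Lemma cmodR r : cmod (r%:C)%C = `|r|.
Proof. by rewrite /cmod normc_def /= expr0n addr0 sqrtr_sqr. Qed.

Lemma cmod_sqr z : cmod z ^+ 2 = complex.Re z ^+ 2 + complex.Im z ^+ 2.
Proof. by rewrite /cmod normc_def /= sqr_sqrtr // addr_ge0 // sqr_ge0. Qed.

Lemma cmodB z w : cmod (z - w) <= cmod z + cmod w.
Proof. by rewrite (le_trans (cmodD _ _)) // cmodN. Qed.

Lemma cmod_geB z w : cmod z - cmod w <= cmod (z - w).
Proof. by rewrite lerBlDr (le_trans _ (cmodD _ _)) // subrK. Qed.

Lemma cmodDB z w x : cmod (z - w) <= cmod (z - x) + cmod (x - w).
Proof. by rewrite (le_trans _ (cmodD _ _)) // addrA subrK. Qed.

Lemma Re_le_cmod z : `|complex.Re z| <= cmod z.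
Proof.
rewrite -(ler_pXn2r (n := 2)) ?nnegrE ?cmod_ge0 // real_normK ?num_real //.
by rewrite cmod_sqr lerDl sqr_ge0.
Qed.

Lemma Im_le_cmod z : `|complex.Im z| <= cmod z.
Proof.
rewrite -(ler_pXn2r (n := 2)) ?nnegrE ?cmod_ge0 // real_normK ?num_real //.
by rewrite cmod_sqr lerDr sqr_ge0.
Qed.

Lemma B2E z r w : B2 z r w <-> cmod (w - z) < r.
Proof.
by rewrite /B2 -ball_normE /ball_ /= normE ltcR cmodBC.
Qed.

Lemma nbhs_cmodP z (P : set K[i]) :
  nbhs z P <-> exists2 e, 0 < e & forall w, cmod (w - z) < e -> P w.
Proof.
split=> [/nbhs_ballP [e e0 eP]|[e e0 eP]].
  exists (complex.Re e) => [|w we].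
    by move: e0; rewrite /= ltcE => /andP[].
  apply: eP; rewrite -ball_normE /ball_ /= normE cmodBC.
  by move: e0 we; rewrite /= !ltcE => /andP[/eqP -> _] /= ->; rewrite eqxx.
apply/nbhs_ballP; exists (e%:C)%C; first by rewrite /= ltcR.
by move=> w; rewrite -ball_normE /ball_ /= normE ltcR cmodBC; exact: eP.
Qed.

Definition cont (F : K[i] -> K[i]) z :=
  forall e, 0 < e -> exists2 d, 0 < d & forall w, cmod (w - z) < d ->
    cmod (F w - F z) < e.

Lemma continuousCP (T : topologicalType) (g : T -> K[i]) (p : T) :
  {for p, continuous g} <->
  forall e, 0 < e -> \forall t \near p, cmod (g t - g p) < e.
Proof.
split=> [gp e e0|gp P].
  have B : nbhs (g p) (B2 (g p) e) by apply/nbhs_cmodP; exists e => // w /B2E.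
  have := gp _ B; rewrite nbhs_simpl => gB.
  have {}gB : nbhs p (g @^-1` B2 (g p) e) := gB.
  by near=> t; apply/B2E; near: t.
move=> /nbhs_cmodP[e e0 eP]; rewrite nbhs_simpl.
have {}gp := gp _ e0; change (nbhs p (g @^-1` P)).
by near=> t; apply: eP; near: t.
Unshelve. all: by end_near. Qed.

Lemma contE F z : {for z, continuous F} <-> cont F z.
Proof.
split=> [/continuousCP Fz e /Fz /nbhs_cmodP //|Fz].
by apply/continuousCP => e /Fz ?; exact/nbhs_cmodP.
Qed.

End Modulus.

(** * Second-order expansions *)

Section Jets.
Variable K : realType.
Local Notation C := K[i].
Implicit Types (z w x y h : C) (r s e d M : K) (F G E : C -> C).

Definition bigO n E := exists M d, [/\ 0 <= M, 0 < d &
  forall h, cmod h < d -> cmod (E h) <= M * cmod h ^+ n].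

Lemma bigO_near n E G d : 0 < d -> (forall h, cmod h < d -> E h = G h) ->
  bigO n E -> bigO n G.
Proof.
move=> d0 EG [M [r [M0 r0 rP]]]; exists M, (Num.min d r).
split => // [|h]; first by rewrite lt_min d0.
by rewrite lt_min => /andP[hd hr]; rewrite -EG // rP.
Qed.

Lemma bigO_ext n E G : E =1 G -> bigO n E -> bigO n G.
Proof. by move=> EG; apply: (bigO_near ltr01) => h _; exact: EG. Qed.

Lemma bigOD n E G : bigO n E -> bigO n G -> bigO n (fun h => E h + G h).
Proof.
move=> [M [r [M0 r0 rP]]] [M' [r' [M'0 r'0 r'P]]].
exists (M + M'), (Num.min r r'); split=> [||h]; first exact: addr_ge0.
  by rewrite lt_min r0.
rewrite lt_min => /andP[/rP ? /r'P ?].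
by rewrite mulrDl (le_trans (cmodD _ _)) // lerD.
Qed.

Lemma bigOM m n E G : bigO m E -> bigO n G ->
  bigO (m + n) (fun h => E h * G h).
Proof.
move=> [M [r [M0 r0 rP]]] [M' [r' [M'0 r'0 r'P]]].
exists (M * M'), (Num.min r r'); split=> [||h]; first exact: mulr_ge0.
  by rewrite lt_min r0.
rewrite lt_min => /andP[/rP ? /r'P ?].
by rewrite exprD mulrACA cmodM ler_pM ?cmod_ge0.
Qed.

Lemma bigO_le m n E : (m <= n)%N -> bigO n E -> bigO m E.
Proof.
move=> mn [M [r [M0 r0 rP]]].
exists M, (Num.min 1 r); split=> // [|h].
  by rewrite lt_min r0 ltr01.
rewrite lt_min => /andP[h1 /rP /le_trans]; apply.
by rewrite ler_wpM2l // ler_wiXn2l ?cmod_ge0 // ltW.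
Qed.

Lemma bigO_cst (c : C) : bigO 0 (fun _ => c).
Proof.
exists (cmod c), 1; split=> // [|h _]; first exact: cmod_ge0.
by rewrite expr0 mulr1.
Qed.

Lemma bigOX n : bigO n (fun h => h ^+ n).
Proof. by exists 1, 1; split=> // h _; rewrite mul1r cmodX. Qed.

Lemma bigO_cM n (c : C) E : bigO n E -> bigO n (fun h => c * E h).
Proof. exact: (@bigOM 0 n _ _ (bigO_cst c)). Qed.

Lemma bigO_cX m n (c : C) : (m <= n)%N -> bigO m (fun h => c * h ^+ n).
Proof. by move=> /bigO_le mn; apply/mn/bigO_cM/bigOX. Qed.

Lemma bigON n E : bigO n E -> bigO n (fun h => - E h).
Proof. by move=> /(@bigO_cM _ (-1)); apply: bigO_ext => h; rewrite mulN1r. Qed.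

Lemma bigO_comp n E k : bigO n E -> bigO 1 k -> bigO n (E \o k).
Proof.
move=> [M [r [M0 r0 rP]]] [L [d [L0 d0 dP]]].
exists (M * L ^+ n), (Num.min d (r / (L + 1))); split=> [||h].
- by rewrite mulr_ge0 // exprn_ge0.
- by rewrite lt_min d0 divr_gt0 // addrC ltr_pwDl.
rewrite lt_min => /andP[/dP]; rewrite expr1 => kh hr.
have L1 : 0 < L + 1 by rewrite addrC ltr_pwDl.
have kr : cmod (k h) < r.
  move: hr; rewrite ltr_pdivlMr // => hr; apply: le_lt_trans kh _.
  by apply: le_lt_trans hr; rewrite mulrC ler_wpM2l ?cmod_ge0 // lerDl.
rewrite (le_trans (rP _ kr)) // -mulrA ler_wpM2l // -exprMn.
by apply: lerXn2r; rewrite ?nnegrE ?cmod_ge0 // mulr_ge0 // cmod_ge0.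
Qed.

(** The form in which continuity enters the expansions of inverses and of
square roots. *)
Lemma bigO_inv u (l : C) : l != 0 ->
  (forall e, 0 < e -> exists2 d, 0 < d & forall h, cmod h < d ->
     cmod (u h - l) < e) ->
  bigO 0 (fun h => (u h)^-1) /\
  exists2 d, 0 < d & forall h, cmod h < d -> u h != 0.
Proof.
rewrite -cmod_gt0 => l0 ul.
have [|d d0 dP] := ul (cmod l / 2); first by rewrite divr_gt0.
have big h : cmod h < d -> cmod l / 2 < cmod (u h).
  move=> /dP; rewrite cmodBC => hd.
  by have := cmod_geB l (u h); lra.
split; last first.
  by exists d => // h /big uh; rewrite -cmod_gt0 (lt_trans _ uh) // divr_gt0.
exists (cmod l / 2)^-1, d; split=> // [|h /big uh].
  by rewrite invr_ge0 divr_ge0 // cmod_ge0.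
have u0 : 0 < cmod (u h) by rewrite (lt_trans _ uh) // divr_gt0.
rewrite expr0 mulr1 cmodV lef_pV2 ?posrE ?divr_gt0 //; exact: ltW.
Qed.

(** [a] is the derivative.  The quadratic term is left implicit; it is there
because the maximum principle needs [|F| ^ 2] up to [O (h ^ 3)]. *)
Definition jet F z (a : C) := exists b : C,
  bigO 3 (fun h => F (z + h) - F z - a * h - b * h ^+ 2).

Lemma jet_near F G z a d : 0 < d ->
  (forall w, cmod (w - z) < d -> F w = G w) -> jet F z a -> jet G z a.
Proof.
move=> d0 FG [b Fb]; exists b; apply: (bigO_near d0) Fb => h hd.
by rewrite !FG // ?subrr ?cmod0 // [z + h]addrC addrK.
Qed.

Lemma jet_lip F z a : jet F z a -> bigO 1 (fun h => F (z + h) - F z).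
Proof.
move=> [b Fb].
apply: (bigO_ext (E := fun h => (F (z + h) - F z - a * h - b * h ^+ 2) +
  (a * h ^+ 1 + b * h ^+ 2))) => [h|]; first by ring.
apply: bigOD; first exact: bigO_le Fb.
by apply: bigOD; apply: bigO_cX.
Qed.

Lemma bigO1_cont F z : bigO 1 (fun h => F (z + h) - F z) -> cont F z.
Proof.
move=> [M [d [M0 d0 dP]]] e e0.
have M1 : 0 < M + 1 by rewrite addrC ltr_pwDl.
exists (Num.min d (e / (M + 1))) => [|w].
  by rewrite lt_min d0 divr_gt0.
rewrite lt_min ltr_pdivlMr // => /andP[/dP + we].
rewrite [z + _]addrC subrK expr1 => /le_lt_trans; apply.
by apply: le_lt_trans we; rewrite mulrC ler_wpM2l ?cmod_ge0 // lerDl.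
Qed.

Lemma jet_cont F z a : jet F z a -> cont F z.
Proof. by move/jet_lip/bigO1_cont. Qed.

Lemma jet_diff F z a e : jet F z a -> 0 < e -> exists2 d, 0 < d &
  forall h, cmod h < d -> cmod (F (z + h) - F z - a * h) <= e * cmod h.
Proof.
move=> [b Fb] e0.
have [M [d [M0 d0 dP]]] : bigO 2 (fun h => F (z + h) - F z - a * h).
  apply: (bigO_ext (E := fun h => (F (z + h) - F z - a * h - b * h ^+ 2) +
    b * h ^+ 2)) => [h|]; first by ring.
  by apply: bigOD; [exact: bigO_le Fb|exact: bigO_cX].
have M1 : 0 < M + 1 by rewrite addrC ltr_pwDl.
exists (Num.min d (e / (M + 1))) => [|h].
  by rewrite lt_min d0 divr_gt0.
rewrite lt_min ltr_pdivlMr // => /andP[/dP hd he].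
apply: le_trans hd _; rewrite expr2 mulrA ler_wpM2r ?cmod_ge0 //.
by have := cmod_ge0 h; nra.
Qed.

Lemma exists_small d : 0 < d -> exists2 h : C, cmod h < d & h != 0.
Proof.
move=> d0; exists ((d / 2)%:C)%C; last first.
  by rewrite -cmod_gt0 cmodR gtr0_norm // divr_gt0.
by rewrite cmodR gtr0_norm; lra.
Qed.

Lemma jet_coef_le F z a L : jet F z a ->
  (forall e, 0 < e -> exists2 d, 0 < d & forall h, cmod h < d ->
     cmod (F (z + h) - F z) <= (L + e) * cmod h) -> cmod a <= L.
Proof.
move=> Fa FL; apply/ler_addgt0Pr => e e0.
have e2 : 0 < e / 2 by rewrite divr_gt0.
have [d d0 dP] := FL _ e2; have [d' d'0 d'P] := jet_diff Fa e2.
have [|h] := @exists_small (Num.min d d'); first by rewrite lt_min d0.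
rewrite lt_min => /andP[/dP hd /d'P hd']; rewrite -cmod_gt0 => h0.
rewrite -(ler_pM2r h0) -cmodM.
have := cmodD (- (F (z + h) - F z - a * h)) (F (z + h) - F z).
rewrite cmodN (_ : - _ + _ = a * h); last by ring.
nra.
Qed.

Lemma jet_coef_ge F z a L d : jet F z a -> 0 <= L -> 0 < d ->
  (forall h, cmod h < d -> cmod h <= L * cmod (F (z + h) - F z)) ->
  1 <= L * cmod a.
Proof.
move=> Fa L0 d0 dP; apply/ler_addgt0Pr => e e0.
have L1 : 0 < L + 1 by rewrite addrC ltr_pwDl.
have e1 : 0 < e / (L + 1) by rewrite divr_gt0.
have [d' d'0 d'P] := jet_diff Fa e1.
have [|h] := @exists_small (Num.min d d'); first by rewrite lt_min d0.
rewrite lt_min => /andP[/dP hd /d'P hd']; rewrite -cmod_gt0 => h0.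
have := cmodD (F (z + h) - F z - a * h) (a * h).
rewrite subrK cmodM => hh.
have Le : L * (e / (L + 1)) <= e.
  by rewrite mulrA ler_pdivrMr // mulrC; nra.
rewrite -(ler_pM2r h0) mul1r; apply: le_trans hd _.
have : L * cmod (F (z + h) - F z) <=
   L * (e / (L + 1) * cmod h + cmod a * cmod h).
  by rewrite ler_wpM2l // (le_trans hh) // lerD2r.
move=> /le_trans; apply; nra.
Qed.

Lemma jet_cst (c z : C) : jet (fun _ => c) z 0.
Proof.
exists 0; apply: (bigO_ext (E := fun h => 0 * h ^+ 3)) => [h|]; first by ring.
exact: bigO_cX.
Qed.

Lemma jet_id z : jet id z 1.
Proof.
exists 0; apply: (bigO_ext (E := fun h => 0 * h ^+ 3)) => [h|]; first by ring.
exact: bigO_cX.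
Qed.

Lemma jetD F G z a b : jet F z a -> jet G z b ->
  jet (fun w => F w + G w) z (a + b).
Proof.
move=> [a2 Fa] [b2 Gb]; exists (a2 + b2).
by apply: bigO_ext (bigOD Fa Gb) => h; ring.
Qed.

Lemma jetM F G z a b : jet F z a -> jet G z b ->
  jet (fun w => F w * G w) z (a * G z + F z * b).
Proof.
move=> Fa Gb; have Gl := jet_lip Gb; move: Fa Gb => [a2 Fa] [b2 Gb].
exists (a2 * G z + a * b + F z * b2).
have G0 : bigO 0 (fun h => G (z + h)).
  apply: (bigO_ext (E := fun h => (G (z + h) - G z) + G z)) => [h|].
    by ring.
  by apply: bigOD; [exact: bigO_le Gl|exact: bigO_cst].
have P0 : bigO 0 (fun h => F z * h ^+ 0 + (a * h ^+ 1 + a2 * h ^+ 2)).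
  by apply: bigOD; [|apply: bigOD]; exact: bigO_cX.
have := bigOD (bigOD (bigOM Fa G0) (bigOM P0 Gb))
  (bigOD (@bigO_cX 3 3 (a * b2 + a2 * b) isT) (@bigO_cX 3 4 (a2 * b2) isT)).
by apply: bigO_ext => h /=; ring.
Qed.

Lemma jet_cM F z a (c : C) : jet F z a -> jet (fun w => c * F w) z (c * a).
Proof.
by move=> /(jetM (jet_cst c z)); rewrite mul0r add0r.
Qed.

Lemma jetB F G z a b : jet F z a -> jet G z b ->
  jet (fun w => F w - G w) z (a - b).
Proof.
move=> Fa /(jet_cM (-1)); rewrite mulN1r => /(jetD Fa).
by apply: (jet_near ltr01) => w _; rewrite mulN1r.
Qed.

Lemma jet_inv F z a : F z != 0 -> jet F z a ->
  jet (fun w => (F w)^-1) z (- a / F z ^+ 2).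
Proof.
move=> Fz Fa; have Fc := jet_cont Fa; move: Fa => [b Fb].
have [V0 [d d0 dP]] : bigO 0 (fun h => (F (z + h))^-1) /\
    exists2 d, 0 < d & forall h, cmod h < d -> F (z + h) != 0.
  apply: (bigO_inv Fz) => e e0; have [d d0 dP] := Fc _ e0.
  by exists d => // h hd; apply: dP; rewrite [z + h]addrC addrK.
set g0 := (F z)^-1; set g1 := - a / F z ^+ 2.
set g2 := a ^+ 2 / F z ^+ 3 - b / F z ^+ 2; exists g2.
have P0 : bigO 0 (fun h => g0 * h ^+ 0 + (g1 * h ^+ 1 + g2 * h ^+ 2)).
  by apply: bigOD; [|apply: bigOD]; exact: bigO_cX.
have := bigON (bigOM (bigOD (bigOM P0 Fb) (bigOD
  (@bigO_cX 3 3 (a * g2 + b * g1) isT) (@bigO_cX 3 4 (b * g2) isT))) V0).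
rewrite addn0; apply: (bigO_near d0) => h /dP hd.
by rewrite /g0 /g1 /g2; field; rewrite hd Fz.
Qed.

Lemma jet_div F G z a b : G z != 0 -> jet F z a -> jet G z b ->
  jet (fun w => F w / G w) z ((a * G z - F z * b) / G z ^+ 2).
Proof.
move=> Gz Fa /(jet_inv Gz)/(jetM Fa).
by rewrite [X in jet _ _ X -> _](_ : _ = (a * G z - F z * b) / G z ^+ 2) //;
  field.
Qed.

Lemma jet_exp F z a n : jet F z a -> jet (fun w => F w ^+ n) z
  (n%:R * a * F z ^+ n.-1).
Proof.
move=> Fa; elim: n => [|n IH].
  by rewrite !mul0r; exact: jet_cst.
have := jetM Fa IH.
rewrite [X in jet _ _ X -> _](_ : _ = n.+1%:R * a * F z ^+ n).
  by apply: (jet_near ltr01) => w _; rewrite exprS.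
case: n {IH} => [|n] /=; first by ring.
by rewrite exprS -!natr1; ring.
Qed.

Lemma jet_poly (p : {poly C}) z : jet (horner p) z (deriv p).[z].
Proof.
elim/poly_ind: p => [|p c IH].
  rewrite deriv0 horner0; apply: jet_near (jet_cst 0 z); first exact: ltr01.
  by move=> w _; rewrite horner0.
have := jetD (jetM IH (jet_id z)) (jet_cst c z).
rewrite [X in jet _ _ X -> _](_ : _ = (deriv (p * 'X + c%:P)).[z]); last first.
  by rewrite derivMXaddC !hornerE; ring.
by apply: (jet_near ltr01) => w _; rewrite !hornerE.
Qed.

(** If [P] is the Taylor polynomial that the equation [S ^ 2 = F] dictates,
then [S - P = (F - P ^ 2) / (S + P)], and [S + P] tends to [2 S z]. *)
Lemma jet_sqrt S F z a d : 0 < d -> (forall w, cmod (w - z) < d ->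
    S w ^+ 2 = F w) -> S z != 0 -> cont S z -> jet F z a ->
  jet S z (a / (2 * S z)).
Proof.
move=> d0 SF Sz Sc [b Fb].
have n2 : 2 != 0 :> C by rewrite pnatr_eq0.
set s1 := a / (2 * S z); set s2 := (b - s1 ^+ 2) / (2 * S z); exists s2.
pose P h := S z * h ^+ 0 + (s1 * h ^+ 1 + s2 * h ^+ 2).
pose u h := S (z + h) + P h.
have [V0 [d' d'0 d'P]] : bigO 0 (fun h => (u h)^-1) /\
    exists2 d, 0 < d & forall h, cmod h < d -> u h != 0.
  apply: (@bigO_inv _ (2 * S z)) => [|e e0]; first by rewrite mulf_neq0.
  have uc : cont u 0.
    move=> {}e {}e0; have e2 : 0 < e / 2 by rewrite divr_gt0.
    have [r r0 rP] := Sc _ e2.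
    have [r' r'0 r'P] : exists2 d, 0 < d & forall h, cmod (h - 0) < d ->
        cmod (P h - P 0) < e / 2.
      have : bigO 1 (fun h => P (0 + h) - P 0).
        apply: (bigO_ext (E := fun h => s1 * h ^+ 1 + s2 * h ^+ 2)) => [h|].
          by rewrite /P; ring.
        by apply: bigOD; exact: bigO_cX.
      by move/bigO1_cont; apply.
    exists (Num.min r r') => [|h]; first by rewrite lt_min r0.
    rewrite subr0 lt_min => /andP[hr hr'].
    have := r'P h; rewrite subr0 => /(_ hr') H1.
    have := rP (z + h); rewrite addrAC subrr add0r => /(_ hr) H2.
    rewrite [u h - _](_ : _ = (S (z + h) - S z) + (P h - P 0)); last first.
      by rewrite /u addr0; ring.
    by have := cmodD (S (z + h) - S z) (P h - P 0); lra.
  have [r r0 rP] := uc _ e0; exists r => // h hr.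
  have := rP h; rewrite subr0 => /(_ hr).
  by rewrite {2}/u /P addr0 expr0 mulr1 !expr0n !mulr0 !addr0 mulrDl mul1r.
have dd : 0 < Num.min d d' by rewrite lt_min d0.
have := bigOM (bigOD Fb (bigON (bigOD
  (@bigO_cX 3 3 (2 * s1 * s2) isT) (@bigO_cX 3 4 (s2 ^+ 2) isT)))) V0.
rewrite addn0; apply: (bigO_near dd) => h.
rewrite lt_min => /andP[hd /d'P hd'].
rewrite -!SF ?subrr ?cmod0 //; last by rewrite [z + h]addrC addrK.
have s1E : a = 2 * s1 * S z by rewrite /s1; field; rewrite Sz.
have s2E : b = 2 * s2 * S z + s1 ^+ 2.
  by rewrite /s2; field; rewrite Sz.
apply: (mulIf hd'); rewrite mulfVK // s2E s1E /u /P.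
clearbody s1 s2; ring.
Qed.

(** Near [B z] the linear term of [A] dominates, so [B] is Lipschitz at [z].
Substituting [k = B (z + h) - B z] in [h = a k + b k ^ 2 + O (k ^ 3)] then
gives [k] up to [O (h ^ 2)], and a second time up to [O (h ^ 3)]. *)
Lemma jet_linv A B z a d : a != 0 -> jet A (B z) a -> cont B z -> 0 < d ->
  (forall w, cmod (w - z) < d -> A (B w) = w) -> jet B z a^-1.
Proof.
move=> a0 [b [M [r [M0 r0 rP]]]] Bc d0 AB.
pose k h := B (z + h) - B z; have AzE : A (B z) = z.
  by rewrite AB // subrr cmod0.
pose EA k := A (B z + k) - A (B z) - a * k - b * k ^+ 2.
have OE : bigO 3 EA by exists M, r.
have hE h : cmod h < d -> h = a * k h + b * k h ^+ 2 + EA (k h).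
  move=> hd; rewrite /EA /k [B z + _]addrC subrK AzE AB; first by ring.
  by rewrite [z + h]addrC addrK.
have a0' : 0 < cmod a by rewrite cmod_gt0.
have kO : bigO 1 k.
  pose q := cmod b + M + 1.
  have q0 : 0 < q by rewrite /q; have := cmod_ge0 b; lra.
  pose t := Num.min (Num.min 1 r) (cmod a / 2 / q).
  have t0 : 0 < t by rewrite !lt_min ltr01 r0 !divr_gt0.
  have [d' d'0 d'P] := Bc _ t0.
  exists (2 / cmod a), (Num.min d d'); split=> [||h].
  - by rewrite divr_ge0 // ltW.
  - by rewrite lt_min d0.
  rewrite lt_min => /andP[hd hd'].
  have : cmod (k h) < t by apply: d'P; rewrite [z + h]addrC addrK.
  rewrite !lt_min ltr_pdivlMr // => /andP[/andP[k1 kr] kq].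
  have := hE _ hd => /(congr1 (fun x => a * k h = x - (b * k h ^+ 2 + EA (k h)))).
  rewrite -[X in _ = (_ = X)]addrA [X in _ = (_ = X)](_ : _ = a * k h); last by ring.
  move=> H; have {}H : a * k h = h - (b * k h ^+ 2 + EA (k h)) by rewrite H.
  have := cmodB h (b * k h ^+ 2 + EA (k h)); rewrite -H cmodM.
  have := cmodD (b * k h ^+ 2) (EA (k h)); rewrite cmodM cmodX.
  have := rP _ kr; rewrite -/(EA _) => E3 h1 h2.
  have k0 := cmod_ge0 (k h); have b0 := cmod_ge0 b.
  have E3' : cmod (EA (k h)) <= M * cmod (k h) ^+ 2.
    apply: le_trans E3 _; rewrite ler_wpM2l // exprS ler_piMl ?sqr_ge0 //.
    exact: ltW.
  rewrite expr1 mulrAC ler_pdivlMr // [_ * cmod a]mulrC.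
  have : cmod (k h) * (cmod (k h) * q) <= cmod (k h) * (cmod a / 2).
    by rewrite ler_wpM2l // ltW.
  rewrite /q; nra.
have Ek := bigO_comp OE kO.
have k2 : bigO 2 (fun h => k h - a^-1 * h).
  have := bigO_cM (- a^-1) (bigOD (bigO_cM b (bigOM kO kO))
    (@bigO_le 2 3 _ isT Ek)).
  apply: (bigO_near d0) => h hd /=.
  have := hE _ hd; set e := EA _; set kk := k h => H.
  have -> : e = h - a * kk - b * kk ^+ 2 by rewrite {1}H; ring.
  by field.
have k1 : bigO 1 (fun h => k h + a^-1 * h ^+ 1).
  by apply: bigOD => //; exact: bigO_cX.
exists (- b / a ^+ 3).
have := bigO_cM (- a^-1) (bigOD (bigO_cM b (bigOM k2 k1)) Ek).
apply: (bigO_near d0) => h hd /=.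
rewrite -/(k h); have := hE _ hd; set e := EA _; set kk := k h => H.
have -> : e = h - a * kk - b * kk ^+ 2 by rewrite {1}H; ring.
by rewrite expr1; field.
Qed.

End Jets.

(** * Maximum principle and Schwarz lemma *)

Section Disc.
Variable K : realType.
Local Notation C := K[i].
Implicit Types (z w x y h : C) (r s e d M : K) (F G E : C -> C).

Definition cdisc z r : set C := [set w | cmod (w - z) <= r].

Lemma closed_cdisc z r : closed (cdisc z r).
Proof.
rewrite -openC openE => w /= /negP; rewrite -ltNge => wronskian; rewrite /interior.
apply/nbhs_cmodP; exists (cmod (w - z) - r) => [|v vw].
  by rewrite subr_gt0.
rewrite /setC /=; apply/negP; rewrite -ltNge.
by have := cmodDB w z v; rewrite cmodBC in vw; lra.
Qed.

Lemma compact_cdisc z r : compact (cdisc z r).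
Proof.
pose Q : set (K * K) := `[- r, r]%classic `*` `[- r, r]%classic.
pose g (p : K * K) : C := z + (p.1 +i* p.2)%C.
have cQ : compact Q by apply: compact_setX; exact: segment_compact.
have gc : {within Q, continuous g}.
  apply: continuous_subspaceT => p; apply/continuousCP => e e0.
  have e2 : 0 < e / 2 by rewrite divr_gt0.
  exists (ball p.1 (e / 2), ball p.2 (e / 2)).
    by split; apply/nbhs_ballP; exists (e / 2).
  case=> a b [/= ab bb].
  rewrite (_ : _ - _ = (a - p.1)%:C%C + 'i%C * (b - p.2)%:C%C); last first.
    rewrite /g /= opprD addrACA subrr add0r.
    by apply/eqP; rewrite eq_complex /=; apply/andP; split; apply/eqP; ring.
  apply: le_lt_trans (cmodD _ _) _; rewrite cmodM !cmodR.
  rewrite (_ : cmod 'i%C = 1); last first.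
    by rewrite /cmod normc_def /= expr0n expr1n add0r sqrtr1.
  move: ab bb; rewrite -!ball_normE /ball_ /= distrC [X in _ -> X < _ -> _]distrC.
  lra.
have ci := continuous_compact gc cQ.
apply: subclosed_compact ci _.
  exact: closed_cdisc.
move=> w wronskian; exists (complex.Re (w - z), complex.Im (w - z)); last first.
  rewrite /g /= (_ : (_ +i* _)%C = w - z); last by case: (w - z).
  by rewrite addrC subrK.
split; rewrite /= in_itv /= -ler_norml; apply: le_trans wronskian.
  exact: Re_le_cmod.
exact: Im_le_cmod.
Qed.

Lemma continuous_realP (u : C -> K) z :
  (forall e, 0 < e -> exists2 d, 0 < d &
     forall v, cmod (v - z) < d -> `|u v - u z| < e) -> {for z, continuous u}.
Proof.
move=> uz P /nbhs_ballP[e /= e0 eP]; have [d d0 dP] := uz _ e0.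
rewrite nbhs_simpl; change (nbhs z (u @^-1` P)).
apply/nbhs_cmodP; exists d => // v /dP vd; apply: eP.
by rewrite -ball_normE /ball_ /= distrC.
Qed.

Lemma disc_max (u : C -> K) z r : 0 <= r ->
  (forall w, cdisc z r w -> forall e, 0 < e -> exists2 d, 0 < d &
     forall v, cmod (v - w) < d -> `|u v - u w| < e) ->
  exists2 w, cdisc z r w & forall v, cdisc z r v -> u v <= u w.
Proof.
move=> r0 uc.
have uc' : {within cdisc z r, continuous u}.
  apply: continuous_in_subspaceT => w /set_mem wD.
  exact/continuous_realP/uc.
have [|w /set_mem wD wP] := compact_EVT_max _ (@compact_cdisc z r) uc'.
  by exists z; rewrite /cdisc /= subrr cmod0.
by exists w => // v vD; apply: wP; exact: mem_set.
Qed.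

Lemma disc_unif (F : C -> C) z r :
  (forall w, cdisc z r w -> cont F w) -> forall e, 0 < e ->
  exists2 d, 0 < d & forall w v, cdisc z r w -> cmod (v - w) < d ->
    cmod (F v - F w) < e.
Proof.
move=> Fc e e0.
have e2 : 0 < e / 2 by rewrite divr_gt0.
have /compact_near_coveringP := @compact_cdisc z r.
move=> /(_ nat \oo (fun n w => forall v, cmod (v - w) < n.+1%:R^-1 ->
    cmod (F v - F w) < e) _) [w wD|].
  have [d d0 dP] := Fc _ wD _ e2.
  have d2 : 0 < d / 2 by rewrite divr_gt0.
  exists (B2 w (d / 2), [set n | n.+1%:R^-1 < d / 2]).
    split; first by apply/nbhs_cmodP; exists (d / 2) => // v /B2E.
    exact: near_infty_natSinv_lt (PosNum d2).
  case=> v n [/= /B2E vw nd] y yv.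
  have {}vw : cmod (v - w) < d / 2 := vw.
  have {}yv : cmod (y - v) < d / 2 := lt_trans yv nd.
  have H1 : cmod (F v - F w) < e / 2 by apply: dP; lra.
  have H2 : cmod (F y - F w) < e / 2.
    by apply: dP; have := cmodDB y w v; lra.
  by have := cmodDB (F y) (F v) (F w); rewrite (cmodBC (F w)); lra.
move=> N _ NP; exists N.+1%:R^-1 => [|w v wD vw]; first by rewrite invr_gt0.
by apply: (NP N) => //=.
Qed.

(** The four values of [h] are the fourth roots of [t ^ 4], so the cross terms
cancel. *)
Lemma parseval4 (f a b : C) (t : K) :
  let T := (t%:C)%C in let X h := f + a * h + b * h ^+ 2 in
  cmod (X T) ^+ 2 + cmod (X (- T)) ^+ 2 + cmod (X ('i%C * T)) ^+ 2 +
  cmod (X (- ('i%C * T))) ^+ 2 =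
  4 * (cmod f ^+ 2 + cmod a ^+ 2 * t ^+ 2 + cmod b ^+ 2 * t ^+ 4).
Proof.
move=> T X; rewrite /X /T !cmod_sqr; case: f a b {X T} => [f1 f2] [a1 a2] [b1 b2].
by rewrite !expr2 /=; ring.
Qed.

(** On the average over the four points the perturbation gains [e t ^ 2], and
the expansion of [F] loses at most [O (t ^ 3)]. *)
Lemma max_principle_local F z z0 a e d : 0 < e -> 0 < d -> jet F z a ->
  (forall w, cmod (w - z) < d -> cmod (F w) ^+ 2 + e * cmod (w - z0) ^+ 2 <=
     cmod (F z) ^+ 2 + e * cmod (z - z0) ^+ 2) -> False.
Proof.
move=> e0 d0 [b [M [r [M0 r0 rP]]]] zmax.
pose X h := F z + a * h + b * h ^+ 2.
pose B := cmod (F z) + cmod a + cmod b.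
have B0 : 0 <= B by rewrite !addr_ge0 // cmod_ge0.
pose q := 2 * B * M + 1.
have q0 : 0 < q by rewrite /q ltr_wpDl // !mulr_ge0.
pose m := Num.min (Num.min d r) (Num.min 1 (e / q)).
have m0 : 0 < m by rewrite !lt_min d0 r0 ltr01 divr_gt0.
pose t := m / 2; have t0 : 0 < t by rewrite divr_gt0.
have : t < m by rewrite /t; lra.
rewrite !lt_min => /andP[/andP[td tr] /andP[t1]].
rewrite ltr_pdivlMr // => tq.
have key h : cmod h = t -> cmod (X h) ^+ 2 - 2 * B * M * t ^+ 3 +
    e * cmod (z - z0 + 1 * h + 0 * h ^+ 2) ^+ 2 <=
    cmod (F z) ^+ 2 + e * cmod (z - z0) ^+ 2.
  move=> ht; have := zmax (z + h); rewrite addrAC subrr add0r ht => /(_ td).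
  rewrite mul1r mul0r addr0 (addrAC z); apply: le_trans; rewrite lerD2r.
  have := rP h; rewrite ht => /(_ tr).
  rewrite (_ : F (z + h) - _ - _ - _ = F (z + h) - X h); last first.
    by rewrite /X; ring.
  move=> E3; have XB : cmod (X h) <= B.
    apply: le_trans (cmodD _ _) _; rewrite /B lerD //.
      apply: le_trans (cmodD _ _) _; rewrite lerD2l cmodM ht ler_piMr ?cmod_ge0 //.
      exact: ltW.
    rewrite cmodM cmodX ht ler_piMr ?cmod_ge0 //.
    by rewrite expr_le1 ?ltW // ltW.
  have F0 := cmod_ge0 (F (z + h)); have X0 := cmod_ge0 (X h).
  have := cmodDB (X h) 0 (F (z + h)); rewrite !subr0 cmodBC => XF.
  rewrite -(mulrA (2 * B)); move: (M * t ^+ 3) E3 => E E3.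
  have E0 : 0 <= E := le_trans (cmod_ge0 _) E3.
  have XE : cmod (X h) * E <= B * E by rewrite ler_wpM2r.
  rewrite lerBlDr.
  suff : cmod (X h) ^+ 2 <= cmod (F (z + h)) ^+ 2 + 2 * (cmod (X h) * E).
    by move: XE; lra.
  move: (cmod (F _)) (cmod (X h)) F0 X0 (le_trans XF (lerD E3 (lexx _))).
  move=> f x f0 x0 xf; rewrite !expr2; case: (leP x E) => [xE|Ex].
    have : x * x <= x * E by rewrite ler_wpM2l.
    by have := mulr_ge0 f0 f0; have := mulr_ge0 x0 E0; lra.
  have : (x - E) * (x - E) <= f * f by rewrite ler_pM //; lra.
  by have := mulr_ge0 E0 E0; lra.
have ci : cmod 'i%C = 1 :> K.
  by rewrite /cmod normc_def /= expr0n expr1n add0r sqrtr1.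
have tT : cmod (t%:C)%C = t by rewrite cmodR gtr0_norm.
have k1 := key (t%:C)%C tT.
have k2 := key (- (t%:C)%C); rewrite cmodN in k2; have {}k2 := k2 tT.
have k3 := key ('i%C * (t%:C)%C); rewrite cmodM ci mul1r in k3; have {}k3 := k3 tT.
have k4 := key (- ('i%C * (t%:C)%C)).
rewrite cmodN cmodM ci mul1r in k4; have {}k4 := k4 tT.
have := parseval4 (F z) a b t; have := parseval4 (z - z0) 1 0 t => /=.
rewrite -!/(X _) cmod1 cmod0 => /(congr1 ( *%R e)) p2 p1.
have ea : 0 <= cmod a ^+ 2 * t ^+ 2 by rewrite mulr_ge0 // sqr_ge0.
have eb : 0 <= cmod b ^+ 2 * t ^+ 4 by rewrite mulr_ge0 // exprn_ge0 // ?cmod_ge0 // ltW.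
have tt : e * t ^+ 2 <= 2 * B * M * t ^+ 3.
  lra.
have t2 : 0 < t ^+ 2 by rewrite exprn_gt0.
have {}tt : t ^+ 2 * e <= t ^+ 2 * (2 * B * M * t) by lra.
move: tt; rewrite ler_pM2l // => tt.
by move: tq; rewrite /q; nra.
Qed.

(** The expansion is asked for only where [F] does not vanish, since a maximum
of the perturbed function at a zero of [F] is harmless.  This is what allows
isolated removable singularities below. *)
Lemma max_principle F z0 r M : 0 <= r -> 0 <= M ->
  (forall z, cdisc z0 r z -> cont F z) ->
  (forall z, cmod (z - z0) < r -> F z != 0 -> exists a, jet F z a) ->
  (forall z, cmod (z - z0) = r -> cmod (F z) <= M) ->
  forall z, cdisc z0 r z -> cmod (F z) <= M.
Proof.
move=> r0 M0 Fc Fj FM z1 z1D; rewrite leNgt; apply/negP => z1M.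
have g0 : 0 < cmod (F z1) ^+ 2 - M ^+ 2.
  by rewrite subr_gt0; apply: ltrXn2r => //; exact: cmod_ge0.
have r1 : 0 < 2 * (r ^+ 2 + 1) by have := sqr_ge0 r; lra.
(* so small that [|F z1| ^ 2] still exceeds [M ^ 2 + e * r ^ 2] *)
pose e := (cmod (F z1) ^+ 2 - M ^+ 2) / (2 * (r ^+ 2 + 1)).
have e0 : 0 < e by rewrite divr_gt0.
have er : e * r ^+ 2 < cmod (F z1) ^+ 2 - M ^+ 2.
  rewrite /e mulrAC ltr_pdivrMr // ltr_pM2l //.
  by have := sqr_ge0 r; lra.
pose u w := cmod (F w) ^+ 2 + e * cmod (w - z0) ^+ 2.
have sqc (f : C -> C) w : cont f w -> forall e, 0 < e -> exists2 d, 0 < d &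
     forall v, cmod (v - w) < d -> `|cmod (f v) ^+ 2 - cmod (f w) ^+ 2| < e.
  move=> fc {e e0 er u}e e0; pose q := 2 * cmod (f w) + 1.
  have q0 : 0 < q by rewrite /q; have := cmod_ge0 (f w); lra.
  have [|d d0 dP] := fc (Num.min 1 (e / q)); first by rewrite lt_min ltr01 divr_gt0.
  exists d => // v /dP; rewrite lt_min ltr_pdivlMr // => /andP[v1 ve].
  have H1 : `|cmod (f v) - cmod (f w)| <= cmod (f v - f w).
    rewrite ler_norml cmod_geB andbT.
    by have := cmod_geB (f w) (f v); rewrite (cmodBC (f w)); lra.
  have H2 : `|cmod (f v) + cmod (f w)| <= q.
    rewrite ger0_norm ?addr_ge0 ?cmod_ge0 // /q.
    by have := ler_norm (cmod (f v) - cmod (f w)); lra.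
  by rewrite subr_sqr normrM; apply: le_lt_trans (ler_pM _ _ H1 H2) ve.
have [|z zD zmax] := @disc_max u z0 r r0.
  move=> w wD d d0.
  have d2 : 0 < d / 2 by rewrite divr_gt0.
  have d3 : 0 < d / 2 / e by rewrite divr_gt0.
  have [s s0 sP] := sqc _ _ (Fc _ wD) _ d2.
  have [|s' s'0 s'P] := sqc (fun w => w - z0) w _ _ d3.
    by apply: (@jet_cont _ _ _ (1 - 0)); apply: jetB; [exact: jet_id|exact: jet_cst].
  exists (Num.min s s') => [|v]; first by rewrite lt_min s0.
  rewrite lt_min => /andP[/sP H1 /s'P]; rewrite ltr_pdivlMr // => H2.
  rewrite /u opprD addrACA -mulrBr; apply: le_lt_trans (ler_normD _ _) _.
  by rewrite normrM (gtr0_norm e0); lra.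
have uz : cmod (F z1) ^+ 2 <= u z.
  apply: le_trans (zmax _ z1D); rewrite /u lerDl mulr_ge0 ?sqr_ge0 //.
  exact: ltW.
have zr : e * cmod (z - z0) ^+ 2 <= e * r ^+ 2.
  apply: ler_wpM2l; first exact: ltW.
  apply: lerXn2r; rewrite ?nnegrE ?cmod_ge0 //; exact: zD.
have M2 := sqr_ge0 M.
have [zr'|] := ltP (cmod (z - z0)) r; last first.
  move=> rz; have /FM : cmod (z - z0) = r by apply/eqP; rewrite eq_le zD rz.
  move=> FzM; have : cmod (F z) ^+ 2 <= M ^+ 2.
    by apply: lerXn2r; rewrite ?nnegrE ?cmod_ge0.
  by move: uz; rewrite /u; lra.
have [Fz|Fz] := eqVneq (F z) 0.
  by move: uz; rewrite /u Fz cmod0 expr0n /=; lra.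
have [a Fa] := Fj _ zr' Fz.
apply: (@max_principle_local F z z0 a e (r - cmod (z - z0))) => //.
  by rewrite subr_gt0.
move=> w wz; apply: zmax; rewrite /cdisc /=.
by have := cmodDB w z0 z; lra.
Qed.

Lemma bernoulli_ineq (x : K) n : 0 <= x -> 1 + n%:R * x <= (1 + x) ^+ n.
Proof.
move=> x0; elim: n => [|n IH]; first by rewrite expr0 mul0r addr0.
rewrite exprS -natr1; apply: le_trans (_ : (1 + x) * (1 + n%:R * x) <= _).
  by have := ler0n K n; nra.
by rewrite ler_wpM2l // addr_ge0.
Qed.

(** This replaces the limit of [q ^ (n / (n + 1))]. *)
Lemma root_limit (x q : K) : 0 <= x -> 0 < q ->
  (forall n, x ^+ n.+1 <= q ^+ n) -> x <= q.
Proof.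
move=> x0 q0 H; rewrite leNgt; apply/negP => qx.
have xx : 0 < x := lt_trans q0 qx.
pose dl := x / q - 1.
have dl0 : 0 < dl by rewrite subr_gt0 ltr_pdivlMr // mul1r.
have H' n : (1 + dl) ^+ n <= x^-1.
  rewrite /dl addrC subrK expr_div_n ler_pdivrMr ?exprn_gt0 //.
  by rewrite -ler_pdivrMl ?invr_gt0 // invrK -exprS.
pose n := (Num.bound (x^-1 / dl)).
have : x^-1 / dl < n%:R.
  apply: archi_boundP; rewrite divr_ge0 ?invr_ge0 //; exact: ltW.
rewrite ltr_pdivrMr // => xn.
have := le_trans (@bernoulli_ineq dl n (ltW dl0)) (H' n).
lra.
Qed.

(** The quotient [(F z - F z0) / (z - z0)] need not have a second-order
expansion at [z0].  But
[(F z - F z0) ^ (n + 1) / (z - z0) ^ n] tends to [0] at [z0], so the maximum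
principle applies to it; then let [n] grow. *)
Lemma schwarz F z0 R M : 0 < R -> 0 <= M ->
  (forall z, cmod (z - z0) < R -> exists a, jet F z a) ->
  (forall z, cmod (z - z0) < R -> cmod (F z - F z0) <= M) ->
  forall z, cmod (z - z0) < R -> cmod (F z - F z0) <= M * (cmod (z - z0) / R).
Proof.
move=> R0; rewrite le_eqVlt => /predU1P[<-|M0] Fj FM z zR.
  by rewrite mul0r; exact: FM.
have [->|zz0] := eqVneq z z0.
  by rewrite !subrr cmod0 mul0r mulr0.
have zz0' : 0 < cmod (z - z0) by rewrite cmod_gt0 subr_eq0.
pose G w := F w - F z0.
have Gj w : cmod (w - z0) < R -> exists a, jet G w a.
  by move=> /Fj[a Fa]; exists (a - 0); apply: jetB Fa (jet_cst _ _).
have key r : cmod (z - z0) < r -> r < R ->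
    cmod (F z - F z0) <= M * (cmod (z - z0) / r).
  move=> zr rR; have r0 : 0 < r := lt_trans zz0' zr.
  have q0 : 0 < cmod (z - z0) / r by rewrite divr_gt0.
  rewrite mulrC -ler_pdivrMr //; apply: root_limit => // [|n].
    by rewrite divr_ge0 ?cmod_ge0 // ltW.
  (* at [z0] itself the inverse of 0 is 0, which is the limit *)
  pose Gn w := G w ^+ n.+1 * (w - z0) ^- n.
  have Gnj w : cmod (w - z0) < R -> w != z0 -> exists a, jet Gn w a.
    move=> /Gj[a Ga] wz; eexists; apply: jetM; first exact: jet_exp Ga.
    apply: jet_inv; first by rewrite expf_neq0 // subr_eq0.
    by apply: jet_exp; apply: jetB; [exact: jet_id|exact: jet_cst].
  have : cmod (Gn z) <= M ^+ n.+1 / r ^+ n.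
    apply: (@max_principle Gn z0 r) => [||w wD|w wD Gn0|w wronskian|].
    - exact: ltW.
    - by rewrite divr_ge0 // exprn_ge0 // ltW.
    - have [->|wz0] := eqVneq w z0; last first.
        by have [|//|a /jet_cont] := Gnj w; first exact: le_lt_trans rR.
      have [|a /jet_lip Gl] := Gj z0; first by rewrite subrr cmod0.
      apply: bigO1_cont; have [L [d [L0 d0 dP]]] := Gl.
      exists (L ^+ n.+1), d; split=> // [|h hd]; first exact: exprn_ge0.
      have := dP _ hd; rewrite /Gn /G !subrr expr0n mul0r !subr0 addrAC subrr add0r.
      rewrite cmodM cmodV !cmodX expr1 => Gh.
      have [->|h0] := eqVneq h 0.
        rewrite addr0 subrr cmod0 expr0n mul0r mulr0 //.
      have h0' : 0 < cmod h by rewrite cmod_gt0.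
      rewrite ler_pdivrMr ?exprn_gt0 // -mulrA -exprS -exprMn.
      by apply: lerXn2r => //; rewrite nnegrE ?cmod_ge0 // mulr_ge0 // cmod_ge0.
    - apply: Gnj; first exact: lt_trans rR.
      by apply: contra Gn0 => /eqP ->; rewrite /Gn /G subrr expr0n mul0r.
    - rewrite /Gn cmodM cmodV !cmodX wronskian ler_pM2r ?invr_gt0 ?exprn_gt0 //.
      apply: lerXn2r; rewrite ?nnegrE ?cmod_ge0 //; first exact: ltW.
      by apply: FM; rewrite wronskian.
    - exact: ltW.
  rewrite /Gn cmodM cmodV !cmodX ler_pdivrMr ?exprn_gt0 // => H.
  rewrite !expr_div_n ler_pdivrMr ?exprn_gt0 // -/(G z); apply: le_trans H _.
  by rewrite le_eqVlt; apply/orP; left; apply/eqP; ring.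
rewrite mulrA ler_pdivlMr // leNgt; apply/negP => H.
pose q := M * cmod (z - z0) / cmod (F z - F z0).
have Fz : 0 < cmod (F z - F z0).
  by rewrite cmod_gt0; apply: contraTneq H => ->; rewrite cmod0 mul0r -leNgt mulr_ge0 // ltW.
have qR : q < R by rewrite ltr_pdivrMr // [R * _]mulrC.
pose r := (Num.max q (cmod (z - z0)) + R) / 2.
have mR : Num.max q (cmod (z - z0)) < R by rewrite gt_max qR.
have mr : Num.max q (cmod (z - z0)) < r by rewrite /r; lra.
have rR : r < R by rewrite /r; lra.
move: mr; rewrite gt_max => /andP[qr zr].
have := key _ zr rR; have r0 : 0 < r := lt_trans zz0' zr.
rewrite mulrA ler_pdivlMr //; apply/negP; rewrite -ltNge.
by move: qr; rewrite ltr_pdivrMr // [r * _]mulrC.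
Qed.

End Disc.

(** * Estimates along segments *)

Section Segments.
Variable K : realType.
Local Notation C := K[i].
Implicit Types (z w x y h : C) (r s e d M : K) (F G E : C -> C).

Definition disc z r : set C := [set w | cmod (w - z) < r].

Lemma is_derive_eps (f : K -> K) (t l : K) :
  (forall e, 0 < e -> exists2 d, 0 < d & forall h : K, `|h| < d ->
     `|f (t + h) - f t - l * h| <= e * `|h|) -> is_derive t 1 f l.
Proof.
move=> fP.
have cv : (h : K)^-1 *: (f (h *: 1 + t) - f t) @[h --> 0^'] --> l.
  apply/cvgrPdist_le => e e0; have [d d0 dP] := fP _ e0.
  exists d => //= h hd h0.
  have {}hd : `|h| < d by move: hd; rewrite -?ball_normE /ball_ /= sub0r normrN.
  have h0' : 0 < `|h| by rewrite normr_gt0.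
  rewrite [h%R *: 1]mulr1 [h + t]addrC distrC.
  rewrite -(ler_pM2r h0') -normrM mulrBl [_ *: _]mulrC mulfVK //.
  exact: dP.
apply: DeriveDef; last exact: cvg_lim cv.
by apply/cvg_ex; exists l.
Qed.

Lemma line_derive F z v (t : K) a : jet F (z + (t%:C)%C * v) a ->
  is_derive t 1 (fun t : K => complex.Re (F (z + (t%:C)%C * v)))
    (complex.Re (a * v)) /\
  is_derive t 1 (fun t : K => complex.Im (F (z + (t%:C)%C * v)))
    (complex.Im (a * v)).
Proof.
move=> Fa; have v1 : 0 < cmod v + 1 by rewrite ltr_wpDl ?cmod_ge0.
have key e : 0 < e -> exists2 d, 0 < d & forall h : K, `|h| < d ->
    cmod (F (z + ((t + h)%:C)%C * v) - F (z + (t%:C)%C * v) - (a * v) * (h%:C)%C)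
      <= e * `|h|.
  move=> e0; have e1 : 0 < e / (cmod v + 1) by rewrite divr_gt0.
  have [d d0 dP] := jet_diff Fa e1.
  exists (d / (cmod v + 1)) => [|h hd]; first by rewrite divr_gt0.
  have hv : cmod ((h%:C)%C * v) <= `|h| * (cmod v + 1).
    by rewrite cmodM cmodR ler_wpM2l // lerDl.
  have -> : z + ((t + h)%:C)%C * v = z + (t%:C)%C * v + (h%:C)%C * v.
    by rewrite rmorphD /=; ring.
  have -> : a * v * (h%:C)%C = a * ((h%:C)%C * v) by ring.
  apply: le_trans (dP _ _) _.
    by apply: le_lt_trans hv _; rewrite -ltr_pdivlMr.
  by rewrite mulrAC ler_pdivrMr // -mulrA ler_wpM2l // ltW.
split; apply: is_derive_eps => e /key[d d0 dP]; exists d => // h /dP.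
  apply: le_trans; apply: le_trans (Re_le_cmod _).
  move: (F _) (F _) (a * v) => [p1 p2] [q1 q2] [u1 u2] /=.
  by rewrite mulr0 subr0.
apply: le_trans; apply: le_trans (Im_le_cmod _).
move: (F _) (F _) (a * v) => [p1 p2] [q1 q2] [u1 u2] /=.
by rewrite mulr0 add0r.
Qed.

Lemma MVT01 (f df : K -> K) :
  (forall x : K, x \in `[0, 1]%R -> is_derive x 1 f (df x)) ->
  exists2 c : K, c \in `[0, 1]%R & f 1 - f 0 = df c.
Proof.
move=> fd.
have fd' (x : K) : x \in `]0, 1[%R -> is_derive x 1 f (df x).
  by move=> x01; apply: fd; apply: subset_itv_oo_cc.
have fc : {within `[0, 1]%classic, continuous f}.
  apply: continuous_in_subspaceT => x /set_mem /fd fx.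
  apply/differentiable_continuous/derivable1_diffP; exact: ex_derive.
have [c c01] := MVT_segment (@ler01 K) fd' fc.
by rewrite subr0 mulr1 => fE; exists c.
Qed.

Lemma segment_in_disc z0 r z (t : K) : t \in `[0, 1]%R -> disc z0 r z ->
  disc z0 r (z0 + (t%:C)%C * (z - z0)).
Proof.
rewrite in_itv /= => /andP[t0 t1] zr.
rewrite /disc /= addrAC subrr add0r cmodM cmodR ger0_norm //.
by apply: le_lt_trans zr; rewrite ler_piMl ?cmod_ge0.
Qed.

(** The factor [2] comes from treating real and imaginary parts
separately. *)
Lemma mean_value_disc F dF z0 r xi : 0 <= xi ->
  (forall z, disc z0 r z -> jet F z (dF z) /\ cmod (dF z) <= xi) ->
  forall z, disc z0 r z -> cmod (F z - F z0) <= 2 * xi * cmod (z - z0).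
Proof.
move=> xi0 FdF z zr; pose v := z - z0.
have D (t : K) : t \in `[0, 1]%R -> disc z0 r (z0 + (t%:C)%C * v).
  by move=> t01; exact: segment_in_disc.
have ends : z0 + (1%:C)%C * v = z /\ z0 + (0%:C)%C * v = z0.
  by rewrite /v rmorph1 rmorph0; split; ring.
have bnd (t : K) : t \in `[0, 1]%R -> cmod (dF (z0 + (t%:C)%C * v) * v) <=
    xi * cmod v.
  by move=> /D/FdF[_ H]; rewrite cmodM ler_wpM2r ?cmod_ge0.
have [c c01] := @MVT01 (fun t : K => complex.Re (F (z0 + (t%:C)%C * v)))
  (fun t : K => complex.Re (dF (z0 + (t%:C)%C * v) * v))
  (fun t t01 => (line_derive (FdF _ (D _ t01)).1).1).
have [c' c'01] := @MVT01 (fun t : K => complex.Im (F (z0 + (t%:C)%C * v)))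
  (fun t : K => complex.Im (dF (z0 + (t%:C)%C * v) * v))
  (fun t t01 => (line_derive (FdF _ (D _ t01)).1).2).
case: ends => -> -> fI fR.
have := bnd _ c01; have := bnd _ c'01.
set y := _ * v; set x := _ * v => xb yb.
have xR := Re_le_cmod x; have yI := Im_le_cmod y.
have := cmodD ((complex.Re (F z - F z0))%:C)%C ('i%C * ((complex.Im (F z - F z0))%:C)%C).
rewrite -complexE cmodM !cmodR (_ : cmod 'i%C = 1); last first.
  by rewrite /cmod normc_def /= expr0n expr1n add0r sqrtr1.
move: fI fR; rewrite -/x -/y.
move: (F z) (F z0) => [p1 p2] [q1 q2] /= -> ->.
lra.
Qed.

(** Along each radius [|F| ^ 2 * exp (- 2 L t)] is non-increasing. *)
Lemma gronwall_disc F dF z0 r L : 0 <= L ->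
  (forall z, disc z0 r z -> jet F z (dF z) /\ cmod (dF z) * r <= L * cmod (F z)) ->
  forall z, disc z0 r z -> cmod (F z) <= expR L * cmod (F z0).
Proof.
move=> L0 FdF z zr; pose v := z - z0.
have D (t : K) : t \in `[0, 1]%R -> disc z0 r (z0 + (t%:C)%C * v).
  by move=> t01; exact: segment_in_disc.
have ends : z0 + (1%:C)%C * v = z /\ z0 + (0%:C)%C * v = z0.
  by rewrite /v rmorph1 rmorph0; split; ring.
pose R t := complex.Re (F (z0 + (t%:C)%C * v)).
pose I t := complex.Im (F (z0 + (t%:C)%C * v)).
pose a t := dF (z0 + (t%:C)%C * v) * v.
pose psi (t : K) := (R t ^+ 2 + I t ^+ 2) * expR (- (2 * L) * t).
pose dpsi (t : K) := (2 * (R t * complex.Re (a t) + I t * complex.Im (a t))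
   - 2 * L * (R t ^+ 2 + I t ^+ 2)) * expR (- (2 * L) * t).
have [c c01 cE] : exists2 c : K, c \in `[0, 1]%R & psi 1 - psi 0 = dpsi c.
  apply: MVT01 => t /D/FdF[/line_derive[dR dI] _].
  have {}dR : is_derive t 1 R (complex.Re (a t)) by [].
  have {}dI : is_derive t 1 I (complex.Im (a t)) by [].
  have dE : is_derive t 1 (fun t : K => expR (- (2 * L) * t))
      (- (2 * L) * expR (- (2 * L) * t)).
    apply: is_derive_eq; rewrite /GRing.scale /= mulr1; ring.
  rewrite /psi; apply: is_derive_eq.
  rewrite /dpsi /GRing.scale /=; ring.
have dle : dpsi c <= 0.
  have /FdF[_ H] := D _ c01.
  rewrite /dpsi pmulr_lle0 ?expR_gt0 // subr_le0.
  have -> : R c ^+ 2 + I c ^+ 2 = cmod (F (z0 + (c%:C)%C * v)) ^+ 2.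
    by rewrite cmod_sqr.
  have aL : cmod (a c) <= L * cmod (F (z0 + (c%:C)%C * v)).
    apply: le_trans H; rewrite cmodM ler_wpM2l ?cmod_ge0 //; exact: ltW.
  have cs : R c * complex.Re (a c) + I c * complex.Im (a c) <=
      cmod (F (z0 + (c%:C)%C * v)) * cmod (a c).
    rewrite -[cmod (a c)]cmodN -(cmodN (- _)) opprK.
    have -> : R c * complex.Re (a c) + I c * complex.Im (a c) =
        complex.Re (F (z0 + (c%:C)%C * v) * (a c)^*%C).
      by rewrite /R /I; case: (F _) (a c) => [p1 p2] [q1 q2] /=; ring.
    apply: le_trans (ler_norm _) _; apply: le_trans (Re_le_cmod _) _.
    rewrite cmodM ler_wpM2l ?cmod_ge0 // {2}/cmod normc_def /cmod normc_def.
    by case: (a c) => p q /=; rewrite sqrrN.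
  by have := cmod_ge0 (F (z0 + (c%:C)%C * v)); nra.
have : psi 1 <= psi 0 by lra.
rewrite /psi /R /I -!cmod_sqr; case: ends => -> ->.
rewrite mulr1 mulr0 expR0 mulr1 expRN ler_pdivrMr ?expR_gt0 // => H.
rewrite -(ler_pXn2r (n := 2)) ?nnegrE ?cmod_ge0 //; last first.
  by rewrite mulr_ge0 ?cmod_ge0 // expR_ge0.
by rewrite exprMn -expRM_natl mulrC.
Qed.

End Segments.

(** * Square roots and univalent functions *)

Section Conformal.
Variable K : realType.
Local Notation C := K[i].
Implicit Types (z w x y h : C) (r s e d M : K) (F G E : C -> C).

Lemma contM F G z : cont F z -> cont G z -> cont (fun w => F w * G w) z.
Proof.
move=> Fc Gc e e0; have F1 : 0 < 2 * (cmod (F z) + 1).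
  by have := cmod_ge0 (F z); lra.
have G1 : 0 < 2 * (cmod (G z) + 1) by have := cmod_ge0 (G z); lra.
have [|d d0 dP] := Fc (Num.min 1 (e / (2 * (cmod (G z) + 1)))).
  by rewrite lt_min ltr01 divr_gt0.
have [|d' d'0 d'P] := Gc (e / (2 * (cmod (F z) + 1))); first exact: divr_gt0.
exists (Num.min d d') => [|w]; first by rewrite lt_min d0.
rewrite lt_min => /andP[/dP + /d'P]; rewrite lt_min !ltr_pdivlMr //.
move=> /andP[Fw1 Fw] Gw.
have -> : F w * G w - F z * G z = F w * (G w - G z) + (F w - F z) * G z by ring.
apply: le_lt_trans (cmodD _ _) _; rewrite !cmodM.
have Fb : cmod (F w) <= cmod (F z) + 1.
  by have := cmod_geB (F w) (F z); lra.
have := cmod_ge0 (F z); have := cmod_ge0 (G z).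
have := cmod_ge0 (F w - F z); have := cmod_ge0 (G w - G z) => g1 f1 g0 f0.
have := ler_wpM2r g1 Fb; nra.
Qed.

Lemma contV F z : F z != 0 -> cont F z -> cont (fun w => (F w)^-1) z.
Proof.
move=> F0 Fc e e0; have F0' : 0 < cmod (F z) by rewrite cmod_gt0.
have [|d d0 dP] := Fc (Num.min (cmod (F z) / 2) (e * cmod (F z) ^+ 2 / 2)).
  by rewrite lt_min !divr_gt0 // mulr_gt0 // exprn_gt0.
exists d => // w /dP; rewrite lt_min => /andP[w1 w2].
have Fw : cmod (F z) / 2 < cmod (F w).
  by have := cmod_geB (F z) (F w); rewrite cmodBC in w1 *; lra.
have Fw0 : 0 < cmod (F w) by lra.
have -> : (F w)^-1 - (F z)^-1 = (F z - F w) / (F w * F z).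
  by field; rewrite -!cmod_gt0 Fw0 F0'.
rewrite cmodM cmodV cmodM ltr_pdivrMr ?mulr_gt0 // cmodBC; apply: lt_le_trans w2 _.
have := ler_wpM2r (ltW F0') (ltW Fw); nra.
Qed.

Lemma cont_comp F G z : cont G z -> cont F (G z) -> cont (F \o G) z.
Proof.
move=> Gc Fc e e0; have [d d0 dP] := Fc _ e0; have [d' d'0 d'P] := Gc _ d0.
by exists d' => // w /d'P /dP.
Qed.

Lemma Re_sqrtc_ge0 (a : C) : 0 <= complex.Re (sqrtc a).
Proof. by case: a => a b; exact: sqrtr_ge0. Qed.

Lemma Re_sqrtc_gt0 (a : C) : 0 < complex.Re a -> 0 < complex.Re (sqrtc a).
Proof.
case: a => a b /= a0; rewrite sqrtr_gt0 divr_gt0 // ltr_wpDl // sqrtr_ge0.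
Qed.

(** Since the principal root has a non-negative real part,
[|sqrtc a + sqrtc b|] is at least [Re (sqrtc b)]; divide
[(sqrtc a) ^ 2 - (sqrtc b) ^ 2] by this sum. *)
Lemma sqrtc_cont (b : C) : 0 < complex.Re b -> cont (@sqrtc K) b.
Proof.
move=> /Re_sqrtc_gt0 b0 e e0; exists (e * complex.Re (sqrtc b)) => [|a ab].
  exact: mulr_gt0.
have : cmod (sqrtc a - sqrtc b) * cmod (sqrtc a + sqrtc b) = cmod (a - b).
  by rewrite -cmodM -subr_sqr !sqr_sqrtc.
have : complex.Re (sqrtc b) <= cmod (sqrtc a + sqrtc b).
  apply: le_trans (Re_le_cmod _); apply: le_trans (ler_norm _).
  by have := Re_sqrtc_ge0 a; move: (sqrtc a) (sqrtc b) => [p1 p2] [q1 q2] /=; lra.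
move=> H1 H2; rewrite -(ltr_pM2r b0); apply: le_lt_trans ab.
by rewrite -H2 ler_wpM2l ?cmod_ge0.
Qed.

(** Subdivide the radius from [z0] to [z].  By uniform continuity the ratios
of [F] at consecutive points lie in the right half-plane, where the principal
root is continuous; the root of [F z] is a root of [F z0] times the product of
the roots of these ratios. *)
Lemma disc_sqrt F z0 r : 0 < r ->
  (forall z, cdisc z0 r z -> cont F z /\ F z != 0) ->
  exists S : C -> C, forall z, disc z0 r z -> S z ^+ 2 = F z /\ cont S z.
Proof.
move=> r0 FP.
have [|m mD mP] := @disc_max K (fun z => - cmod (F z)) z0 r (ltW r0).
  move=> w /FP[Fc _] e /Fc[d d0 dP]; exists d => // v /dP vd.
  rewrite opprK addrC; apply: le_lt_trans vd.
  rewrite ler_norml; have := cmod_geB (F w) (F v).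
  by have := cmod_geB (F v) (F w); rewrite (cmodBC (F w)); lra.
have m0 : 0 < cmod (F m) by rewrite cmod_gt0; exact: (FP _ mD).2.
have {}mP z : cdisc z0 r z -> cmod (F m) <= cmod (F z).
  by move=> /mP; rewrite lerN2.
have [|d d0 dP] := @disc_unif K F z0 r (fun w wD => (FP w wD).1) (cmod (F m)).
  exact: m0.
pose n := Num.bound (r / d).
have n0 : 0 < n.+1%:R :> K by rewrite ltr0n.
have rn : r / n.+1%:R < d.
  rewrite ltr_pdivrMr // mulrC -ltr_pdivrMr //.
  have : r / d < n%:R by apply: archi_boundP; rewrite divr_ge0 // ltW.
  by move/lt_le_trans; apply; rewrite ler_nat.
pose p (j : nat) z := z0 + ((j%:R / n.+1%:R : K)%:C)%C * (z - z0).
have pD j z : (j <= n.+1)%N -> cdisc z0 r z -> cdisc z0 r (p j z).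
  move=> jn zD; rewrite /cdisc /= /p addrAC subrr add0r cmodM cmodR.
  rewrite ger0_norm ?divr_ge0 //; apply: le_trans zD; rewrite ler_piMl ?cmod_ge0 //.
  by rewrite ler_pdivrMr // mul1r ler_nat.
have pc j z : cont (p j) z.
  apply: (@jet_cont _ _ _ (0 + ((j%:R / n.+1%:R : K)%:C)%C * (1 - 0))).
  apply: jetD; first exact: jet_cst.
  by apply: jet_cM; apply: jetB; [exact: jet_id|exact: jet_cst].
pose q j z := F (p j.+1 z) / F (p j z).
have qRe j z : (j < n.+1)%N -> cdisc z0 r z -> 0 < complex.Re (q j z).
  move=> jn zD; have D1 := pD _ _ (ltnW jn) zD; have D2 := pD _ _ jn zD.
  have : cmod (F (p j.+1 z) - F (p j z)) < cmod (F m).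
    apply: dP => //; rewrite /p (_ : _ - _ = ((n.+1%:R^-1 : K)%:C)%C * (z - z0)).
      rewrite cmodM cmodR ger0_norm ?invr_ge0 //; apply: le_lt_trans rn.
      by rewrite mulrC ler_wpM2r // invr_ge0.
    have -> : (j.+1%:R / n.+1%:R : K) = n.+1%:R^-1 + j%:R / n.+1%:R.
      by rewrite -[j.+1%:R]natr1; ring.
    by rewrite rmorphD /=; ring.
  have F0 := (FP _ D1).2; have F0' : 0 < cmod (F (p j z)) by rewrite cmod_gt0.
  have -> : F (p j.+1 z) - F (p j z) = (q j z - 1) * F (p j z).
    by rewrite /q; field.
  rewrite cmodM => H; have : cmod (q j z - 1) < 1.
    rewrite -(ltr_pM2r F0') mul1r; apply: lt_le_trans H _; exact: mP.
  have := Re_le_cmod (q j z - 1); case: (q j z) => a b /=.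
  by rewrite ler_norml => /andP[]; lra.
pose S z := sqrtc (F z0) * \prod_(j < n.+1) sqrtc (q j z).
exists S => z zr; have zD : cdisc z0 r z by exact: ltW.
split.
  rewrite /S exprMn sqr_sqrtc -prodrXl.
  have H k : (k <= n.+1)%N -> F z0 * \prod_(j < k) sqrtc (q j z) ^+ 2 = F (p k z).
    elim: k => [_|k IH kn].
      by rewrite big_ord0 mulr1 /p mul0r rmorph0 mul0r addr0.
    rewrite big_ord_recr /= mulrA IH ?(ltnW kn) // sqr_sqrtc /q mulrC divfK //.
    by apply: (FP _ _).2; apply: pD => //; exact: ltnW.
  rewrite H // /p divff ?gt_eqF // rmorph1 mul1r addrC subrK //.
apply: contM; first by apply: (jet_cont (jet_cst _ _)).
have H k : (k <= n.+1)%N -> cont (fun z => \prod_(j < k) sqrtc (q j z)) z.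
  elim: k => [_|k IH kn].
    apply: (@jet_cont _ _ _ 0); apply: jet_near (jet_cst 1 z).
      exact: ltr01.
    by move=> w _; rewrite big_ord0.
  have H : cont (fun z => (\prod_(j < k) sqrtc (q j z)) * sqrtc (q k z)) z.
    apply: contM; first by apply: IH; exact: ltnW.
    apply: (@cont_comp (@sqrtc K) (q k)); last by apply: sqrtc_cont; exact: qRe.
    have D1 := pD _ _ (ltnW kn) zD; have D2 := pD _ _ kn zD.
    apply: contM; first by apply: (cont_comp (pc _ _)); exact: (FP _ D2).1.
    apply: contV; first exact: (FP _ D1).2.
    by apply: (cont_comp (pc _ _)); exact: (FP _ D1).1.
  move=> e /H[d' d'0 d'P]; exists d' => // w /d'P.
  by rewrite !big_ord_recr.
exact: H.
Qed.

(** Univalence of [H] on [D], with its inverse [g] as part of the data.  The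
last clause expresses that the image is open. *)
Definition conformal (D : set C) (H g : C -> C) := forall z, D z ->
  [/\ exists2 a, a != 0 & jet H z a, g (H z) = z, cont g (H z) &
      exists2 d, 0 < d & forall w, cmod (w - H z) < d -> H (g w) = w].

Lemma conformalS (D D' : set C) H g : D' `<=` D -> conformal D H g ->
  conformal D' H g.
Proof. by move=> DD' Hg z /DD' /Hg. Qed.

Lemma conformal_inv D H g z : conformal D H g -> D z ->
  exists a, jet g (H z) a.
Proof.
move=> Hg /Hg[[a a0 Ha] gH gc [d d0 dP]]; exists a^-1.
by apply: (@jet_linv _ H g (H z) a d); rewrite ?gH.
Qed.

Lemma conformal_deriv D H g : conformal D H g ->
  exists dH : C -> C, forall z, D z -> jet H z (dH z).
Proof.
move=> Hg; have key z : exists b, D z -> jet H z b.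
  have [zD|zD] := pselect (D z); last by exists 0.
  by have [[b _ Hb] _ _ _] := Hg _ zD; exists b.
by have [dH dHP] := choice key; exists dH.
Qed.

Lemma jet_uniq F z a b : jet F z a -> jet F z b -> a = b.
Proof.
move=> Fa Fb; apply/eqP; rewrite -subr_eq0 -cmod_eq0 eq_le cmod_ge0 andbT.
apply: (jet_coef_le (jetB Fa Fb)) => e e0; exists 1 => // h _.
by rewrite !subrr cmod0 add0r mulr_ge0 ?cmod_ge0 // ltW.
Qed.

Lemma near_disc z0 r z : disc z0 r z -> exists2 d, 0 < d &
  forall w, cmod (w - z) < d -> disc z0 r w.
Proof.
move=> zr; exists (r - cmod (z - z0)) => [|w]; first by rewrite subr_gt0.
by rewrite /disc /=; have := cmodDB w z0 z; lra.
Qed.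

(** Up to a factor [2], [c'] realises the distance from [H z0] to the omitted
values, so that all values in a disc around [H z0] of half that radius are
taken. *)
Lemma nearly_closest z0 R H g (c : C) : 0 < R -> conformal (disc z0 R) H g ->
  (forall z, disc z0 R z -> H z != c) ->
  exists c', [/\ forall z, disc z0 R z -> H z != c',
    cmod (H z0 - c') <= 2 * cmod (H z0 - c) &
    forall w, cmod (w - H z0) <= cmod (H z0 - c') / 2 ->
      exists2 z, disc z0 R z & H z = w].
Proof.
move=> R0 Hg Hc; have z0D : disc z0 R z0 by rewrite /disc /= subrr cmod0.
pose Om := [set c | forall z, disc z0 R z -> H z != c].
pose A := [set cmod (H z0 - c) | c in Om].
have [_ gH gc [d d0 dP]] := Hg _ z0D.
have [d' d'0 d'P] := gc _ R0.
pose m := Num.min d d'; have m0 : 0 < m by rewrite lt_min d0.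
have Am : lbound A m.
  move=> _ [v vO <-]; rewrite leNgt; apply/negP; rewrite cmodBC lt_min.
  move=> /andP[/dP Hv /d'P]; rewrite gH => gv.
  by move: (vO _ gv); rewrite Hv eqxx.
have hA : has_inf A.
  by split; [exists (cmod (H z0 - c)), c|exists m].
have iA : 0 < inf A by apply: (lt_le_trans m0); apply: lb_le_inf => //; case: hA.
have [x [c' c'O <-] xi] := @inf_adherent _ A (inf A) iA hA.
have ic : inf A <= cmod (H z0 - c) by apply: ge_inf; [case: hA|exists c].
exists c'; split=> // [|w wc]; first by lra.
apply/not_exists2P => wO.
have : inf A <= cmod (H z0 - w).
  apply: ge_inf; [by case: hA|exists w => // z zD].
  by apply/eqP => Hz; have [] := wO z.
by rewrite cmodBC; lra.
Qed.

Lemma IVT_zero (f : K -> K) :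
  (forall t : K, t \in `[0, 1]%R -> forall e, 0 < e -> exists2 d, 0 < d &
    forall t' : K, `|t' - t| < d -> `|f t' - f t| < e) ->
  0 < f 0 -> f 1 < 0 -> exists2 t : K, t \in `[0, 1]%R & f t = 0.
Proof.
move=> fc f0 f1; apply: IVT; first exact: ler01.
  apply: continuous_in_subspaceT => t /set_mem tD.
  apply/cvgrPdist_lt => e e0; have [d d0 dP] := fc t tD _ e0.
  exists d => // t' /=; rewrite distrC => /dP; by rewrite distrC.
by rewrite ge_min le_max (ltW f0) (ltW f1) orbT.
Qed.

(** [x + s] and [x - s] both have modulus [sqrt (|x| ^ 2 + |s| ^ 2)]. *)
Lemma sqr_dist_orth (s x : C) : complex.Re (x * s^*%C) = 0 ->
  cmod s ^+ 2 <= cmod (x ^+ 2 - s ^+ 2).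
Proof.
move=> xs; rewrite -(ler_pXn2r (n := 2)) ?nnegrE ?cmod_ge0 ?sqr_ge0 //.
have -> : x ^+ 2 - s ^+ 2 = (x - s) * (x + s) by ring.
rewrite cmodM (exprMn 2 (cmod (x - s))).
have -> : cmod (x - s) ^+ 2 = cmod x ^+ 2 + cmod s ^+ 2.
  rewrite !cmod_sqr; move: xs; case: x s => [x1 x2] [s1 s2] /= xs.
  lra.
have -> : cmod (x + s) ^+ 2 = cmod x ^+ 2 + cmod s ^+ 2.
  rewrite !cmod_sqr; move: xs; case: x s => [x1 x2] [s1 s2] /= xs.
  lra.
by have := sqr_ge0 (cmod x); have := sqr_ge0 (cmod s); nra.
Qed.

End Conformal.

(** * A distortion theorem for univalent functions *)

Section Distortion.
Variable K : realType.
Local Notation C := K[i].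
Implicit Types (z w x y h : C) (r s e d M : K) (F G E : C -> C).

(** If [S z] were very close to [- S z0], then [H z] would be close to [H z0],
and [g] could be followed along the segment between them.  Along this path [S]
goes from [S z0] to a point close to [- S z0], so it becomes orthogonal to
[S z0] somewhere; but there [S ^ 2] is too far from [(S z0) ^ 2]. *)
Lemma sqrt_avoids (H g S : C -> C) z0 R rho (c : C) : rho <= R ->
  0 < rho -> conformal (disc z0 R) H g ->
  (forall z, disc z0 R z -> H z != c) ->
  (forall w, cmod (w - H z0) <= cmod (H z0 - c) / 2 ->
     disc z0 rho (g w) /\ H (g w) = w) ->
  (forall z, disc z0 rho z -> S z ^+ 2 = H z - c /\ cont S z) ->
  forall z, disc z0 rho z -> cmod (S z0) <= 5 * cmod (S z + S z0).
Proof.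
move=> rR rho0 Hg Hc gD SP z zD; set s := S z0; rewrite leNgt; apply/negP => sz.
have z0D : disc z0 rho z0 by rewrite /disc /= subrr cmod0.
have DR w : disc z0 rho w -> disc z0 R w by move=> /lt_le_trans; apply.
have s2 : s ^+ 2 = H z0 - c := (SP _ z0D).1.
have s0 : s != 0.
  apply/eqP => sE; move: s2; rewrite sE expr0n /= => /esym/eqP.
  by rewrite subr_eq0; apply/negP/Hc/DR.
have s0' : 0 < cmod s by rewrite cmod_gt0.
have Hz : cmod (H z - H z0) < cmod (H z0 - c) / 2.
  have -> : H z - H z0 = (S z + s) * (S z - s).
    rewrite mulrC -subr_sqr s2 (SP _ zD).1; ring.
  rewrite cmodM -s2 cmodX.
  have : cmod (S z - s) <= cmod (S z + s) + 2 * cmod s.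
    have -> : S z - s = (S z + s) - 2 * s by ring.
    apply: le_trans (cmodB _ _) _; rewrite lerD2l cmodM.
    have -> : (2 : C) = ((2 : K)%:C)%C by rewrite rmorph_nat.
    by rewrite cmodR ger0_norm.
  by have := cmod_ge0 (S z + s); have := cmod_ge0 (S z - s); nra.
pose v (t : K) := H z0 + (t%:C)%C * (H z - H z0).
have vD (t : K) : t \in `[0, 1]%R -> cmod (v t - H z0) < cmod (H z0 - c) / 2.
  rewrite in_itv /= => /andP[t0 t1]; rewrite /v addrAC subrr add0r cmodM cmodR.
  rewrite ger0_norm //; apply: le_lt_trans Hz.
  by rewrite ler_piMl ?cmod_ge0.
have zeD t t01 := gD _ (ltW (vD t t01)).
have [t t01 tau0] : exists2 t : K, t \in `[0, 1]%R &
    complex.Re (S (g (v t)) * s^*%C) = 0.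
  apply: IVT_zero => [t t01 e e0||].
  - have [D1 HgE] := zeD t t01.
    have vc : exists2 d, 0 < d & forall t' : K, `|t' - t| < d ->
        cmod (S (g (v t')) - S (g (v t))) < e / cmod s.
      have e1 : 0 < e / cmod s by rewrite divr_gt0.
      have [d d0 dP] := (SP _ D1).2 _ e1.
      have [_ gH gc _] := Hg _ (DR _ D1).
      rewrite HgE in gH gc; have [d' d'0 d'P] := gc _ d0.
      have q0 : 0 < cmod (H z - H z0) + 1 by rewrite ltr_wpDl ?cmod_ge0.
      exists (d' / (cmod (H z - H z0) + 1)) => [|t']; first by rewrite divr_gt0.
      rewrite ltr_pdivlMr // => tt; apply: dP; apply: d'P.
      have -> : v t' - v t = ((t' - t)%:C)%C * (H z - H z0).
        by rewrite /v rmorphB /=; ring.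
      by rewrite cmodM cmodR; apply: le_lt_trans tt; rewrite ler_wpM2l // lerDl.
    have [d d0 dP] := vc; exists d => // t' /dP.
    rewrite ltr_pdivlMr //; apply: le_lt_trans.
    have -> : cmod s = cmod (s^*)%C.
      by rewrite /cmod !normc_def; case: (s) => a b /=; rewrite sqrrN.
    rewrite -cmodM; apply: le_trans (Re_le_cmod _); rewrite mulrBl.
    by case: (_ * _) (_ * _) => [a b] [a' b'] /=.
  - rewrite /v rmorph0 mul0r addr0; have [_ -> _ _] := Hg _ (DR _ z0D).
    rewrite -/s; move: s0'; rewrite -(ltr_pXn2r (n := 2)) ?nnegrE ?cmod_ge0 //.
    by rewrite cmod_sqr expr0n; case: (s) => a b /=; rewrite !expr2; lra.
  - rewrite /v rmorph1 mul1r addrC subrK; have [_ -> _ _] := Hg _ (DR _ zD).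
    have : complex.Re ((S z + s) * s^*%C) <= cmod (S z + s) * cmod s.
      have -> : cmod s = cmod (s^*)%C.
        by rewrite /cmod !normc_def; case: (s) => a b /=; rewrite sqrrN.
      by rewrite -cmodM; apply: le_trans (ler_norm _) (Re_le_cmod _).
    have : complex.Re ((S z + s) * s^*%C) =
        complex.Re (S z * s^*%C) + cmod s ^+ 2.
      by rewrite cmod_sqr; case: (s) (S z) => [a b] [a' b'] /=; ring.
    by have := cmod_ge0 (S z + s); nra.
have [D1 HgE] := zeD t t01.
have := sqr_dist_orth tau0; rewrite (SP _ D1).1 HgE s2 -cmodX s2.
have -> : v t - c - (H z0 - c) = v t - H z0 by ring.
have := vD _ t01; have := cmod_ge0 (H z0 - c).
by lra.
Qed.

(** Koebe's one-quarter theorem with a worse constant.  Apply the Schwarz lemma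
to [T = (S - S z0) / (S + S z0)], where [S ^ 2 = H - c'] and [c'] is an almost
closest omitted value: [T] is bounded by [11], and its derivative at [z0] is
that of [H] divided by [4 (H z0 - c')]. *)
Theorem covering (H g : C -> C) z0 R (a c : C) : 0 < R ->
  conformal (disc z0 R) H g -> jet H z0 a ->
  (forall z, disc z0 R z -> H z != c) ->
  cmod a * R <= 176 * cmod (H z0 - c).
Proof.
move=> R0 Hg Ha Hc.
have [c' [Hc' c'c c'D]] := nearly_closest R0 Hg Hc.
have [||w0 w0D w0P] := @disc_max K (fun w => cmod (g w - z0)) (H z0)
    (cmod (H z0 - c') / 2).
- by rewrite divr_ge0 ?cmod_ge0.
- move=> w /c'D[z zD <-] e e0; have [_ gH gc _] := Hg _ zD.
  have [d d0 dP] := gc _ e0; exists d => // v /dP; apply: le_lt_trans.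
  have := cmod_geB (g v - z0) (g (H z) - z0).
  have := cmod_geB (g (H z) - z0) (g v - z0).
  rewrite (cmodBC (g (H z) - z0)) (_ : g v - z0 - _ = g v - g (H z)); last by ring.
  by rewrite ler_norml; lra.
have gw0 : cmod (g w0 - z0) < R.
  by have [z zD zE] := c'D _ w0D; have [_ gH _ _] := Hg _ zD; rewrite -zE gH.
(* A smaller closed disc, on which [H - c'] is continuous and bounded away from
   0, but which still contains the image under [g] of the disc of radius
   [|H z0 - c'| / 2]. *)
pose rho := (Num.max (cmod (g w0 - z0)) (R / 2) + R) / 2.
have mR : Num.max (cmod (g w0 - z0)) (R / 2) < R by rewrite gt_max gw0; lra.
have rhoR : rho < R by rewrite /rho; lra.
have : Num.max (cmod (g w0 - z0)) (R / 2) < rho by rewrite /rho; lra.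
rewrite gt_max => /andP[rho1 rho2].
have rho0 : 0 < rho by lra.
have gD w : cmod (w - H z0) <= cmod (H z0 - c') / 2 ->
    disc z0 rho (g w) /\ H (g w) = w.
  move=> wD; split; first by apply: le_lt_trans (w0P _ wD) rho1.
  by have [z zD <-] := c'D _ wD; have [_ -> _ _] := Hg _ zD.
have DR w : disc z0 rho w -> disc z0 R w by move=> /lt_trans; apply.
have [|S SP] := @disc_sqrt K (fun z => H z - c') z0 rho rho0.
  move=> z zD; have zR : disc z0 R z by apply: le_lt_trans rhoR.
  split; last by rewrite subr_eq0 Hc'.
  have [[b _ Hb] _ _ _] := Hg _ zR.
  exact: (jet_cont (jetB Hb (jet_cst _ _))).
have av := sqrt_avoids (ltW rhoR) rho0 Hg Hc' gD SP.
have z0D : disc z0 rho z0 by rewrite /disc /= subrr cmod0.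
have Sn0 z : disc z0 rho z -> S z != 0.
  move=> zD; apply/eqP => sE; have := (SP _ zD).1.
  by rewrite sE expr0n /= => /esym/eqP; rewrite subr_eq0; apply/negP/Hc'/DR.
have s0' : 0 < cmod (S z0) by rewrite cmod_gt0 Sn0.
have Sj z b : disc z0 rho z -> jet H z b -> jet S z (b / (2 * S z)).
  move=> zD Hb; have [d d0 dP] := near_disc zD.
  apply: (@jet_sqrt K S (fun z => H z - c') z b d) => //.
  - by move=> w /dP /SP[].
  - exact: Sn0.
  - by have [] := SP _ zD.
  - by have := jetB Hb (jet_cst c' z); rewrite subr0.
have SS z : disc z0 rho z -> S z + S z0 != 0.
  by move=> /av; rewrite -cmod_gt0; lra.
pose T z := (S z - S z0) / (S z + S z0).
have Tj z b : disc z0 rho z -> jet H z b -> jet T z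
    (((b / (2 * S z) - 0) * (S z + S z0) - (S z - S z0) * (b / (2 * S z) + 0))
       / (S z + S z0) ^+ 2).
  move=> zD /(Sj _ _ zD) Sb; apply: jet_div; first exact: SS.
    by apply: jetB => //; exact: jet_cst.
  by apply: jetD => //; exact: jet_cst.
have T0 : T z0 = 0 by rewrite /T subrr mul0r.
have n2 : (2 : C) = ((2 : K)%:C)%C by rewrite rmorph_nat.
have schw : forall z, disc z0 rho z -> cmod (T z - T z0) <= 11 * (cmod (z - z0) / rho).
  apply: schwarz => // [z zD|z zD].
    by have [[b _ Hb] _ _ _] := Hg _ (DR _ zD); eexists; apply: Tj Hb.
  have Sp : 0 < cmod (S z + S z0) by rewrite cmod_gt0 SS.
  rewrite T0 subr0 /T cmodM cmodV ler_pdivrMr //.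
  have -> : S z - S z0 = (S z + S z0) - 2 * S z0 by ring.
  apply: le_trans (cmodB _ _) _; rewrite cmodM n2 cmodR ger0_norm //.
  by have := av _ zD; lra.
have := @jet_coef_le K T z0 _ (11 / rho) (Tj _ _ z0D Ha).
have -> : ((a / (2 * S z0) - 0) * (S z0 + S z0) - (S z0 - S z0) * (a / (2 * S z0) + 0))
       / (S z0 + S z0) ^+ 2 = a / (2 * (2 * (S z0 ^+ 2))).
  field; rewrite Sn0 //=; apply/negP => /eqP E.
  have := SS _ z0D; by rewrite E eqxx.
rewrite (SP _ z0D).1 !cmodM cmodV !cmodM n2 cmodR ger0_norm // => H0.
have H1 : cmod a / (2 * (2 * cmod (H z0 - c'))) <= 11 / rho.
  apply: H0 => e e0; exists rho => // h hr.
  have := schw (z0 + h); rewrite /disc /= addrAC subrr add0r => /(_ hr).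
  by have := mulr_ge0 (ltW e0) (cmod_ge0 h); lra.
have k0 : 0 < cmod (H z0 - c') by rewrite -(SP _ z0D).1 cmodX exprn_gt0.
move: H1; rewrite ler_pdivrMr; last lra.
rewrite mulrAC ler_pdivlMr // => H1.
have := cmod_ge0 a; nra.
Qed.

(** Otherwise the inverse of [H] would map a disc of radius [2 |a| R] into a
disc of radius [R], and by the Schwarz lemma its derivative at [H z0] would be
at most half of what it is. *)
Lemma omitted_value (H g : C -> C) z0 R (a : C) : 0 < R ->
  conformal (disc z0 R) H g -> jet H z0 a ->
  exists2 c, forall z, disc z0 R z -> H z != c & cmod (H z0 - c) <= 2 * cmod a * R.
Proof.
move=> R0 Hg Ha; apply/not_exists2P => nc.
have z0D : disc z0 R z0 by rewrite /disc /= subrr cmod0.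
have [[a' a'0 Ha'] gH gc _] := Hg _ z0D.
have aa' := jet_uniq Ha Ha'; have a0 : 0 < cmod a by rewrite aa' cmod_gt0.
pose s := 2 * cmod a * R; have s0 : 0 < s by rewrite /s !mulr_gt0.
have onto w : cmod (w - H z0) < s -> exists2 z, disc z0 R z & H z = w.
  move=> ws; have [Hw|] := nc w; last by rewrite cmodBC -/s; lra.
  apply: contrapT => nonzero_at; apply: Hw => z zD; apply/eqP => zw; apply: nonzero_at.
  by exists z.
have schw : forall w, cmod (w - H z0) < s ->
    cmod (g w - g (H z0)) <= R * (cmod (w - H z0) / s).
  apply: schwarz => // [|w /onto[z zD <-]|w /onto[z zD <-]]; first exact: ltW.
    exact: conformal_inv Hg zD.
  by rewrite gH; have [_ -> _ _] := Hg _ zD; exact: ltW.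
have [d d0 dP] := jet_cont Ha s0.
have : 1 <= R / s * cmod a.
  apply: (@jet_coef_ge K H z0 a (R / s) (Num.min d R)) => //.
  - by rewrite divr_ge0 // ltW.
  - by rewrite lt_min d0.
  move=> h; rewrite lt_min => /andP[hd hR].
  have := dP (z0 + h); rewrite addrAC subrr add0r => /(_ hd)/schw.
  rewrite gH; have [|_ -> _ _] := Hg (z0 + h).
    by rewrite /disc /= addrAC subrr add0r.
  by rewrite addrAC subrr add0r mulrA mulrAC.
rewrite /s mulrAC ler_pdivlMr // -/s; rewrite /s; nra.
Qed.

(** With [c] an omitted value close to [H z0], [covering] on the disc of radius
[R / 2] around each point [w] bounds [|H' w|] by a multiple of
[|H w - c| / R]. *)
Theorem distortion (H g : C -> C) z0 R (a z b : C) : 0 < R ->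
  conformal (disc z0 R) H g -> jet H z0 a -> disc z0 (R / 2) z -> jet H z b ->
  cmod b <= 704 * expR 176 * cmod a.
Proof.
move=> R0 Hg Ha zR Hb.
have [c cO ca] := omitted_value R0 Hg Ha.
have R2 : 0 < R / 2 by rewrite divr_gt0.
have DR w : disc z0 (R / 2) w -> disc z0 R w by move=> wD; apply: lt_trans wD _; lra.
have cov w b' : disc z0 (R / 2) w -> jet H w b' ->
    cmod b' * (R / 2) <= 176 * cmod (H w - c).
  move=> wD Hb'; apply: covering R2 _ Hb' _.
    apply: conformalS Hg => v; rewrite /disc /= => vw.
    by have := cmodDB v z0 w; move: wD; rewrite /disc /=; lra.
  move=> v; rewrite /disc /= => vw; apply: cO.
  by have := cmodDB v z0 w; move: wD; rewrite /disc /=; lra.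
have [dH dHP] := conformal_deriv Hg.
have gr : cmod (H z - c) <= expR 176 * cmod (H z0 - c).
  apply: (@gronwall_disc K (fun w => H w - c) dH z0 (R / 2)) => // w wD.
  split; last by apply: cov => //; exact/dHP/DR.
  by have := jetB (dHP _ (DR _ wD)) (jet_cst c w); rewrite subr0.
rewrite -(ler_pM2r R2); apply: le_trans (cov _ _ zR Hb) _.
have := ler_wpM2l (expR_ge0 176) ca; nra.
Qed.

End Distortion.

(** * Rational maps in homogeneous coordinates *)

Section Rational.
Variable K : realType.
Local Notation C := K[i].
Implicit Types (z w x y t h : C) (A B p q : {poly C}) (F : ratmap K).

(** The point [[x : y]] of the projective line. *)
Definition hpoint x y : sphere K := if y == 0 then infty else fin (x / y).

Definition nonzero_at A B t := (A.[t] != 0) || (B.[t] != 0).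

(** Up to the factors [B ^ 2] and [- A ^ 2], the derivative of [A / B] and of
[B / A]. *)
Definition wronskian A B : {poly C} := deriv A * B - A * deriv B.

(** The homogenisation of [p] in degree [d] at [(A, B)]; it allows one to
follow an orbit through infinity. *)
Definition homog p d A B : {poly C} :=
  \sum_(i < d.+1) p`_i *: (A ^+ i * B ^+ (d - i)).

Lemma homog_horner p d A B t : (homog p d A B).[t] =
  \sum_(i < d.+1) p`_i * (A.[t] ^+ i * B.[t] ^+ (d - i)).
Proof.
by rewrite horner_sum; apply: eq_bigr => i _; rewrite hornerZ hornerM !horner_exp.
Qed.

Lemma homog_fin p d A B t : (size p <= d.+1)%N -> B.[t] != 0 ->
  (homog p d A B).[t] = B.[t] ^+ d * p.[A.[t] / B.[t]].
Proof.
move=> sp B0; rewrite homog_horner (horner_coef_wide _ sp) big_distrr /=.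
apply: eq_bigr => i _; rewrite expr_div_n [RHS]mulrCA; congr (_ * _).
have -> : B.[t] ^+ d = B.[t] ^+ (d - i) * B.[t] ^+ i.
  by rewrite -exprD subnK // -ltnS.
move: (B.[t] ^+ i) (expf_neq0 i B0) (A.[t] ^+ i) (B.[t] ^+ (d - i)).
by move=> b b0 a c; field.
Qed.

Lemma homog_inf p d A B t : B.[t] = 0 ->
  (homog p d A B).[t] = p`_d * A.[t] ^+ d.
Proof.
move=> B0; rewrite homog_horner big_ord_recr /= subnn expr0 mulr1 big1 ?add0r //.
by move=> i _; rewrite B0 expr0n subn_eq0 leqNgt ltn_ord /= !mulr0.
Qed.

Lemma size_num_le F : (size (ratnum F) <= (degree F).+1)%N.
Proof. by rewrite /degree (leq_trans (leq_maxl _ (size (ratden F)))) // leqSpred. Qed.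

Lemma size_den_le F : (size (ratden F) <= (degree F).+1)%N.
Proof. by rewrite /degree (leq_trans (leq_maxr (size (ratnum F)) _)) // leqSpred. Qed.

Lemma ratmap_coprime F : coprimep (ratnum F) (ratden F).
Proof. by case: F. Qed.

Lemma ratmap_nonzero F t : nonzero_at (ratnum F) (ratden F) t.
Proof.
rewrite /nonzero_at -negb_and; apply/negP => /andP[p0 q0].
have := coprimep_root (ratmap_coprime F) p0.
by rewrite (eqP q0) eqxx.
Qed.

Lemma ratmap_nonzero_inf F :
  ((ratnum F)`_(degree F) != 0) || ((ratden F)`_(degree F) != 0).
Proof.
have pq0 : (ratnum F != 0) || (ratden F != 0).
  by apply: contraTT (ratmap_nonzero F 0); rewrite !negb_or !negbK => /andP[/eqP-> /eqP->];
     rewrite !horner0 eqxx.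
rewrite /degree; case: (leqP (size (ratnum F)) (size (ratden F))) => s.
  rewrite -lead_coefE lead_coef_eq0.
  apply/orP; right; move: pq0; rewrite -!size_poly_gt0 => /orP[] // /leq_trans.
  exact.
rewrite -lead_coefE lead_coef_eq0 -size_poly_gt0; apply/orP; left.
exact: leq_ltn_trans s.
Qed.

Lemma ratfun_homog F A B t : nonzero_at A B t ->
  let d := degree F in
  let A' := homog (ratnum F) d A B in let B' := homog (ratden F) d A B in
  nonzero_at A' B' t /\ ratfun F (hpoint A.[t] B.[t]) = hpoint A'.[t] B'.[t].
Proof.
move=> ABt d A' B'; rewrite /nonzero_at /hpoint; have [B0|B0] := eqVneq B.[t] 0.
  have A0 : A.[t] != 0 by move: ABt; rewrite /nonzero_at B0 eqxx orbF.
  rewrite /A' /B' !homog_inf // !mulf_eq0 !negb_or expf_neq0 // !andbT.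
  split; first exact: ratmap_nonzero_inf.
  rewrite /ratfun /= (negbTE (expf_neq0 _ A0)) orbF; case: eqP => // _.
  congr (fin _); rewrite -mulf_div divff ?mulr1 // expf_neq0 //.
rewrite /A' /B' !homog_fin ?size_num_le ?size_den_le //.
rewrite !mulf_eq0 !negb_or expf_neq0 //=.
split; first exact: ratmap_nonzero.
rewrite /ratfun /= (negbTE (expf_neq0 _ B0)) /=; case: eqP => // _.
congr (fin _); rewrite -mulf_div divff ?mul1r // expf_neq0 //.
Qed.

(** Euler's relation for homogeneous polynomials. *)
Lemma homog_deriv p d A B t (l : C) :
  (deriv A).[t] = l * A.[t] -> (deriv B).[t] = l * B.[t] ->
  (deriv (homog p d A B)).[t] = d%:R * l * (homog p d A B).[t].
Proof.
move=> Al Bl.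
have E (Q : {poly C}) n : (deriv Q).[t] = l * Q.[t] ->
    (deriv (Q ^+ n)).[t] = n%:R * l * Q.[t] ^+ n.
  move=> Ql; rewrite deriv_exp hornerMn hornerM Ql horner_exp; case: n => [|n] /=.
    by rewrite mulr0n mul0r mul0r.
  by rewrite exprS -mulr_natl; ring.
rewrite homog_horner /homog linear_sum /= horner_sum big_distrr /=; apply: eq_bigr => i _.
rewrite derivZ derivM hornerZ hornerD !hornerM !E // !horner_exp.
have -> : d%:R = i%:R + (d - i)%:R :> C by rewrite -natrD subnKC // -ltnS.
ring.
Qed.

Lemma wronskian_dep A B t : nonzero_at A B t -> (wronskian A B).[t] = 0 ->
  exists l, (deriv A).[t] = l * A.[t] /\ (deriv B).[t] = l * B.[t].
Proof.
rewrite /wronskian hornerD hornerN !hornerM => /orP[A0|B0] /eqP; rewrite subr_eq0 => /eqP W.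
  exists ((deriv A).[t] / A.[t]); rewrite divfK //; split=> //.
  by rewrite mulrAC W; field.
exists ((deriv B).[t] / B.[t]); rewrite divfK //; split=> //.
by rewrite mulrAC [_ * A.[t]]mulrC -W; field.
Qed.

(** At a zero of the Wronskian the derivatives of [A] and [B] are proportional
to [A] and [B] with the same factor, and by Euler's relation this persists: a
critical point stays critical after composition. *)
Lemma wronskian_homog p q d A B t : nonzero_at A B t -> (wronskian A B).[t] = 0 ->
  (wronskian (homog p d A B) (homog q d A B)).[t] = 0.
Proof.
move=> /wronskian_dep ABt /ABt[l [Al Bl]].
rewrite /wronskian hornerD hornerN !hornerM (homog_deriv p d Al Bl) (homog_deriv q d Al Bl).
ring.
Qed.

Lemma word_map_poly u (f : 'I_u -> ratmap K) (w : seq 'I_u) A B :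
  (forall t, nonzero_at A B t) -> exists A' B', forall t,
  [/\ nonzero_at A' B' t, word_map f w (hpoint A.[t] B.[t]) = hpoint A'.[t] B'.[t] &
      (wronskian A B).[t] = 0 -> (wronskian A' B').[t] = 0].
Proof.
elim: w A B => [|i w IH] A B ABt; first by exists A, B.
pose d := degree (f i).
pose A1 := homog (ratnum (f i)) d A B; pose B1 := homog (ratden (f i)) d A B.
have [|A' [B' H]] := IH A1 B1.
  by move=> t; have [] := ratfun_homog (f i) (ABt t).
exists A', B' => t; have [h1 h2 h3] := H t.
split=> // [|W]; last by apply/h3/wronskian_homog.
by rewrite /word_map /= (ratfun_homog (f i) (ABt t)).2; exact: h2.
Qed.

Lemma jet_is_derive (G : C -> C) z (a : C) : jet G z a -> is_derive z 1 G a.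
Proof.
move=> Ga.
have cv : (h : C)^-1 *: (G (h *: 1 + z) - G z) @[h --> 0^'] --> a.
  move=> P /nbhs_cmodP[e e0 eP]; rewrite nbhs_simpl.
  have e2 : 0 < e / 2 by rewrite divr_gt0.
  have [d d0 dP] := jet_diff Ga e2.
  change (nbhs 0 (fun h : C => h != 0 -> P (h^-1 *: (G (h *: 1 + z) - G z)))).
  apply/nbhs_cmodP; exists d => // h; rewrite subr0 => /dP hd h0; apply: eP.
  have h0' : 0 < cmod h by rewrite cmod_gt0.
  rewrite -(ltr_pM2r h0') -cmodM.
  rewrite (_ : _ * h = G (z + h) - G z - a * h); last first.
    rewrite [h *: (1 : C)]mulr1 [h + z]addrC /GRing.scale /=.
    by rewrite mulrBl mulrAC mulVf // mul1r.
  by apply: le_lt_trans hd _; rewrite ltr_pM2r // ltr_pdivrMr // ltr_pMr // ltr1n.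
apply: DeriveDef; last exact: cvg_lim cv.
by apply/cvg_ex; exists a.
Qed.

End Rational.

(** * Critical points, the post-critical set and local inverses *)

Section Critical.
Variable K : realType.
Local Notation C := K[i].
Implicit Types (z w x y t h : C) (A B p q : {poly C}) (F : ratmap K).

Lemma cont_lower (P : C -> C) z : cont P z -> P z != 0 ->
  exists2 d : K, 0 < d &
    forall w, cmod (w - z) < d -> cmod (P z) / 2 < cmod (P w).
Proof.
move=> Pc; rewrite -cmod_gt0 => P0.
have P2 : 0 < cmod (P z) / 2 by rewrite divr_gt0.
have [d d0 dP] := Pc _ P2; exists d => // w /dP.
by have := cmod_geB (P z) (P w); rewrite cmodBC; lra.
Qed.

Lemma cont_neq0 (G : C -> C) z : cont G z -> G z != 0 ->
  exists2 d : K, 0 < d & forall w, cmod (w - z) < d -> G w != 0.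
Proof.
move=> Gc G0; have [d d0 dP] := cont_lower Gc G0.
exists d => // w /dP; rewrite -cmod_gt0; apply: le_lt_trans.
by rewrite divr_ge0 ?cmod_ge0.
Qed.

Lemma critical_wronskian (g : sphere K -> sphere K) (c : sphere K) A B :
  (forall t, nonzero_at A B t /\ g (chart_inv c t) = hpoint A.[t] B.[t]) ->
  critical g c <-> (wronskian A B).[chart c c] = 0.
Proof.
move=> gAB; set t0 := chart c c.
have cE : chart_inv c t0 = c by rewrite /t0; case: (c) => //=; rewrite eqxx.
have [nz0 gc] := gAB t0; rewrite cE in gc.
pose G := (chart (g c) \o g \o chart_inv c : C -> C).
have [s [s0 Gj]] : exists s : C, s != 0 /\ jet G t0 (s * (wronskian A B).[t0]).
  have [B0|B0] := eqVneq B.[t0] 0.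
    have A0 : A.[t0] != 0 by move: nz0; rewrite /nonzero_at B0 eqxx orbF.
    exists (- (A.[t0] ^+ 2)^-1); rewrite oppr_eq0 invr_eq0 expf_neq0 //; split=> //.
    have := jet_div A0 (jet_poly B t0) (jet_poly A t0).
    have -> : ((deriv B).[t0] * A.[t0] - B.[t0] * (deriv A).[t0]) / A.[t0] ^+ 2 =
        - (A.[t0] ^+ 2)^-1 * (wronskian A B).[t0].
      by rewrite /wronskian hornerD hornerN !hornerM; ring.
    have [d d0 dP] := cont_neq0 (jet_cont (jet_poly A t0)) A0.
    apply: jet_near d0 _ => w /dP Aw.
    rewrite /G /= gc /hpoint B0 eqxx (gAB w).2 /hpoint /=.
    by case: eqP => [->|_] /=; rewrite ?mul0r ?invf_div.
  exists (B.[t0] ^+ 2)^-1; rewrite invr_eq0 expf_neq0 //; split=> //.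
  have := jet_div B0 (jet_poly A t0) (jet_poly B t0).
  have -> : ((deriv A).[t0] * B.[t0] - A.[t0] * (deriv B).[t0]) / B.[t0] ^+ 2 =
      (B.[t0] ^+ 2)^-1 * (wronskian A B).[t0].
    by rewrite /wronskian hornerD hornerN !hornerM; ring.
  have [d d0 dP] := cont_neq0 (jet_cont (jet_poly B t0)) B0.
  apply: jet_near d0 _ => w /dP Bw.
  by rewrite /G /= gc /hpoint (negbTE B0) (gAB w).2 /hpoint (negbTE Bw).
have Gd := jet_is_derive Gj.
split=> [cr|W]; last first.
  by rewrite W mulr0 in Gd.
have Gd0 : is_derive t0 1 G 0 := cr.
have := @derive_val _ _ _ _ _ _ _ Gd0.
rewrite (@derive_val _ _ _ _ _ _ _ Gd) => /eqP.
by rewrite mulf_eq0 (negbTE s0) /= => /eqP.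
Qed.

Lemma chart_inv_hpoint (c : sphere K) : exists A B, forall t,
  nonzero_at A B t /\ chart_inv c t = hpoint A.[t] B.[t].
Proof.
case: c => [c|].
  exists 'X, 1 => t; rewrite /nonzero_at /hpoint !hornerE oner_eq0 orbT divr1.
  by split.
exists 1, 'X => t; rewrite /nonzero_at /hpoint !hornerE oner_eq0 ?div1r ?mul1r.
by split.
Qed.

Lemma critical_cat u (f : 'I_u -> ratmap K) (v w : seq 'I_u) c :
  critical (word_map f v) c -> critical (word_map f (v ++ w)) c.
Proof.
have [A0 [B0 AB0]] := chart_inv_hpoint c.
have [A1 [B1 AB1]] := word_map_poly f v (fun t => (AB0 t).1).
have [|A2 [B2 AB2]] := @word_map_poly _ _ f w A1 B1.
  by move=> t; have [] := AB1 t.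
have c1 : forall t, nonzero_at A1 B1 t /\ word_map f v (chart_inv c t) = hpoint A1.[t] B1.[t].
  by move=> t; have [] := AB1 t; rewrite (AB0 t).2.
have c2 : forall t, nonzero_at A2 B2 t /\
    word_map f (v ++ w) (chart_inv c t) = hpoint A2.[t] B2.[t].
  move=> t; have [h1 h2 _] := AB2 t; split=> //.
  by rewrite /word_map foldl_cat -/(word_map f v _) (c1 t).2.
move=> /(critical_wronskian c1) W; apply/(critical_wronskian c2).
by have [_ _] := AB2 (chart c c); apply.
Qed.

Lemma word_map_cat u (f : 'I_u -> ratmap K) (v w : seq 'I_u) (z : sphere K) :
  word_map f (v ++ w) z = word_map f w (word_map f v z).
Proof. by rewrite /word_map foldl_cat. Qed.

Lemma PCV_forward u (f : 'I_u -> ratmap K) (v w : seq 'I_u) c : v <> [::] ->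
  critical (word_map f v) c -> PCV f (word_map f w (word_map f v c)).
Proof.
move=> v0 cr; apply: subset_closure; exists (word_map f (v ++ w)).
  by exists (v ++ w) => //= /eqP; case: (v) v0.
exists c; first exact: critical_cat.
by rewrite word_map_cat.
Qed.

Lemma PCV_value u (f : 'I_u -> ratmap K) (w : seq 'I_u) c : w <> [::] ->
  critical (word_map f w) c -> PCV f (word_map f w c).
Proof. exact: (@PCV_forward _ f w [::]). Qed.

Lemma coef_derivM_top p q m : (size p <= m.+3)%N -> (size q <= m.+3)%N ->
  (deriv p * q)`_(m.+1.*2) = m.+1%:R * p`_m.+1 * q`_m.+2 + m.+2%:R * p`_m.+2 * q`_m.+1.
Proof.
move=> sp sq; rewrite coefM.
have lt1 : (m < m.+1.*2.+1)%N by lia.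
have lt2 : (m.+1 < m.+1.*2.+1)%N by lia.
rewrite (bigD1 (Ordinal lt1)) //= (bigD1 (Ordinal lt2)) /=; last first.
  by apply/eqP => /(congr1 (@nat_of_ord _)) /=; lia.
rewrite big1 ?addr0 => [|i /andP[i1 i2]].
  rewrite !coef_deriv.
  have -> : (m.+1.*2 - m = m.+2)%N by lia.
  have -> : (m.+1.*2 - m.+1 = m.+1)%N by lia.
  by rewrite !mulr_natl.
have [im|mi] := ltnP i m.
  rewrite [q`__]nth_default ?mulr0 //; apply: leq_trans sq _; clear -im; lia.
rewrite coef_deriv [p`__]nth_default ?mul0rn ?mul0r //.
have : (i : nat) != m by apply: contra i1 => /eqP E; apply/eqP/val_inj.
have : (i : nat) != m.+1 by apply: contra i2 => /eqP E; apply/eqP/val_inj.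
by move=> H1 H2; apply: leq_trans sp _; clear -mi H1 H2; lia.
Qed.

(** If the Wronskian [W] has a root, the root is critical.  Otherwise [W] is
constant, so its coefficient of degree [2 d - 2] vanishes; up to sign this
coefficient is the value at [0] of the Wronskian in the coordinate [1 / z], and
infinity is critical. *)
Lemma critical_exists F : (2 <= degree F)%N -> exists c, critical (ratfun F) c.
Proof.
move=> d2; pose W := wronskian (ratnum F) (ratden F).
have [/closed_rootP[t Wt]|/negPn W1] := boolP (size W != 1).
  exists (fin t); apply/(@critical_wronskian _ _ (ratnum F) (ratden F)).
    by move=> s; split=> //; exact: ratmap_nonzero.
  exact/eqP.
exists infty; pose d := degree F.
pose A := homog (ratnum F) d 1 'X; pose B := homog (ratden F) d 1 'X.
have nz1 (t : C) : nonzero_at 1 'X t by rewrite /nonzero_at !hornerE oner_eq0.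
apply/(@critical_wronskian _ _ A B) => [t|/=].
  have [h1 h2] := ratfun_homog F (nz1 t); split=> //.
  by rewrite -h2 /hpoint !hornerE ?div1r ?mul1r.
have v0 p : (homog p d 1 'X).[0] = p`_d.
  by rewrite homog_inf ?hornerX // hornerE expr1n mulr1.
case dE : d => [|[|m]]; first by move: d2; rewrite -/d dE.
  by move: d2; rewrite -/d dE.
have v1 p : (deriv (homog p d 1 'X)).[0] = p`_m.+1.
  rewrite horner_coef0 coef_deriv mulr1n /homog coef_sum.
  have lt1 : (m.+1 < d.+1)%N by rewrite dE; lia.
  rewrite (bigD1 (Ordinal lt1)) //= big1 ?addr0 => [|i i1].
    by rewrite expr1n mul1r coefZ coefXn dE (_ : (_ - _ = 1)%N) ?mulr1 //; lia.
  rewrite expr1n mul1r coefZ coefXn; case: eqP => [E|_]; last by rewrite mulr0.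
  case/negP: i1; apply/eqP/val_inj => /=.
  by have := ltn_ord i; move: E dE; move: (nat_of_ord i) => k; clear; lia.
have := size_num_le F; have := size_den_le F; rewrite -/d dE => sq sp.
have : W`_(m.+1.*2) = 0 by rewrite nth_default // (eqP W1); lia.
rewrite /W /wronskian coefB coef_derivM_top // [ratnum F * _]mulrC coef_derivM_top //.
rewrite /A /B hornerD hornerN !hornerM -/d !v0 !v1 dE.
rewrite -[m.+2%:R]natr1 => H; rewrite -[RHS]oppr0 -[in RHS]H; ring.
Qed.

(** [p] is a critical value of an element of degree at least two. *)
Lemma PCV_point u (f : 'I_u -> ratmap K) : fundamental_assumption f ->
  exists p : sphere K, forall w : seq 'I_u, PCV f (word_map f w p).
Proof.
move=> [[g [v v0 <-] [d [F vF dF] d2]] _ _ _].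
have [c cr] : exists c, critical (ratfun F) c by apply: critical_exists; rewrite dF.
by exists (word_map f v c) => w; apply: PCV_forward; rewrite ?vF.
Qed.

(** Strict differentiability; both points move, as injectivity near a point
requires. *)
Lemma strict_poly p (w0 : C) (e : K) : 0 < e -> exists2 d, 0 < d & forall x y,
  cmod (x - w0) < d -> cmod (y - w0) < d ->
  cmod (p.[x] - p.[y] - (deriv p).[w0] * (x - y)) <= e * cmod (x - y).
Proof.
elim/poly_ind: p e => [|p c IH] e e0.
  exists 1 => // x y _ _; rewrite deriv0 !horner0 mul0r !subr0 cmod0.
  by rewrite mulr_ge0 ?cmod_ge0 // ltW.
pose q := 2 * (cmod w0 + 1) * 2; have q0 : 0 < q.
  by rewrite /q; have := cmod_ge0 w0; lra.
have e2 : 0 < e / q by rewrite divr_gt0.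
have [d d0 dP] := IH _ e2.
pose M := cmod (deriv p).[w0] + 1; have M0 : 0 < M.
  by rewrite /M; have := cmod_ge0 (deriv p).[w0]; lra.
have eM : 0 < e / (4 * M) by rewrite divr_gt0 // mulr_gt0.
have e4 : 0 < e / 4 by rewrite divr_gt0.
have [d1 d10 d1P] := jet_cont (jet_poly p w0) e4.
exists (Num.min (Num.min d 1) (Num.min d1 (e / (4 * M)))) => [|x y].
  by rewrite !lt_min d0 ltr01 d10.
rewrite !lt_min => /andP[/andP[xd x1] /andP[xd1 xM]] /andP[/andP[yd y1] /andP[yd1 _]].
have := dP _ _ xd yd; have := d1P _ yd1.
set P := (deriv p).[w0]; set px := p.[x]; set py := p.[y].
move=> H1 H2; rewrite !hornerE derivMXaddC !hornerE -/P.
have -> : px * x + c - (py * y + c) - (p.[w0] + P * w0) * (x - y) =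
   (px - py - P * (x - y)) * x + ((py - p.[w0]) * (x - y) + P * (x - w0) * (x - y)).
  by ring.
have xb : cmod x <= cmod w0 + 1.
  by have := cmod_geB x w0; lra.
apply: le_trans (cmodD _ _) _; rewrite cmodM.
have := cmodD ((py - p.[w0]) * (x - y)) (P * (x - w0) * (x - y)); rewrite !cmodM => H3.
have PM : cmod P * cmod (x - w0) <= e / 4.
  move: xM; rewrite ltr_pdivlMr ?mulr_gt0 // => xM.
  have PM' : cmod P <= M by rewrite /M lerDl.
  have := ler_wpM2r (cmod_ge0 (x - w0)) PM'; lra.
have xy0 := cmod_ge0 (x - y).
have H4 : cmod (px - py - P * (x - y)) * cmod x <=
    e / q * cmod (x - y) * (cmod w0 + 1).
  by apply: ler_pM => //; rewrite cmod_ge0.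
have H5 : e / q * cmod (x - y) * (cmod w0 + 1) = e / 4 * cmod (x - y).
  rewrite /q; field; rewrite gt_eqF //; have := cmod_ge0 w0; lra.
rewrite H5 in H4; have := ler_wpM2r xy0 PM; have := ler_wpM2r xy0 (ltW H1).
have := mulr_ge0 (ltW e0) xy0; lra.
Qed.

(** [A x * B y - A y * B x] equals [(x - y) * wronskian] up to a small multiple
of [x - y]. *)
Lemma ratio_inj A B (w0 : C) : B.[w0] != 0 -> (wronskian A B).[w0] != 0 ->
  exists2 d : K, 0 < d & forall x y, cmod (x - w0) < d -> cmod (y - w0) < d ->
    A.[x] / B.[x] = A.[y] / B.[y] -> x = y.
Proof.
move=> B0 W0; pose W t := (deriv A).[w0] * B.[t] - A.[t] * (deriv B).[w0].
have Wc : cont W w0.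
  apply: (jet_cont (a := (deriv A).[w0] * (deriv B).[w0] -
      ((deriv A).[w0] * (deriv B).[w0] + A.[w0] * 0))).
  apply: jetB; first by apply: jet_cM; exact: jet_poly.
  by apply: jetM; [exact: jet_poly|exact: jet_cst].
have W0' : 0 < cmod (W w0).
  by rewrite cmod_gt0 /W; move: W0; rewrite /wronskian hornerD hornerN !hornerM.
have Wh : 0 < cmod (W w0) / 2 by rewrite divr_gt0.
have [d1 d10 d1P] := Wc _ Wh.
have [d2 d20 d2P] := jet_cont (jet_poly A w0) ltr01.
have [d3 d30 d3P] := jet_cont (jet_poly B w0) ltr01.
have [d4 d40 d4P] := cont_neq0 (jet_cont (jet_poly B w0)) B0.
pose a := cmod A.[w0] + 1; pose b := cmod B.[w0] + 1.
have a0 : 0 < a by rewrite /a; have := cmod_ge0 A.[w0]; lra.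
have b0 : 0 < b by rewrite /b; have := cmod_ge0 B.[w0]; lra.
have eA : 0 < cmod (W w0) / (8 * b) by rewrite divr_gt0 // mulr_gt0.
have eB : 0 < cmod (W w0) / (8 * a) by rewrite divr_gt0 // mulr_gt0.
have [d5 d50 d5P] := @strict_poly A w0 _ eA.
have [d6 d60 d6P] := @strict_poly B w0 _ eB.
exists (Num.min (Num.min d1 d2) (Num.min (Num.min d3 d4) (Num.min d5 d6))).
  by rewrite !lt_min d10 d20 d30 d40 d50.
move=> x y; rewrite !lt_min.
move=> /andP[/andP[_ _] /andP[/andP[_ /d4P Bx] /andP[x5 x6]]].
move=> /andP[/andP[/d1P y1 /d2P y2] /andP[/andP[/d3P y3 /d4P By] /andP[y5 y6]]] E.
have {}E : A.[x] * B.[y] - A.[y] * B.[x] = 0.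
  have -> : A.[x] = A.[y] / B.[y] * B.[x] by rewrite -E; field.
  by field.
apply/eqP; rewrite -subr_eq0 -cmod_eq0 eq_le cmod_ge0 andbT leNgt.
apply/negP => xy.
have HA := d5P _ _ x5 y5; have HB := d6P _ _ x6 y6.
have Wy : cmod (W w0) / 2 <= cmod (W y).
  by have := cmod_geB (W w0) (W y); rewrite cmodBC; lra.
have Ay : cmod A.[y] <= a.
  by have := cmod_geB A.[y] A.[w0]; rewrite /a; lra.
have By' : cmod B.[y] <= b.
  by have := cmod_geB B.[y] B.[w0]; rewrite /b; lra.
have key : W y * (x - y) =
    A.[y] * (B.[x] - B.[y] - (deriv B).[w0] * (x - y))
    - (A.[x] - A.[y] - (deriv A).[w0] * (x - y)) * B.[y].
  rewrite -[LHS]subr0 -E /W; ring.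
have : cmod (W y * (x - y)) <= cmod (W w0) / 4 * cmod (x - y).
  rewrite key; apply: le_trans (cmodB _ _) _; rewrite !cmodM.
  have H1 := ler_pM (cmod_ge0 _) (cmod_ge0 _) Ay HB.
  have H2 := ler_pM (cmod_ge0 _) (cmod_ge0 _) HA By'.
  have E1 : a * (cmod (W w0) / (8 * a) * cmod (x - y)) =
     cmod (W w0) / 8 * cmod (x - y) by field; rewrite gt_eqF.
  have E2 : cmod (W w0) / (8 * b) * cmod (x - y) * b =
     cmod (W w0) / 8 * cmod (x - y) by field; rewrite gt_eqF.
  lra.
rewrite cmodM; have := ler_wpM2r (ltW xy) Wy.
have := mulr_gt0 W0' xy; lra.
Qed.

(** A continuous right inverse of a rational map is univalent as soon as the
map is not critical at its values: expansions come from [jet_linv], openness from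
[ratio_inj]. *)
Lemma branch_conformal z0 (R : K) (H : C -> C) A B :
  (forall z, disc z0 R z -> [/\ cont H z, B.[H z] != 0,
     A.[H z] / B.[H z] = z & (wronskian A B).[H z] != 0]) ->
  conformal (disc z0 R) H (fun w => A.[w] / B.[w]).
Proof.
move=> HP z zD; have [Hc B0 gH W0] := HP _ zD.
have gj := jet_div B0 (jet_poly A (H z)) (jet_poly B (H z)).
set a := (X in jet _ _ X) in gj.
have a0 : a != 0.
  rewrite /a mulf_neq0 ?invr_eq0 ?expf_neq0 //.
  by move: W0; rewrite /wronskian hornerD hornerN !hornerM.
have gc := jet_cont gj.
have [d d0 dP] := near_disc zD.
split=> //.
  exists a^-1; first by rewrite invr_eq0.
  apply: (jet_linv a0 gj Hc d0) => w /dP wD.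
  by have [] := HP _ wD.
have [e e0 eP] := ratio_inj B0 W0.
have [d1 d10 d1P] := Hc _ e0.
have m0 : 0 < Num.min d d1 by rewrite lt_min d0.
have [d2 d20 d2P] := gc _ m0.
exists (Num.min d2 e) => [|w]; first by rewrite lt_min d20.
rewrite lt_min => /andP[/d2P]; rewrite gH lt_min => /andP[/dP wD /d1P we] we'.
by apply: eP => //; have [] := HP _ wD.
Qed.

End Critical.

(** * The topology of the sphere *)

Section SphereTopology.
Variable K : realType.
Local Notation C := K[i].
Implicit Types (z w x y t : C) (A B p q : {poly C}).

Lemma sphere_cont_fin (h : C -> sphere K) z y (e : K) :
  {for z, continuous h} -> h z = fin y -> 0 < e ->
  exists2 d : K, 0 < d & forall w, cmod (w - z) < d ->
    exists2 y', h w = fin y' & cmod (y' - y) < e.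
Proof.
move=> hc hz e0.
have N : nbhs (h z) (@fin K @` B2 y e).
  rewrite hz; apply: one_point_compactification_some_nbhs.
  by apply/nbhs_cmodP; exists e => // w /B2E.
have {}N : nbhs z (h @^-1` (@fin K @` B2 y e)) := hc _ N.
have [d d0 dP] := (nbhs_cmodP _ _).1 N.
by exists d => // w /dP [y' /B2E ? <-]; exists y'.
Qed.

Lemma sphere_cont_inf (h : C -> sphere K) z (M : K) :
  {for z, continuous h} -> h z = infty ->
  exists2 d : K, 0 < d & forall w, cmod (w - z) < d ->
    forall y, h w = fin y -> M < cmod y.
Proof.
move=> hc hz.
pose V : set (sphere K) := (@fin K @` (~` cdisc 0 M)) `|` [set infty].
have N : nbhs (h z) V.
  rewrite hz; exists (cdisc 0 M) => //.
  by split; [exact: compact_cdisc|exact: closed_cdisc].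
have {}N : nbhs z (h @^-1` V) := hc _ N.
have [d d0 dP] := (nbhs_cmodP _ _).1 N.
exists d => // w /dP; rewrite /= /V => + y hw; rewrite hw => -[[y' + [<-]]|//].
by rewrite /cdisc /= subr0 => /negP; rewrite -ltNge.
Qed.

Lemma compact_cmod_bounded (U : set C) : compact U ->
  exists M : K, forall x, U x -> cmod x <= M.
Proof.
move=> cU; have [U0|/set0P U0] := eqVneq U set0; first by exists 0; rewrite U0.
have uc : {within U, continuous (@cmod K)}.
  apply: continuous_in_subspaceT => z _; apply: continuous_realP => e e0.
  exists e => // v; apply: le_lt_trans; rewrite ler_norml cmod_geB andbT.
  by have := cmod_geB z v; rewrite cmodBC; lra.
have [c _ cP] := compact_EVT_max U0 cU uc.
by exists (cmod c) => x Ux; apply: cP; exact: mem_set.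
Qed.

Lemma hpoint_continuous (P Q : C -> C) z : cont P z -> cont Q z ->
  (P z != 0) || (Q z != 0) -> {for z, continuous (fun w => hpoint (P w) (Q w))}.
Proof.
move=> Pc Qc PQ V.
have [Q0|Q0] := eqVneq (Q z) 0; last first.
  rewrite /hpoint (negbTE Q0) => VN.
  have {}VN : nbhs (P z / Q z) (@fin K @^-1` V) := VN.
  have [e e0 eP] := (nbhs_cmodP _ _).1 VN.
  have [d d0 dP] := contM Pc (contV Q0 Qc) e0.
  have [d' d'0 d'P] := cont_neq0 Qc Q0.
  change (nbhs z (fun w => V (hpoint (P w) (Q w)))).
  apply/nbhs_cmodP; exists (Num.min d d') => [|w]; first by rewrite lt_min d0.
  rewrite lt_min => /andP[/dP Pw /d'P Qw]; rewrite /hpoint (negbTE Qw).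
  exact: eP.
have P0 : P z != 0 by move: PQ; rewrite Q0 eqxx orbF.
rewrite {1}/hpoint Q0 eqxx => -[U [cU _] UV].
have [M MP] := compact_cmod_bounded cU.
have [d d0 dP] := cont_lower Pc P0.
have P0' : 0 < cmod (P z) by rewrite cmod_gt0.
have M1 : 0 < 2 * (`|M| + 1) by have := normr_ge0 M; lra.
have e0 : 0 < cmod (P z) / (2 * (`|M| + 1)) by rewrite divr_gt0.
have [d' d'0 d'P] := Qc _ e0.
change (nbhs z (fun w => V (hpoint (P w) (Q w)))).
apply/nbhs_cmodP; exists (Num.min d d') => [|w]; first by rewrite lt_min d0.
rewrite lt_min => /andP[/dP Pw /d'P]; rewrite Q0 subr0 ltr_pdivlMr // => Qw.
apply: UV; rewrite /hpoint; have [Qw0|Qw0] := eqVneq (Q w) 0; first by right.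
left; exists (P w / Q w) => // /MP; apply/negP; rewrite -ltNge.
have Qw0' : 0 < cmod (Q w) by rewrite cmod_gt0.
rewrite cmodM cmodV ltr_pdivlMr //.
have := ler_norm M; nra.
Qed.

(** Near a bounded set the chordal and the Euclidean distance are comparable,
and infinity is far away. *)
Lemma chordal_small (M eta : K) : 0 <= M -> 0 < eta -> exists2 e : K, 0 < e &
  forall y1, cmod y1 <= M -> forall x : sphere K, chordal x (fin y1) < e ->
    exists2 y, x = fin y & cmod (y - y1) < eta.
Proof.
move=> M0 eta0; pose m := 1 + M; have m0 : 0 < m by rewrite /m; lra.
have sq (y : C) (s : K) : 0 <= s -> cmod y <= s -> Num.sqrt (1 + cmod y ^+ 2) <= 1 + s.
  move=> s0 ys; rewrite -[leRHS]ger0_norm; last lra.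
  by rewrite -sqrtr_sqr ler_wsqrtr //; have := cmod_ge0 y; nra.
have sq0 (y : C) : 0 < Num.sqrt (1 + cmod y ^+ 2).
  by rewrite sqrtr_gt0 ltr_pwDl // sqr_ge0.
exists (2 * eta / ((m + eta) * m)) => [|y1 y1M [y|]].
- by rewrite !divr_gt0 ?mulr_gt0 //; lra.
- rewrite /chordal => ye; exists y => //; rewrite ltNge; apply/negP => yeta.
  move: ye; apply/negP; rewrite -leNgt.
  set dl := cmod (y - y1) in yeta *.
  have ym : Num.sqrt (1 + cmod y ^+ 2) <= m + dl.
    rewrite /m -addrA; apply: sq; first by rewrite addr_ge0 // cmod_ge0.
    by have := cmod_geB y y1; rewrite -/dl; lra.
  have y1m := sq _ _ M0 y1M; rewrite -/m in y1m.
  have s1 := sq0 y; have s2 := sq0 y1.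
  rewrite ler_pdivlMr ?mulr_gt0 // mulrAC ler_pdivrMr; last first.
    by rewrite mulr_gt0 //; lra.
  have : Num.sqrt (1 + cmod y ^+ 2) * Num.sqrt (1 + cmod y1 ^+ 2) <= (m + dl) * m.
    by apply: ler_pM => //; exact: ltW.
  move/(ler_wpM2l (ltW eta0)).
  have := mulr_ge0 (ltW m0) (ltW m0); nra.
rewrite /chordal => H; exfalso; move: H; apply/negP; rewrite -leNgt.
have y1m := sq _ _ M0 y1M; rewrite -/m in y1m.
rewrite ler_pdivlMr ?sq0 // mulrAC ler_pdivrMr; last by rewrite mulr_gt0 //; lra.
have := ler_wpM2l (ltW eta0) y1m; have := sq0 y1; nra.
Qed.

Lemma exp_small (c alpha e : K) : 0 < c -> 0 < alpha -> 0 < e ->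
  exists N, forall n, (N <= n)%N -> c * expR (- alpha * n%:R) < e.
Proof.
move=> c0 a0 e0; pose x := c / e / alpha.
exists (Num.bound x) => n Nn.
have xn : x < n%:R.
  apply: lt_le_trans (_ : (Num.bound x)%:R <= _); last by rewrite ler_nat.
  by apply: archi_boundP; rewrite /x !divr_ge0 // ltW.
rewrite mulNr expRN ltr_pdivrMr ?expR_gt0 // mulrC -ltr_pdivrMr //.
apply: lt_le_trans (expR_ge1Dx _).
by move: xn; rewrite /x ltr_pdivrMr //; lra.
Qed.

Lemma disc_connected_image (h : C -> sphere K) z0 (r : K) z (A : set (sphere K)) :
  (forall w, disc z0 r w -> {for w, continuous h} /\ A (h w)) ->
  disc z0 r z -> connected_component A (h z0) (h z).
Proof.
move=> hP zD; pose s (t : K) := h (z0 + (t%:C)%C * (z - z0)).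
have D (t : K) : t \in `[0, 1]%R -> disc z0 r (z0 + (t%:C)%C * (z - z0)).
  by move=> t01; exact: segment_in_disc.
have sc : {within `[0, 1]%classic, continuous s}.
  apply: continuous_in_subspaceT => t /set_mem t01.
  apply: (@continuous_comp _ _ _ (fun t : K => z0 + (t%:C)%C * (z - z0)) h).
    apply/continuousCP => e e0.
    have q0 : 0 < cmod (z - z0) + 1 by rewrite ltr_wpDl ?cmod_ge0.
    have ed : 0 < e / (cmod (z - z0) + 1) by rewrite divr_gt0.
    apply/nbhs_ballP; exists (e / (cmod (z - z0) + 1)) => // t' /=.
    rewrite -ball_normE /ball_ /= ltr_pdivlMr // => tt.
    have -> : z0 + (t'%:C)%C * (z - z0) - (z0 + (t%:C)%C * (z - z0)) =
        ((t' - t)%:C)%C * (z - z0) by rewrite rmorphB /=; ring.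
    rewrite cmodM cmodR distrC; apply: le_lt_trans tt.
    by rewrite ler_wpM2l // lerDl.
  exact: (hP _ (D _ t01)).1.
have cs : connected (s @` `[0, 1]%classic).
  by apply: connected_continuous_connected sc; exact: segment_connected.
apply: (connected_component_max _ _ cs).
- exists 0; first by rewrite /= in_itv /= lexx ler01.
  by rewrite /s rmorph0 mul0r addr0.
- by move=> _ [t t01 <-]; exact: (hP _ (D _ t01)).2.
exists 1; first by rewrite /= in_itv /= lexx ler01.
by rewrite /s rmorph1 mul1r addrC subrK.
Qed.

Lemma finite_radius (T : choiceType) (S : set T) (P : T -> K -> Prop) :
  finite_set S -> (forall s (r r' : K), r' <= r -> P s r -> P s r') ->
  (forall s, S s -> exists2 r : K, 0 < r & P s r) ->
  exists2 r : K, 0 < r & forall s, S s -> P s r.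
Proof.
move=> /finite_seqP[l ->] Pm; elim: l => [_|x l IH SP].
  by exists 1.
have [|r r0 rP] := IH; first by move=> s sl; apply: SP; rewrite /= inE sl orbT.
have [|r' r'0 r'P] := SP x; first by rewrite /= inE eqxx.
exists (Num.min r r') => [|s /=]; first by rewrite lt_min r0.
rewrite inE => /orP[/eqP->|sl].
  by apply: Pm r'P; rewrite ge_min lexx orbT.
by apply: Pm (rP _ sl); rewrite ge_min lexx.
Qed.

End SphereTopology.

(** * Inverse branches near the finite set *)

Section Branches.
Variables (K : realType) (u : nat) (f : 'I_u -> ratmap K).
Local Notation C := K[i].
Implicit Types (z y t a b : C) (A B p q : {poly C}) (v w : seq 'I_u)
  (h : C -> sphere K) (D : set C).

(** Asking only for continuity makes these branches stable under cancelling an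
initial part of the word; over a disc that avoids the post-critical set they are
holomorphic all the same. *)
Definition branch w h D := forall z, D z ->
  {for z, continuous h} /\ word_map f w (h z) = fin z.

Lemma word_poly w : exists A B, forall t,
  nonzero_at A B t /\ word_map f w (fin t) = hpoint A.[t] B.[t].
Proof.
have nz1 t : nonzero_at 'X 1 t by rewrite /nonzero_at !hornerE oner_eq0 orbT.
have [A [B AB]] := word_map_poly f w nz1.
exists A, B => t; have [h1 h2 _] := AB t; split=> //.
by rewrite -h2 /hpoint !hornerE oner_eq0 divr1.
Qed.

Lemma word_cont w t : {for t, continuous (fun t => word_map f w (fin t))}.
Proof.
have [A [B AB]] := word_poly w.
have -> : (fun t => word_map f w (fin t)) = fun t => hpoint A.[t] B.[t].
  by apply/funext => s; exact: (AB s).2.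
apply: hpoint_continuous; [exact: jet_cont (jet_poly A t)|
  exact: jet_cont (jet_poly B t)|exact: (AB t).1].
Qed.

(** The image of the disc is connected, so it lies in one component of the
preimage of a ball of radius [Rs], which shrinks exponentially; chordal and
Euclidean distances are comparable there. *)
Lemma long_branch_near (Rs R M eta : K) : exponential_shrinking f Rs ->
  0 < R < Rs -> 0 <= M -> 0 < eta -> exists N, forall b w h a z1 y1,
    J_ f (fin b) -> branch w h (disc b R) -> (N <= size w)%N -> cmod a <= M ->
    disc b R z1 -> h z1 = fin y1 -> cmod (y1 - a) < eta / 2 ->
    forall z, disc b R z -> exists2 y, h z = fin y & cmod (y - a) < eta.
Proof.
move=> [c [al [c0 al0 shr]]] /andP[R0 RRs] M0 eta0.
have M1 : 0 <= M + eta by lra.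
have eta2 : 0 < eta / 2 by lra.
have [e e0 eP] := chordal_small M1 eta2.
have [N NP] := exp_small c0 al0 e0.
exists N => b w h a z1 y1 Jb bh wN aM z1D hz1 y1a z zD.
pose A : set (sphere K) := word_map f w @^-1` (@fin K @` B2 b Rs).
have inA x : disc b R x -> {for x, continuous h} /\ A (h x).
  move=> xD; have [hc hx] := bh _ xD; split=> //.
  rewrite /A /= hx; exists x => //; apply/B2E; exact: lt_trans xD RRs.
have bD : disc b R b by rewrite /disc /= subrr cmod0.
have Ac : component A (connected_component A (h b)).
  by exists (h b) => //; exact: (inA _ bD).2.
have [_ Vd] := shr _ Jb w _ Ac.
have Vz := disc_connected_image inA zD; have Vz1 := disc_connected_image inA z1D.
have := le_lt_trans (Vd _ _ Vz Vz1) (NP _ wN); rewrite hz1 => /eP[|y hy yy1].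
  by have := cmod_geB y1 a; lra.
by exists y => //; have := cmodDB y a y1; lra.
Qed.

(** There are finitely many triples [(a, b, w)], and each one has some radius by
continuity of the word map at [a], as its value there is not [b]. *)
Lemma short_word (S : set C) N : finite_set S -> aperiodic f S ->
  exists2 r : K, 0 < r & forall a b w y z, S a -> S b -> w <> [::] ->
    (size w < N)%N -> cmod (y - a) < r -> cmod (z - b) < r ->
    word_map f w (fin y) <> fin z.
Proof.
move=> finS apS.
pose P a b w (r : K) := forall y z, cmod (y - a) < r -> cmod (z - b) < r ->
    word_map f w (fin y) <> fin z.
have Pm a b w (r r' : K) : r' <= r -> P a b w r -> P a b w r'.
  by move=> rr H y z ya zb; apply: H; exact: lt_le_trans rr.
have one a b w : S a -> S b -> w <> [::] -> exists2 r : K, 0 < r & P a b w r.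
  move=> Sa Sb w0.
  have nab : word_map f w (fin a) <> fin b.
    move=> E; suff : (@fin K @` S `&` \bigcup_(g in semigroup f) (g @` (@fin K @` S)))
        (fin b) by rewrite apS.
    split; first by exists b.
    exists (word_map f w); first by exists w.
    by exists (fin a) => //; exists a.
  have wc := @word_cont w a.
  case wa : (word_map f w (fin a)) => [x|].
    have xb : x != b by apply/eqP => xb; apply: nab; rewrite wa xb.
    have xb0 : 0 < cmod (x - b) / 2 by rewrite divr_gt0 // cmod_gt0 subr_eq0.
    have [d d0 dP] := sphere_cont_fin wc wa xb0.
    exists (Num.min d (cmod (x - b) / 2)) => [|y z].
      by rewrite lt_min d0.
    rewrite !lt_min => /andP[/dP [x' -> x'x] _] /andP[_ zb] [xz].
    rewrite xz in x'x; have := cmodDB x b z; rewrite (cmodBC x z); lra.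
  have [d d0 dP] := sphere_cont_inf (cmod b + 1) wc wa.
  exists (Num.min d 1) => [|y z]; first by rewrite lt_min d0 ltr01.
  rewrite !lt_min => /andP[/dP yP _] /andP[_ zb] /yP.
  by have := cmod_geB z b; lra.
have words : finite_set [set w : seq 'I_u | w <> [::] /\ (size w < N)%N].
  pose l := [seq tval x | n <- iota 0 N, x <- enum {: n.-tuple 'I_u}].
  apply: (sub_finite_set (B := [set` l])); last exact: finite_seq.
  move=> w [_ wN] /=; apply/allpairsPdep; exists (size w), (in_tuple w).
  by rewrite mem_iota mem_enum.
have ab a b : S a -> S b -> exists2 r : K, 0 < r & forall w,
    w <> [::] /\ (size w < N)%N -> P a b w r.
  move=> Sa Sb; apply: finite_radius words (Pm a b) _ => w [w0 _].
  exact: one.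
have fin_a a : S a -> exists2 r : K, 0 < r & forall b, S b -> forall w,
    w <> [::] /\ (size w < N)%N -> P a b w r.
  move=> Sa; apply: finite_radius finS _ _ => [b r r' rr H w /H|b Sb]; last exact: ab.
  exact: Pm.
have [r r0 rP] : exists2 r : K, 0 < r & forall a, S a -> forall b, S b ->
    forall w, w <> [::] /\ (size w < N)%N -> P a b w r.
  apply: finite_radius finS _ fin_a => a r r' rr H b Sb w /(H _ Sb).
  exact: Pm.
by exists r => // a b w y z Sa Sb w0 wN; exact: rP.
Qed.

(** The values of the branch are not critical points of the word map, because
the latter sends these into the post-critical set. *)
Lemma branch_univalent w h z0 (R : K) : w <> [::] -> branch w h (disc z0 R) ->
  (forall z, disc z0 R z -> h z <> infty) ->
  (forall z, disc z0 R z -> ~ PCV f (fin z)) ->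
  exists A B, conformal (disc z0 R) (@finpart K \o h) (fun t => A.[t] / B.[t]) /\
    forall t, nonzero_at A B t /\ word_map f w (fin t) = hpoint A.[t] B.[t].
Proof.
move=> w0 hb hf nP; have [A [B AB]] := word_poly w.
exists A, B; split=> //; apply: branch_conformal => z zD.
have [hc hw] := hb _ zD; have hn := hf _ zD.
case hz : (h z) => [y|]; last by rewrite hz in hn.
have yw : word_map f w (fin y) = fin z by rewrite -hw hz.
have [nzy wy] := AB y; rewrite yw in wy.
have -> : (@finpart K \o h) z = y by rewrite /= hz.
move: wy; rewrite /hpoint; case: eqP => // /eqP By [zE]; split=> //.
  move=> e e0; have [d d0 dP] := sphere_cont_fin hc hz e0.
  by exists d => // t /dP [y' hy' yy] /=; rewrite hy' hz.
apply/eqP => W; have cr : critical (word_map f w) (fin y).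
  by apply/(@critical_wronskian _ _ _ A B).
apply: (nP _ zD); rewrite -yw; exact: PCV_value.
Qed.

Lemma branch_lip w h a b (R eta : K) : 0 < R -> 0 < eta -> w <> [::] ->
  branch w h (disc b R) -> (forall z, disc b R z -> ~ PCV f (fin z)) ->
  (forall z, disc b R z -> exists2 y, h z = fin y & cmod (y - a) < eta) ->
  forall z, disc b R z ->
  cmod (finpart (h z) - finpart (h b)) <= 2 * eta * (cmod (z - b) / R).
Proof.
move=> R0 eta0 w0 hb nP ha.
have hf z : disc b R z -> h z <> infty by move=> /ha[y ->].
have [A [B [cf _]]] := branch_univalent w0 hb hf nP.
have bD : disc b R b by rewrite /disc /= subrr cmod0.
apply: (@schwarz _ (@finpart K \o h)) => // [|z zD|z zD /=]; first lra.
  by have [[s _ js] _ _ _] := cf _ zD; exists s.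
have [y -> ya] := ha _ zD; have [y' -> ya'] := ha _ bD => /=.
by have := cmodDB y y' a; rewrite (cmodBC a); lra.
Qed.

End Branches.

(** * Contraction of holomorphic inverse branches *)

Section Contraction.
Variables (K : realType) (u : nat) (f : 'I_u -> ratmap K).
Local Notation C := K[i].
Implicit Types (z y t a b : C) (A B p q : {poly C}) (v w : seq 'I_u)
  (h : C -> sphere K) (D : set C).

Lemma derivable_lip (G : C -> C) z : derivable G z 1 ->
  bigO 1 (fun t => G (z + t) - G z).
Proof.
move=> /cvg_ex[l Gl].
have N : nbhs l (B2 l 1) by apply/nbhs_cmodP; exists 1 => // x /B2E.
have {}N := Gl _ N; rewrite nbhs_simpl in N.
have {}N : nbhs (0 : C) (fun t : C => t != 0 ->
    B2 l 1 (t^-1 *: (G (t *: (1 : C) + z) - G z))) := N.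
have [d d0 dP] := (nbhs_cmodP _ _).1 N.
exists (cmod l + 1), d; split=> // [|t td]; first by rewrite addr_ge0 // cmod_ge0.
have [->|t0] := eqVneq t 0; first by rewrite addr0 subrr !cmod0 expr1 mulr0.
have := dP t; rewrite subr0 => /(_ td t0) /B2E.
rewrite [t *: (1 : C)]mulr1 [t + z]addrC /GRing.scale /= => H.
have t0' : 0 < cmod t by rewrite cmod_gt0.
have E : G (z + t) - G z = t^-1 * (G (z + t) - G z) * t by field.
rewrite E cmodM expr1 ler_wpM2r ?cmod_ge0 //.
by have := cmod_geB (t^-1 * (G (z + t) - G z)) l; lra.
Qed.

Lemma lip_comp (G M : C -> C) z a : bigO 1 (fun t => G (z + t) - G z) ->
  jet M (G z) a -> bigO 1 (fun t => M (G (z + t)) - M (G z)).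
Proof.
move=> Gl /jet_lip Ml; have := bigO_comp Ml Gl; apply: bigO_ext => t /=.
by rewrite [G z + _]addrC subrK.
Qed.

(** If the Wronskian vanished, then [A / B] would change by [o (k)] when its
argument changes by [k], and composing with the Lipschitz function [H] would
give [t = o (t)]. *)
Lemma lip_wronskian (H : C -> C) A B z (d : K) : 0 < d ->
  bigO 1 (fun t => H (z + t) - H z) -> B.[H z] != 0 ->
  (forall t, cmod (t - z) < d -> A.[H t] / B.[H t] = t) -> (wronskian A B).[H z] != 0.
Proof.
move=> d0 Hl B0 gH; apply/eqP => W.
have := jet_div B0 (jet_poly A (H z)) (jet_poly B (H z)).
have -> : ((deriv A).[H z] * B.[H z] - A.[H z] * (deriv B).[H z]) / B.[H z] ^+ 2 = 0.
  by move: W; rewrite /wronskian hornerD hornerN !hornerM => ->; rewrite mul0r.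
move=> /jet_diff gj; have [L [d1 [L0 d10 d1P]]] := Hl.
have L1 : 0 < 2 * (L + 1) by lra.
have e0 : 0 < (2 * (L + 1))^-1 by rewrite invr_gt0.
have [d2 d20 d2P] := gj _ e0.
have m0 : 0 < Num.min (Num.min d d1) (d2 / (L + 1)).
  by rewrite !lt_min d0 d10 divr_gt0 //; lra.
have [t] := exists_small m0.
rewrite !lt_min => /andP[/andP[td td1] td2]; rewrite -cmod_gt0 => t0.
have := d1P _ td1; rewrite expr1 => Ht.
have kd : cmod (H (z + t) - H z) < d2.
  move: td2; rewrite ltr_pdivlMr; last lra.
  by apply: le_lt_trans; apply: le_trans Ht _; rewrite mulrC ler_wpM2l ?cmod_ge0 //; lra.
have := d2P _ kd; rewrite [H z + _]addrC subrK mul0r subr0.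
rewrite !gH ?subrr ?cmod0 //; last by rewrite addrAC subrr add0r.
rewrite addrAC subrr add0r mulrC ler_pdivlMr // => H1.
have := cmod_ge0 t; nra.
Qed.

Lemma finpartE y : finpart (@fin K y) = y. Proof. by []. Qed.

(** [H] is [1 / (h - p0)], with value [0] at the poles of [h].  It is Lipschitz
at each point, in the chart at a finite value of [h] as well as in the chart at
infinity, so [lip_wronskian] applies to the word map read in the coordinate
[1 / (z - p0)]. *)
Lemma HIB_coordinate (R : K) b w h (p0 : C) :
  HIB f R b (w, h) -> (forall z, disc b (4 * R) z -> h z <> fin p0) ->
  exists H g, conformal (disc b (4 * R)) H g /\ forall z, disc b (4 * R) z ->
    h z = if H z == 0 then infty else fin (p0 + (H z)^-1).
Proof.
move=> hb hp; pose H z := if h z is Some y then (y - p0)^-1 else 0.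
have hH z : disc b (4 * R) z -> h z = if H z == 0 then infty else fin (p0 + (H z)^-1).
  move=> /hp; rewrite /H; case: (h z) => [y yp|_]; last by rewrite eqxx.
  have y0 : y - p0 != 0 by rewrite subr_eq0; apply/eqP => E; apply: yp; rewrite E.
  by rewrite invr_eq0 (negbTE y0) invrK addrC subrK.
(* [[p0 t + 1 : t]] is the point with coordinate [t = 1 / (z - p0)] *)
pose A0 : {poly C} := p0 *: 'X + 1; pose B0 : {poly C} := 'X.
have nz0 t : nonzero_at A0 B0 t.
  rewrite /nonzero_at /A0 /B0 !hornerE; have [->|_] := eqVneq t 0; last by rewrite orbT.
  by rewrite mulr0 add0r oner_eq0.
have [A [B AB]] := word_map_poly f w nz0.
have hD z : disc b (4 * R) z -> B.[H z] != 0 /\ A.[H z] / B.[H z] = z.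
  move=> zD; have [nzz + _] := AB (H z).
  have -> : hpoint A0.[H z] B0.[H z] = h z.
    rewrite (hH _ zD) /hpoint /A0 /B0 !hornerE; case: eqP => // /eqP H0.
    by congr (fin _); field.
  have /B2E zB : cmod (z - b) < 4 * R := zD.
  rewrite (hb _ zB).2 /hpoint.
  by case: eqP => [_|/eqP Bz] // [zE]; split.
have lip z : disc b (4 * R) z -> bigO 1 (fun t => H (z + t) - H z).
  move=> zD; have /B2E zB : cmod (z - b) < 4 * R := zD.
  have [[hc hd] _] := hb _ zB; have zp := hp _ zD.
  have {}hc : {for z, continuous h} := hc.
  pose G : C -> C := chart (h z) \o h.
  have Gl : bigO 1 (fun t => G (z + t) - G z) by exact: derivable_lip.
  case hz : (h z) => [y|].
    have y0 : y - p0 != 0.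
      by rewrite subr_eq0; apply/eqP => E; apply: zp; rewrite hz E.
    have GE x : G x = finpart (h x) by rewrite /G /= hz.
    have Gz : G z = y by rewrite GE hz.
    have Mj : jet (fun x => (x - p0)^-1) (G z) (- (1 - 0) / (G z - p0) ^+ 2).
      apply: (jet_inv (F := fun x => x - p0)); first by rewrite Gz.
      by apply: jetB; [exact: jet_id|exact: jet_cst].
    have [d d0 dP] := sphere_cont_fin hc hz ltr01.
    apply: (bigO_near d0 _ (lip_comp Gl Mj)) => t td.
    have [|y' hy' _] := dP (z + t); first by rewrite addrAC subrr add0r.
    by rewrite !GE /H hy' hz.
  have GE x : G x = if h x is Some y then y^-1 else 0 by rewrite /G /= hz.
  have Gz : G z = 0 by rewrite GE hz.
  have Mj : jet (fun x => x / (1 - p0 * x)) (G z)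
      ((1 * (1 - p0 * G z) - G z * (0 - p0 * 1)) / (1 - p0 * G z) ^+ 2).
    apply: jet_div; first by rewrite Gz mulr0 subr0 oner_eq0.
      exact: jet_id.
    by apply: jetB; [exact: jet_cst|apply: jet_cM; exact: jet_id].
  have [d d0 dP] := sphere_cont_inf 0 hc hz.
  apply: (bigO_near d0 _ (lip_comp Gl Mj)) => t td.
  have := dP (z + t); rewrite addrAC subrr add0r => /(_ td) hy.
  rewrite Gz GE mul0r subr0 /H hz subr0.
  case E : (h (z + t)) => [y|]; last by rewrite mul0r.
  have y0 : y != 0 by rewrite -cmod_gt0; exact: hy.
  have [->|yp] := eqVneq y p0.
    by rewrite subrr invr0; have [->|p00] := eqVneq p0 0;
      rewrite ?invr0 ?mul0r // divff // subrr invr0 mulr0.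
  by field; rewrite y0 subr_eq0 yp.
exists H, (fun t => A.[t] / B.[t]); split=> //.
apply: branch_conformal => z zD; have [Bz gz] := hD _ zD.
have Hl := lip _ zD; split=> //; first exact: bigO1_cont.
have [d d0 dP] := near_disc zD.
by apply: (lip_wronskian d0 Hl Bz) => t /dP /hD[].
Qed.

Definition distortion_cst : K := 704 * expR 176.

Lemma distortion_cst_gt0 : 0 < distortion_cst.
Proof. by apply: mulr_gt0; rewrite ?ltr0n ?expR_gt0. Qed.

Lemma norm_le_quarter (x : C) : cmod x <= 4^-1 -> `|x| <= 4^-1.
Proof.
move=> H; rewrite normE (_ : (4^-1 : C) = ((4^-1 : K)%:C)%C) ?lecR //.
by rewrite fmorphV rmorph_nat.
Qed.

Lemma HIB_branch (R r : K) b w h : r <= 4 * R -> HIB f R b (w, h) ->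
  branch f w h (disc b r).
Proof.
move=> rR hb z zr.
have zD : cmod (z - b) < 4 * R by apply: lt_le_trans rR.
by have /B2E/hb[[hc _] hw] := zD.
Qed.

(** The Schwarz lemma bounds the derivative at the centre, and the distortion
theorem propagates the bound. *)
Lemma conformal_small_derivative (H g : C -> C) b (R eta : K) dH : 0 < R ->
  0 < eta -> conformal (disc b (4 * R)) H g ->
  (forall z, disc b (4 * R) z -> jet H z (dH z)) ->
  (forall z, disc b R z -> cmod (H z - H b) <= eta) ->
  forall z, disc b (2 * R) z -> cmod (dH z) <= distortion_cst * (eta / R).
Proof.
move=> R0 eta0 Hg dHP He z zD.
have bD r : 0 < r -> disc b r b by rewrite /disc /= subrr cmod0.
have R4 : 0 < 4 * R by rewrite mulr_gt0.
have DR x : disc b R x -> disc b (4 * R) x by rewrite /disc /=; lra.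
have D2 x : disc b (2 * R) x -> disc b (4 * R) x by rewrite /disc /=; lra.
have Hb : cmod (dH b) <= eta / R.
  apply: (jet_coef_le (dHP _ (bD _ R4))) => e e0; exists R => // t tR.
  have sc : forall x, disc b R x -> cmod (H x - H b) <= eta * (cmod (x - b) / R).
    apply: schwarz => // [|x xR]; first exact: ltW.
    by exists (dH x); exact/dHP/DR.
  have := sc (b + t); rewrite /disc /= addrAC subrr add0r => /(_ tR).
  by have := mulr_ge0 (ltW e0) (cmod_ge0 t); lra.
apply: le_trans (_ : distortion_cst * cmod (dH b) <= _).
  apply: (distortion R4 Hg (dHP _ (bD _ R4)) _ (dHP _ (D2 _ zD))).
  by move: zD; rewrite /disc /=; lra.
by rewrite ler_wpM2l // ltW // distortion_cst_gt0.
Qed.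

(** Let [p] be as in [PCV_point].  No branch over [B(b, 4 R)] takes the value
[p], since the word map sends [p] into the post-critical set.  If [p] is
infinity then [h] is univalent, and [conformal_small_derivative] applies to it.
If [p] is finite, it applies to [H = 1 / (h - p)]: the bound on the derivative
keeps [H] away from [0] on [B(b, 2 R)], so [h = p + 1 / H] is finite there and
its derivative [- H' / H ^ 2] is small. *)
Lemma HIB_contraction (R M : K) : 0 < R -> 0 <= M -> fundamental_assumption f ->
  exists2 eta : K, 0 < eta & forall a b w h,
  cmod a <= M -> w <> [::] -> HIB f R b (w, h) ->
  (forall z, disc b (8 * R) z -> ~ PCV f (fin z)) ->
  (forall z, disc a (8 * R) z -> ~ PCV f (fin z)) ->
  (forall z, disc b R z -> exists2 y, h z = fin y & cmod (y - a) < eta) ->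
  forall z, disc b (2 * R) z -> h z <> infty /\
    `|derive1 (@finpart K \o h : C -> C) z| <= 4^-1.
Proof.
move=> R0 M0 /PCV_point[p pP]; have c0 := distortion_cst_gt0.
have omit b w h : HIB f R b (w, h) ->
    (forall z, disc b (8 * R) z -> ~ PCV f (fin z)) ->
    forall z, disc b (4 * R) z -> h z <> p.
  move=> hb nP z zD hz; apply: (nP z).
    by move: zD; rewrite /disc /=; lra.
  by rewrite -(HIB_branch (lexx _) hb zD).2 hz; exact: pP.
have bD b r : 0 < r -> disc b r b by rewrite /disc /= subrr cmod0.
have R4 : 0 < 4 * R by rewrite mulr_gt0.
case pE : p => [p0|]; last first.
  exists (R / (8 * distortion_cst)) => [|a b w h aM w0 hb nPb nPa ha z zD].
    by rewrite divr_gt0 // mulr_gt0.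
  set eta := R / _ in ha; have eta0 : 0 < eta by rewrite divr_gt0 // mulr_gt0.
  have hf x : disc b (4 * R) x -> h x <> infty.
    by move=> xD; have := omit b w h hb nPb x xD; rewrite pE.
  have [|A [B [cf _]]] := branch_univalent w0 (HIB_branch (lexx _) hb) hf.
    by move=> x xD; apply: nPb; move: xD; rewrite /disc /=; lra.
  have zD4 : disc b (4 * R) z by move: zD; rewrite /disc /=; lra.
  split; first exact: hf.
  have [dH dHP] := conformal_deriv cf.
  have e2 : 0 < 2 * eta by rewrite mulr_gt0.
  have small x : disc b R x -> cmod ((@finpart K \o h) x - (@finpart K \o h) b) <= 2 * eta.
    move=> xD /=; have [y -> ya] := ha _ xD; have [y' -> ya'] := ha _ (bD _ _ R0).
    by rewrite !finpartE; have := cmodDB y y' a; rewrite (cmodBC a); lra.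
  have := conformal_small_derivative R0 e2 cf dHP small zD => H1.
  rewrite derive1E (@derive_val _ _ _ _ _ _ _ (jet_is_derive (dHP _ zD4))).
  apply: norm_le_quarter; apply: le_trans H1 _.
  rewrite /eta le_eqVlt; apply/orP; left; apply/eqP.
  by field; rewrite !gt_eqF.
have m0 : 0 < M + cmod p0 + 4 * R by have := cmod_ge0 p0; lra.
pose m := (M + cmod p0 + 4 * R)^-1; have m1 : 0 < m by rewrite invr_gt0.
(* [m] bounds [|H b|] from below.  If [|H'| <= q] then [H] varies by at most
   [m / 2] on the disc of radius [2 R], and [|H'| / (m / 2) ^ 2 <= 1 / 4]. *)
pose q := Num.min (m / (8 * R)) (m ^+ 2 / 16).
have q0 : 0 < q by rewrite lt_min !divr_gt0 ?mulr_gt0 // exprn_gt0.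
pose eta := Num.min (4 * R) (8 * R ^+ 3 * q / distortion_cst).
have eta0 : 0 < eta by rewrite lt_min R4 divr_gt0 // !mulr_gt0 // exprn_gt0.
exists eta => // a b w h aM w0 hb nPb nPa ha z zD.
have hp x : disc b (4 * R) x -> h x <> fin p0.
  by move=> xD; have := omit b w h hb nPb x xD; rewrite pE.
have [H [g [cf hH]]] := HIB_coordinate hb hp.
have [dH dHP] := conformal_deriv cf.
have ap : 8 * R <= cmod (p0 - a).
  rewrite leNgt; apply/negP => /nPa; apply; rewrite -[fin p0]pE.
  exact: (pP [::]).
have DR x : disc b R x -> disc b (4 * R) x by rewrite /disc /=; lra.
have D2 x : disc b (2 * R) x -> disc b (4 * R) x by rewrite /disc /=; lra.
have e4 : eta <= 4 * R by rewrite ge_min lexx.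
have eq : eta <= 8 * R ^+ 3 * q / distortion_cst by rewrite ge_min lexx orbT.
have near x : disc b R x -> exists y, [/\ H x = (y - p0)^-1, cmod (y - a) < eta &
    4 * R <= cmod (y - p0)].
  move=> xD; have [y hy ya] := ha _ xD; exists y.
  have yp : 4 * R <= cmod (y - p0).
    by have := cmodDB p0 a y; rewrite (cmodBC p0 y); lra.
  split=> //; have := hH _ (DR _ xD); rewrite hy; case: eqP => // _ [->].
  by rewrite addrAC subrr add0r invrK.
have e16 : 0 < 2 * eta / (16 * R ^+ 2).
  by rewrite divr_gt0 ?mulr_gt0 // exprn_gt0.
have small x : disc b R x -> cmod (H x - H b) <= 2 * eta / (16 * R ^+ 2).
  move=> xD; have [y [-> ya yp]] := near _ xD.
  have [y' [-> ya' yp']] := near _ (bD _ _ R0).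
  have y0 : 0 < cmod (y - p0) by lra. have y0' : 0 < cmod (y' - p0) by lra.
  have -> : (y - p0)^-1 - (y' - p0)^-1 = (y' - y) / ((y - p0) * (y' - p0)).
    by field; rewrite -!cmod_gt0 y0 y0'.
  rewrite cmodM cmodV cmodM; apply: ler_pM; rewrite ?cmod_ge0 ?invr_ge0 //.
  - by rewrite mulr_ge0 // cmod_ge0.
  - by have := cmodDB y' y a; rewrite (cmodBC a y); lra.
  rewrite lef_pV2 ?posrE ?mulr_gt0 ?exprn_gt0 //.
  have -> : 16 * R ^+ 2 = (4 * R) * (4 * R) by ring.
  by apply: ler_pM => //; exact: ltW.
have dHq x : disc b (2 * R) x -> cmod (dH x) <= q.
  move=> xD; have := conformal_small_derivative R0 e16 cf dHP small xD.
  move=> /le_trans; apply.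
  move: eq; rewrite ler_pdivlMr // => eq.
  have -> : distortion_cst * (2 * eta / (16 * R ^+ 2) / R) =
      eta * distortion_cst / (8 * R ^+ 3) by field; rewrite gt_eqF.
  rewrite ler_pdivrMr; last by rewrite mulr_gt0 // exprn_gt0.
  by move: eq; lra.
have Hbm : m <= cmod (H b).
  have [y [-> ya yp]] := near _ (bD _ _ R0).
  rewrite cmodV /m lef_pV2 ?posrE //; last by lra.
  by have := cmodDB y p0 a; have := cmodB a p0; lra.
have Hzm : m / 2 <= cmod (H z).
  have := @mean_value_disc K H dH b (2 * R) q (ltW q0).
  move=> /(_ _ z zD) Hz; have {}Hz : cmod (H z - H b) <= 2 * q * cmod (z - b).
    by apply: Hz => x xD; split; [exact/dHP/D2|exact: dHq].
  have : 2 * q * cmod (z - b) <= m / 2.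
    have q1 : q <= m / (8 * R) by rewrite ge_min lexx.
    move: q1; rewrite ler_pdivlMr ?mulr_gt0 // => q1.
    have : q * cmod (z - b) <= q * (2 * R).
      by rewrite ler_wpM2l ?ltW //; exact: zD.
    lra.
  by have := cmod_geB (H b) (H z); rewrite (cmodBC (H b)); lra.
have Hz0 : H z != 0 by rewrite -cmod_gt0; lra.
split; first by rewrite (hH _ (D2 _ zD)) (negbTE Hz0).
have jH := dHP _ (D2 _ zD).
have hj : jet (@finpart K \o h) z (0 + (- dH z / H z ^+ 2)).
  have [d d0 dP] := near_disc (D2 _ zD).
  have [d' d'0 d'P] := cont_neq0 (jet_cont jH) Hz0.
  have mn : 0 < Num.min d d' by rewrite lt_min d0.
  apply: (jet_near mn _ (jetD (jet_cst p0 z) (jet_inv Hz0 jH))) => x.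
  rewrite lt_min => /andP[/dP xD /d'P Hx] /=.
  by rewrite (hH _ xD) (negbTE Hx).
rewrite derive1E (@derive_val _ _ _ _ _ _ _ (jet_is_derive hj)) add0r.
apply: norm_le_quarter; rewrite cmodM cmodN cmodV cmodX.
have Hz2 : 0 < cmod (H z) ^+ 2 by rewrite exprn_gt0 // cmod_gt0.
rewrite ler_pdivrMr //; apply: le_trans (dHq _ zD) _.
have q2 : q <= m ^+ 2 / 16 by rewrite ge_min lexx orbT.
have : (m / 2) ^+ 2 <= cmod (H z) ^+ 2.
  by apply: lerXn2r; rewrite ?nnegrE ?cmod_ge0 //; lra.
rewrite expr_div_n; lra.
Qed.

End Contraction.

(** * Cylinders in the shift space *)

Section Shift.
Variable u : nat.
Implicit Types (om : Sigma u) (w v : seq 'I_u).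

Definition shift n om : Sigma u := fun i => om (n + i)%N.

Definition cylinder om n : set (Sigma u) :=
  [set om' | forall i, (i < n)%N -> om' i = om i].

Lemma nbhs_cylinder om n : nbhs om (cylinder om n).
Proof.
elim: n => [|n IH].
  have -> : cylinder om 0 = setT by apply/seteqP; split.
  exact: filterT.
have N : nbhs om (fun om' : Sigma u => om' n = om n).
  have := @proj_continuous nat (fun=> discrete_topology 'I_u) n om [set om n].
  apply; exact: discrete_set1.
apply: filterS (filterI IH N) => om' [H1 H2] i.
by rewrite ltnS leq_eqVlt => /orP[/eqP->|/H1].
Qed.

Lemma nbhs_cylinderP om (P : set (Sigma u)) : nbhs om P ->
  exists n, cylinder om n `<=` P.
Proof.
pose F : set_system (Sigma u) := filter_from setT (cylinder om).
have FF : Filter F.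
  apply: filter_from_filter; first by exists 0%N.
  move=> i j _ _; exists (maxn i j) => // om' H; split=> k kl; apply: H.
    by rewrite leq_max kl.
  by rewrite leq_max kl orbT.
suff : F --> om by move=> H /H [n _ nP]; exists n.
apply/cvg_sup => i V.
rewrite nbhsE => -[W [[W' oW' <-] Wom] WV].
exists i.+1 => // om' H; apply: WV => /=.
by rewrite /proj H.
Qed.

Lemma prepend0 om : prepend [::] om = om.
Proof. by apply/funext => i; rewrite /prepend nth_nil subn0. Qed.

Lemma prepend_lt w om x0 i : (i < size w)%N -> prepend w om i = nth x0 w i.
Proof. by move=> iw; rewrite /prepend; exact: set_nth_default. Qed.

Lemma prepend_ge w om i : prepend w om (size w + i) = om i.
Proof. by rewrite /prepend nth_default ?leq_addr // addKn. Qed.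

Lemma shift_prepend w om : shift (size w) (prepend w om) = om.
Proof. by apply/funext => i; rewrite /shift prepend_ge. Qed.

Lemma prepend_cat v w om : prepend (v ++ w) om = prepend v (prepend w om).
Proof.
apply/funext => i; have [iv|vi] := ltnP i (size v).
  rewrite !(prepend_lt _ (om 0%N)) ?size_cat ?ltn_addr // nth_cat iv //.
rewrite -(subnKC vi) prepend_ge; move: (i - size v)%N => {vi}i.
have [iw|wi] := ltnP i (size w).
  rewrite !(prepend_lt _ (om 0%N)) ?size_cat ?ltn_add2l // nth_cat.
  by rewrite ltnNge leq_addr addKn.
by rewrite -(subnKC wi) addnA -size_cat !prepend_ge.
Qed.

Lemma prepend_prefix w v om om' : prepend w om = prepend v om' ->
  (size v <= size w)%N -> exists2 w', w = v ++ w' & om' = prepend w' om.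
Proof.
move=> E vw; have wE : w = v ++ drop (size v) w.
  rewrite -{1}(cat_take_drop (size v) w); congr (_ ++ _).
  apply: (@eq_from_nth _ (om 0%N)); first by rewrite size_takel.
  rewrite size_takel // => i iv; rewrite nth_take //.
  rewrite -(prepend_lt om (om 0%N)); last exact: leq_trans vw.
  by rewrite E (prepend_lt _ (om 0%N)).
exists (drop (size v) w) => //.
by rewrite -(shift_prepend v om') -E {1}wE prepend_cat shift_prepend.
Qed.

Lemma cylinder_prepend w om om' n : cylinder (prepend w om) (size w + n) om' ->
  om' = prepend w (shift (size w) om') /\ cylinder om n (shift (size w) om').
Proof.
move=> H; split=> [|i ni]; last first.
  by rewrite /shift H ?ltn_add2l // prepend_ge.
apply/funext => i; have [iw|wi] := ltnP i (size w).
  by rewrite H ?ltn_addr // !(prepend_lt _ (om 0%N)).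
by rewrite -(subnKC wi) prepend_ge.
Qed.

End Shift.

(** * Uniqueness of lifts *)

Section Lifts.
Variables (K : realType) (u : nat) (f : 'I_u -> ratmap K).
Local Notation C := K[i].
Implicit Types (z y t a b c : C) (v w : seq 'I_u) (h k : C -> sphere K).

(** Connectedness of the segment, by the intermediate value theorem for the
function that is [1] where [P] holds and [-1] elsewhere, extended to the whole
line by clamping. *)
Lemma segment_induction (P : K -> Prop) : P 0 ->
  (forall t : K, t \in `[0, 1]%R -> P t -> exists2 d : K, 0 < d & forall t' : K,
     t' \in `[0, 1]%R -> `|t' - t| < d -> P t') ->
  (forall t : K, t \in `[0, 1]%R -> ~ P t -> exists2 d : K, 0 < d & forall t' : K,
     t' \in `[0, 1]%R -> `|t' - t| < d -> ~ P t') -> P 1.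
Proof.
move=> P0 Po Pc; apply: contrapT => P1.
pose cl (t : K) := Num.max 0 (Num.min 1 t).
have cl01 (t : K) : cl t \in `[0, 1]%R.
  by rewrite in_itv /= le_max lexx /= ge_max ler01 /= ge_min lexx.
have clE (t : K) : t \in `[0, 1]%R -> cl t = t.
  rewrite in_itv /= => /andP[t0 t1]; rewrite /cl.
  by rewrite (min_idPr t1) (max_idPr t0).
have cl0 (t : K) : t <= 0 -> cl t = 0.
  by move=> t0; rewrite /cl (min_idPr (le_trans t0 ler01)) (max_idPl t0).
have cl1 (t : K) : 1 <= t -> cl t = 1.
  by move=> t1; rewrite /cl (min_idPl t1) (max_idPr ler01).
have clP (t : K) : [\/ t <= 0 /\ cl t = 0, 1 <= t /\ cl t = 1 |
    [/\ 0 <= t, t <= 1 & cl t = t]].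
  have [t0|t0] := leP t 0; first by apply: Or31; split; last exact: cl0.
  have [t1|t1] := leP 1 t; first by apply: Or32; split; last exact: cl1.
  by apply: Or33; rewrite clE ?in_itv /= ?ltW.
have cld (t t' : K) : `|cl t' - cl t| <= `|t' - t|.
  have n1 := ler_norm (t' - t); have n2 := ler_norm (- (t' - t)).
  rewrite normrN in n2; rewrite ler_norml; apply/andP.
  by case: (clP t) => -[] => [? ->|? ->|? ? ->];
    case: (clP t') => -[] => [? ->|? ->|? ? ->]; split; lra.
pose g (t : K) : K := if `[< P (cl t) >] then 1 else -1.
have g0 : 0 < g 0.
  rewrite /g clE ?in_itv /= ?lexx ?ler01 //; case: asboolP => //.
have g1 : g 1 < 0.
  by rewrite /g clE ?in_itv /= ?lexx ?ler01 //; case: asboolP => // _; lra.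
have [|t t01] := @IVT_zero K g _ g0 g1; last first.
  by rewrite /g; case: ifP => _; lra.
move=> t t01 e e0; have [Pt|Pt] := pselect (P (cl t)).
  have [d d0 dP] := Po _ (cl01 t) Pt; exists d => // t' td.
  have Pt' : P (cl t') by apply: dP => //; apply: le_lt_trans td; exact: cld.
  by rewrite /g !asboolT // subrr normr0.
have [d d0 dP] := Pc _ (cl01 t) Pt; exists d => // t' td.
have Pt' : ~ P (cl t') by apply: dP => //; apply: le_lt_trans td; exact: cld.
by rewrite /g !asboolF // subrr normr0.
Qed.

(** Along a segment the set of agreement is closed by continuity, and open
because the word map is injective near a value of the branch. *)
Lemma branch_unique w h k b (R : K) : w <> [::] ->
  branch f w h (disc b R) -> branch f w k (disc b R) ->
  (forall z, disc b R z -> h z <> infty /\ k z <> infty) ->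
  (forall z, disc b R z -> ~ PCV f (fin z)) ->
  forall z z', disc b R z -> disc b R z' -> h z = k z -> h z' = k z'.
Proof.
move=> w0 hb kb hk nP z z' zD z'D.
have [A [B [cf AB]]] := branch_univalent w0 hb (fun z zD => (hk z zD).1) nP.
pose H := @finpart K \o h; pose G := @finpart K \o k.
have hH x : disc b R x -> h x = fin (H x).
  by move=> /hk[]; rewrite /H /=; case: (h x).
have kG x : disc b R x -> k x = fin (G x).
  by move=> /hk[_]; rewrite /G /=; case: (k x).
have Hc x : disc b R x -> cont H x.
  by move=> /cf[[a _ /jet_cont]].
have Gc x : disc b R x -> cont G x.
  move=> xD e e0; have [d d0 dP] := sphere_cont_fin (kb _ xD).1 (kG _ xD) e0.
  exists d => // y /dP[y' ky ye].
  by have -> : G y = y' by rewrite /G /= ky.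
have gG x : disc b R x -> A.[G x] / B.[G x] = x.
  move=> xD; have := (kb _ xD).2; rewrite kG // (AB (G x)).2 /hpoint.
  by case: eqP => // _ [].
move=> hkz; suff : H z' = G z' by rewrite hH // kG // => ->.
pose s (t : K) := z + (t%:C)%C * (z' - z).
have sD (t : K) : t \in `[0, 1]%R -> disc b R (s t).
  rewrite in_itv /= => /andP[t0 t1]; rewrite /disc /= /s.
  have -> : z + (t%:C)%C * (z' - z) - b = ((1 - t)%:C)%C * (z - b) + (t%:C)%C * (z' - b).
    by rewrite rmorphB rmorph1 /=; ring.
  apply: le_lt_trans (cmodD _ _) _; rewrite !cmodM !cmodR !ger0_norm ?subr_ge0 //.
  have {}zD : cmod (z - b) < R := zD; have {}z'D : cmod (z' - b) < R := z'D.
  pose m := Num.max (cmod (z - b)) (cmod (z' - b)).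
  apply: le_lt_trans (_ : m < R); last by rewrite gt_max zD.
  have m1 : cmod (z - b) <= m by rewrite le_max lexx.
  have m2 : cmod (z' - b) <= m by rewrite le_max lexx orbT.
  have t1' : 0 <= 1 - t by rewrite subr_ge0.
  by have := ler_wpM2l t1' m1; have := ler_wpM2l t0 m2; lra.
have sc (t d : K) : 0 < d -> exists2 e : K, 0 < e & forall t' : K,
    `|t' - t| < e -> cmod (s t' - s t) < d.
  move=> d0; have q0 : 0 < cmod (z' - z) + 1 by rewrite ltr_wpDl ?cmod_ge0.
  exists (d / (cmod (z' - z) + 1)) => [|t']; first by rewrite divr_gt0.
  rewrite ltr_pdivlMr // => tt.
  have -> : s t' - s t = ((t' - t)%:C)%C * (z' - z).
    by rewrite /s rmorphB /=; ring.
  by rewrite cmodM cmodR; apply: le_lt_trans tt; rewrite ler_wpM2l // lerDl.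
have -> : z' = s 1 by rewrite /s rmorph1; ring.
apply: (@segment_induction (fun t : K => H (s t) = G (s t))).
- have -> : s 0 = z by rewrite /s rmorph0; ring.
  by rewrite /H /G /= hkz.
- move=> t t01 E; have tD := sD _ t01; have [_ _ _ [d d0 dP]] := cf _ tD.
  have [d1 d10 d1P] := Gc _ tD _ d0.
  have [e e0 eP] := sc t _ d10; exists e => // t' t'01 /eP/d1P.
  by rewrite -E => /dP; rewrite gG //; exact: sD.
- move=> t t01 /eqP HG; have tD := sD _ t01.
  have n0 : 0 < cmod (H (s t) - G (s t)) / 2.
    by rewrite divr_gt0 // cmod_gt0 subr_eq0.
  have [d d0 dP] := Hc _ tD _ n0; have [d1 d10 d1P] := Gc _ tD _ n0.
  have m0 : 0 < Num.min d d1 by rewrite lt_min d0.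
  have [e e0 eP] := sc t _ m0; exists e => // t' t'01 /eP.
  rewrite lt_min => /andP[/dP + /d1P + E]; rewrite E => H1 H2.
  have := cmodDB (H (s t)) (G (s t)) (G (s t')).
  by rewrite (cmodBC (H (s t)) (G (s t'))); lra.
Qed.

End Lifts.

(** * The nice sets *)

Section Nice.
Variables (K : realType) (u : nat) (f : 'I_u -> ratmap K).
Local Notation C := K[i].
Variables (R r rr : K) (S : set C).
Implicit Types (z y t a b c : C) (v w : seq 'I_u) (h k : C -> sphere K)
  (om : Sigma u) (rho : seq 'I_u * (C -> sphere K)) (n m : nat).

Definition base s : set (Sigma u * C) := [set: Sigma u] `*` disc s r.

(** A pull-back is adjoined only if it meets the initial set, and not merely
the previous stage: this is what keeps the stages inside a fixed disc.  Closure
under pull-backs that meet the union elsewhere is [pull_back_nested]. *)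
Fixpoint stage n (s : C) : set (Sigma u * C) :=
  if n is n'.+1 then base s `|` [set x | exists b rho,
    [/\ S b, rho.1 <> [::], branch f rho.1 rho.2 (disc b R),
        in_sphere (base s) `&` pull_back rho (stage n' b) !=set0 &
        pull_back rho (stage n' b) (x.1, fin x.2)]]
  else base s.

Definition nice_set s := \bigcup_n stage n s.

Lemma in_sphereP (U : set (Sigma u * C)) om z : in_sphere U (om, fin z) <-> U (om, z).
Proof.
split=> [[[om' z'] Uz [<- <-]] //|Uz]; by exists (om, z).
Qed.

Lemma pull_backS rho (U V : set (Sigma u * C)) : U `<=` V ->
  pull_back rho U `<=` pull_back rho V.
Proof. by move=> UV _ [x /UV Vx <-]; exists x. Qed.

Lemma base_stage n s : base s `<=` stage n s.
Proof. by case: n => [//|n] x bx; left. Qed.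

Lemma stageS n s : stage n s `<=` stage n.+1 s.
Proof.
elim: n s => [|n IH] s; first exact: base_stage.
move=> x [bx|[b [rho [Sb w0 hb [y [y1 y2]] px]]]]; first by left.
right; exists b, rho; split=> //; last exact: pull_backS px.
by exists y; split=> //; exact: pull_backS y2.
Qed.

Lemma stage_le m n s : (m <= n)%N -> stage m s `<=` stage n s.
Proof.
move=> /subnKC <-; elim: (n - m)%N => [|k IH]; first by rewrite addn0.
by rewrite addnS; apply: subset_trans IH _; exact: stageS.
Qed.

(** [rr] is [kappa * r]; the two last hypotheses are the contraction estimates
for branches that come near [S]. *)
Hypothesis r0 : 0 < r.
Hypothesis rrr : r < rr.
Hypothesis rrR : rr <= R.
Hypothesis sep : forall a b z, S a -> S b -> disc a rr z -> disc b rr z -> a = b.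
Hypothesis noPCV : forall b z, S b -> disc b R z -> ~ PCV f (fin z).
Hypothesis near_centre : forall a b w h z1 y1, S a -> S b -> w <> [::] ->
  branch f w h (disc b R) -> disc b rr z1 -> h z1 = fin y1 -> disc a rr y1 ->
  forall z, disc b R z -> exists2 y, h z = fin y & disc a R y.
Hypothesis contracts : forall a b w h z1 y1, S a -> S b -> w <> [::] ->
  branch f w h (disc b R) -> disc b rr z1 -> h z1 = fin y1 -> disc a rr y1 ->
  forall z z', disc b rr z -> disc b rr z' ->
    cmod (finpart (h z) - finpart (h z')) < rr - r.

Let disc_r_rr s z : disc s r z -> disc s rr z.
Proof. by move=> H; exact: lt_trans rrr. Qed.

Let disc_rr_R s z : disc s rr z -> disc s R z.
Proof. by move=> H; exact: lt_le_trans rrR. Qed.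

Lemma stage_bound n s : S s -> stage n s `<=` [set: Sigma u] `*` disc s rr.
Proof.
elim: n s => [|n IH] s Ss [om z].
  by move=> [_ /= zr]; split=> //; exact: disc_r_rr.
case=> [[_ /= zr]|[b [[w h] [/= Sb w0 hb]]]]; first by split=> //; exact: disc_r_rr.
move=> [_ [[[om1 y1] [_ /= y1r] <-] [[om2 z2] z2L [/= _ hz2]]]].
move=> [[om3 z3] z3L [/= _ hz3]]; split=> //=.
have z2D := (IH _ Sb _ z2L).2; have z3D := (IH _ Sb _ z3L).2.
have := contracts Ss Sb w0 hb z2D hz2 (disc_r_rr y1r) z3D z2D.
rewrite hz2 hz3 /= => H; rewrite /disc /=.
have {}y1r : cmod (y1 - s) < r := y1r.
by have := cmodDB z s y1; lra.
Qed.

Lemma nice_set_bound s : S s -> nice_set s `<=` [set: Sigma u] `*` disc s rr.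
Proof. by move=> Ss x [n _ /(stage_bound Ss)]. Qed.

Lemma base_nice_set s : base s `<=` nice_set s.
Proof. by move=> x bx; exists 0%N. Qed.

(** After applying the word map of [v], the branch [h] becomes a branch [g] of
the rest of the word with values near [c].  Then [k] after [g] and [h] are two
branches of the same word that agree at [z]. *)
Lemma branch_factor a b c v w' h k z y : S a -> S b -> S c ->
  v <> [::] -> branch f (v ++ w') h (disc b R) -> branch f v k (disc c R) ->
  disc b rr z -> disc c rr y -> h z = k y ->
  (exists2 x, h z = fin x & disc a rr x) ->
  branch f w' (word_map f v \o h) (disc b R) /\
  forall z' y', disc b R z' -> word_map f v (h z') = fin y' ->
    disc c R y' /\ k y' = h z'.
Proof.
move=> Sa Sb Sc v0 hb kc zD yD hk [x hx xa].
have w0 : v ++ w' <> [::] by case: (v) v0.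
have hfin z' : disc b R z' -> exists2 y, h z' = fin y & disc a R y.
  exact: (near_centre Sa Sb w0 hb zD hx xa).
have kx : k y = fin x by rewrite -hk.
have kfin y' : disc c R y' -> exists2 y, k y' = fin y & disc a R y.
  exact: (near_centre Sa Sc v0 kc yD kx xa).
have br : branch f w' (word_map f v \o h) (disc b R).
  move=> z' z'D; have [hc hw] := hb _ z'D; have [y' hy' _] := hfin _ z'D.
  split; last by rewrite /= -word_map_cat.
  have jc : {for z', continuous (@finpart K \o h)}.
    apply/contE => e e0; have [d d0 dP] := sphere_cont_fin hc hy' e0.
    by exists d => // s /dP[s' /= -> ]; rewrite hy'.
  have E : \forall s \near z', word_map f v (h s) =
      word_map f v (fin ((@finpart K \o h) s)).
    apply/nbhs_cmodP; have [d d0 dP] := near_disc z'D.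
    by exists d => // s /dP /hfin[s' hs _] /=; rewrite hs.
  have Gc : {for z', continuous ((fun t => word_map f v (fin t)) \o (@finpart K \o h))}.
    by apply: continuous_comp => //; exact: word_cont.
  move=> V VN; rewrite /= (nbhs_singleton E) in VN.
  have N : nbhs z' (((fun t => word_map f v (fin t)) \o (@finpart K \o h)) @^-1` V).
    exact: Gc VN.
  change (nbhs z' ((word_map f v \o h) @^-1` V)).
  by apply: filterS (filterI E N) => s [/= -> ].
split=> // z' y' z'D hy'.
(* If [w'] is empty then [word_map f v (h z) = z], so [z] is near [b] and [c]. *)
have inc z1 : disc b R z1 -> exists2 y1, word_map f v (h z1) = fin y1 & disc c R y1.
  have vy : word_map f v (h z) = fin y by rewrite hk (kc _ (disc_rr_R yD)).2.
  case w'E : w' => [|i l].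
    move: hb; rewrite w'E cats0 => hb.
    have : y = z by move: vy; rewrite (hb _ (disc_rr_R zD)).2 => -[].
    move=> yz; have bc : b = c by apply: sep zD _ => //; rewrite -yz.
    by move=> z1D; exists z1; [rewrite (hb _ z1D).2|rewrite -bc].
  have w'0 : w' <> [::] by rewrite w'E.
  exact: (near_centre Sc Sb w'0 br zD vy yD).
have y'D : disc c R y' by have [y1] := inc _ z'D; rewrite hy' => -[->].
split=> //.
(* a second branch of the word [v ++ w'] *)
pose g := k \o (@finpart K \o (word_map f v \o h)).
have gb : branch f (v ++ w') g (disc b R).
  move=> z1 z1D; have [y1 hy1 y1D] := inc _ z1D; split.
    apply: continuous_comp; last by rewrite /= hy1; exact: (kc _ y1D).1.
    apply/contE => e e0; have [d d0 dP] := sphere_cont_fin (br _ z1D).1 hy1 e0.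
    by exists d => // s /dP[s' /= -> ]; rewrite hy1.
  rewrite word_map_cat /g /= hy1 /= (kc _ y1D).2 -hy1.
  exact: (br _ z1D).2.
have -> : k y' = g z' by rewrite /g /= hy'.
have fins z1 : disc b R z1 -> g z1 <> infty /\ h z1 <> infty.
  move=> z1D; have [y1 hy1 y1D] := inc _ z1D.
  have [s ks _] := kfin _ y1D; have [s' hs _] := hfin _ z1D.
  by rewrite /g /= hy1 /= ks hs.
have gz : g z = h z.
  by rewrite /g /= hk (kc _ (disc_rr_R yD)).2.
exact: (branch_unique w0 gb hb fins (fun z1 => @noPCV b z1 Sb) (disc_rr_R zD) z'D gz).
Qed.

(** The point that meets [base a] and any other given point of the pull-back
come from a common stage of [b]. *)
Lemma pull_back_meets_base a b rho : S a -> S b -> rho.1 <> [::] ->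
  branch f rho.1 rho.2 (disc b R) ->
  in_sphere (base a) `&` pull_back rho (nice_set b) !=set0 ->
  pull_back rho (nice_set b) `<=` in_sphere (nice_set a).
Proof.
move=> Sa Sb w0 hb [p [pa [[om1 z1] [n1 _ z1L] z1p]]] _ [[om2 z2] [n2 _ z2L] <-] /=.
pose n := maxn n1 n2.
have z1L' : stage n b (om1, z1) by apply: stage_le z1L; rewrite leq_maxl.
have z2L' : stage n b (om2, z2) by apply: stage_le z2L; rewrite leq_maxr.
have z1D := (stage_bound Sb z1L').2; have z2D := (stage_bound Sb z2L').2.
case: pa => -[om3 y] ya yp.
have hz1 : rho.2 z1 = fin y by move: z1p; rewrite -yp => -[].
have [y2 hz2 _] := near_centre Sa Sb w0 hb z1D hz1 (disc_r_rr ya.2) (disc_rr_R z2D).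
rewrite /= hz2; apply/in_sphereP; exists n.+1 => //; right.
exists b, rho; split=> //; last by exists (om2, z2) => //=; rewrite hz2.
exists p; split; first by exists (om3, y).
by exists (om1, z1).
Qed.

Lemma pull_back_nested_nil m n a b rho : S a -> S b -> rho.1 = [::] ->
  branch f rho.1 rho.2 (disc b R) ->
  in_sphere (stage n a) `&` pull_back rho (stage m b) !=set0 ->
  pull_back rho (nice_set b) `<=` in_sphere (nice_set a).
Proof.
case: rho => w h /= Sa Sb -> hb [p [[[om' y] ya <-] [[om z] zb [/= _ hz]]]].
have zD := (stage_bound Sb zb).2; have yD := (stage_bound Sa ya).2.
have hE x : disc b rr x -> h x = fin x by move=> /disc_rr_R/hb[_ /= ->].
have zy : z = y by move: hz; rewrite hE // => -[].
have -> : a = b by apply: sep yD _ => //; rewrite -zy.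
move=> _ [[om3 z3] z3L <-] /=; rewrite hE ?prepend0.
  exact/in_sphereP.
exact: (nice_set_bound Sb z3L).2.
Qed.

(** Induction on the sum [m + n] of the two stages that meet.  If the meeting
point lies in a pull-back adjoined along [(v, k)], compare the lengths of the
words [w] and [v].  Cancelling the shorter word leaves a pull-back that meets a
stage of total index one less.  If [w] is the longer one, then by induction the
remaining pull-back lies in the nice set of [c], and the pull-back of the latter
along [(v, k)] lies in that of [a].  If [v] is the longer one, then by induction
the pull-back along [(w, h)] contains the one along [(v, k)], so it meets
[base a]. *)
Lemma pull_back_nested N : forall m n a b rho, (m + n <= N)%N -> S a -> S b ->
  branch f rho.1 rho.2 (disc b R) ->
  in_sphere (stage n a) `&` pull_back rho (stage m b) !=set0 ->
  pull_back rho (nice_set b) `<=` in_sphere (nice_set a).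
Proof.
elim: N => [|N IH] m n a b [w h] mnN Sa Sb hb meet;
    have [w0|/eqP w0] := eqVneq w [::]; try exact: (@pull_back_nested_nil m n a b (w, h) Sa Sb w0 hb meet).
  case: meet => p [pa pb]; apply: (@pull_back_meets_base a b (w, h) Sa Sb w0 hb).
  exists p; split; last by apply: pull_backS pb => x xb; exists m.
  by move: pa; have -> : n = 0%N by lia.
have {}hb : branch f w h (disc b R) := hb.
have [p [[[om' y] ya yp] [[om z] zb zp]]] := meet.
have inb : base a (om', y) -> pull_back (w, h) (nice_set b) `<=` in_sphere (nice_set a).
  move=> ya'; apply: (@pull_back_meets_base a b (w, h) Sa Sb w0 hb); exists p; split; first by exists (om', y).
  by exists (om, z) => //; exists m.
case: n ya mnN meet => [/inb //|n] ya mnN meet.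
have yD := (stage_bound Sa ya).2.
case: ya => [/inb //|[c [[v k] /= [Sc v0 kc ba [[om2 z2] z2L [/= omE kz2]]]]]].
have zD := (stage_bound Sb zb).2; have z2D := (stage_bound Sc z2L).2.
move: zp; rewrite -yp => -[/= ompE hz].
have ca : pull_back (v, k) (nice_set c) `<=` in_sphere (nice_set a).
  case: ba => q [qa qc]; apply: (@pull_back_meets_base a c (v, k) Sa Sc v0 kc); exists q; split=> //.
  by apply: pull_backS qc => x xc; exists n.
have hk : h z = k z2 by rewrite hz kz2.
have ompE' : prepend w om = prepend v om2 by rewrite ompE omE.
have [vw|wv] := leqP (size v) (size w).
  have [w' wE om2E] := prepend_prefix ompE' vw.
  rewrite wE in hb w0 ompE'.
  have [|br lift] := branch_factor Sa Sb Sc v0 hb kc zD z2D hk; first by exists y.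
  have sub : pull_back (w', word_map f v \o h) (nice_set b) `<=` in_sphere (nice_set c).
    apply: (IH m n c b) => //; first by lia.
    exists (om2, fin z2); split; first by exists (om2, z2).
    exists (om, z) => //=; rewrite -om2E hk.
    by rewrite (kc _ (disc_rr_R z2D)).2.
  move=> _ [[om3 z3] z3L <-]; rewrite wE /=.
  have /sub : pull_back (w', word_map f v \o h) (nice_set b)
      (prepend w' om3, word_map f v (h z3)) by exists (om3, z3).
  case=> -[om4 z4] z4L [/= om4E hz4].
  have z3R := disc_rr_R (nice_set_bound Sb z3L).2.
  change (in_sphere (nice_set a) (prepend (v ++ w') om3, h z3)).
  have [_ <-] := lift z3 z4 z3R (esym hz4).
  apply: ca; exists (om4, z4) => //=.
  by rewrite om4E prepend_cat.
have [v' vE omE'] := prepend_prefix (esym ompE') (ltnW wv).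
rewrite vE in kc v0 ompE' ca ba.
have [|br lift] := branch_factor Sa Sc Sb w0 kc hb z2D zD (esym hk); first by exists y.
have sub : pull_back (v', word_map f w \o k) (nice_set c) `<=` in_sphere (nice_set b).
  apply: (IH n m b c) => //; first by lia.
  exists (om, fin z); split; first by exists (om, z).
  exists (om2, z2) => //=; rewrite -omE' -hk.
  by rewrite (hb _ (disc_rr_R zD)).2.
case: ba => q [qa [[om5 z5] z5L q5]].
have z5l : nice_set c (om5, z5) by exists n.
have /sub : pull_back (v', word_map f w \o k) (nice_set c)
    (prepend v' om5, word_map f w (k z5)) by exists (om5, z5).
case=> -[om6 z6] z6L [/= om6E kz6].
have z5R := disc_rr_R (nice_set_bound Sc z5l).2.
have [_ hz6] := lift z5 z6 z5R (esym kz6).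
apply: (@pull_back_meets_base a b (w, h) Sa Sb w0 hb); exists q; split=> //.
exists (om6, z6) => //=.
by rewrite hz6 om6E -prepend_cat.
Qed.

(** Since [h] is inverse to a rational map near its values, the pull-back of an
open set is the preimage of it under the skew product, within a cylinder and
near the image of [h]. *)
Lemma stage_open n s : S s -> open (stage n s).
Proof.
have bo x : open (base x).
  rewrite openE => -[om z] [_ /= zD].
  have [d d0 dP] := near_disc (zD : disc x r z).
  exists (setT, B2 z d) => /=.
    split; first exact: filterT.
    by apply/nbhs_cmodP; exists d => // y /B2E.
  by case=> om' y [_ /= /B2E/dP yD].
elim: n s => [|n IH] s Ss; first exact: bo.
rewrite openE => x [bx|[b [[w h] [/= Sb w0 hb meet]]]].
  have := bo s; rewrite openE => /(_ _ bx); apply: filterS => y yb; exact: base_stage.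
case: x => om y [[om0 z0] z0L [/= omE hz0]].
have z0D := (stage_bound Sb z0L).2; have z0R := disc_rr_R z0D.
have [p [[[om1 y1] y1D p1] [[om2 z2] z2L p2]]] := meet.
have hz2 : h z2 = fin y1 by move: p2; rewrite -p1 => -[].
have hfin z : disc b R z -> exists2 y, h z = fin y & disc s R y.
  apply: (near_centre Ss Sb w0 hb (stage_bound Sb z2L).2 hz2).
  exact: disc_r_rr y1D.2.
have hni z : disc b R z -> h z <> infty by move=> /hfin[x ->].
have [A [B [cf AB]]] := branch_univalent w0 hb hni (fun z => @noPCV b z Sb).
have [_ gH gc [d d0 dP]] := cf _ z0R; rewrite /= hz0 /= in gH gc dP.
have := IH _ Sb; rewrite openE => /(_ _ z0L).
case=> -[N1 N2] /= [N1n N2n] N12.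
have [m mP] := nbhs_cylinderP N1n.
have [d1 d10 d1P] := (nbhs_cmodP _ _).1 N2n.
have [d2 d20 d2P] := near_disc z0R.
have [|d3 d30 d3P] := gc (Num.min d1 d2); first by rewrite lt_min d10.
exists (cylinder om (size w + m), B2 y (Num.min d d3)) => /=.
  split; first exact: nbhs_cylinder.
  apply/nbhs_cmodP; exists (Num.min d d3) => [|x /B2E //].
  by rewrite lt_min d0.
case=> om' y' [/= om'c /B2E]; rewrite lt_min => /andP[/dP Hg /d3P].
rewrite gH lt_min => /andP[/d1P gN /d2P gR].
right; exists b, (w, h); split=> //=.
rewrite -omE in om'c; have [om'E cy] := cylinder_prepend om'c.
exists (shift (size w) om', A.[y'] / B.[y']) => /=.
  apply: N12; split=> //=; exact: mP.
rewrite -om'E; congr pair; move: Hg; have := hni _ gR.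
by case: (h _) => [x|//] _ /= ->.
Qed.

End Nice.

(** * The theorem *)

Lemma finite_separated (K : realType) (S : set K[i]) : finite_set S ->
  exists2 d : K, 0 < d & forall a b, S a -> S b -> cmod (a - b) < d -> a = b.
Proof.
move=> finS; pose P (a b : K[i]) (d : K) := cmod (a - b) < d -> a = b.
have Pm a b (d d' : K) : d' <= d -> P a b d -> P a b d'.
  by move=> dd H ab; apply: H; exact: lt_le_trans dd.
have row a : S a -> exists2 d : K, 0 < d & forall b, S b -> P a b d.
  move=> Sa; apply: finite_radius finS (Pm a) _ => b Sb.
  have [->|ab] := eqVneq a b; first by exists 1.
  exists (cmod (a - b)); last by rewrite /P ltxx.
  by rewrite cmod_gt0 subr_eq0.
have [d d0 dP] : exists2 d : K, 0 < d & forall a, S a -> forall b, S b -> P a b d.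
  apply: finite_radius finS _ row => a d d' dd H b Sb; apply: Pm dd _; exact: H.
by exists d => // a b Sa Sb; exact: dP.
Qed.

Lemma finite_bounded (K : realType) (S : set K[i]) : finite_set S ->
  exists2 M : K, 0 <= M & forall a, S a -> cmod a <= M.
Proof.
move=> finS.
have [d d0 dP] : exists2 d : K, 0 < d & forall a : K[i], S a -> d * cmod a <= 1.
  apply: finite_radius finS _ _ => [a d d' dd H|a _].
    by apply: le_trans H; rewrite ler_wpM2r // cmod_ge0.
  have a1 : 0 < cmod a + 1 by rewrite ltr_wpDl ?cmod_ge0.
  exists (cmod a + 1)^-1; first by rewrite invr_gt0.
  by rewrite mulrC ler_pdivrMr // mul1r lerDl.
exists d^-1 => [|a /dP]; first by rewrite invr_ge0 ltW.
by rewrite -[d^-1]mul1r ler_pdivlMr // mulrC.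
Qed.

Unset Implicit Arguments.

Theorem theorem1p5 (K : realType) (u : nat) (hu : (1 <= u)%N)
    (f : 'I_u -> ratmap K) (hf : forall i, (1 <= degree (f i))%N)
    (hTNR : TNR f)
    (Rstar : K) (hRstar : admissible_Rstar f Rstar)
    (R : K) (hR : 0 < R < Rstar)
    (kappa : K) (hkappa : 1 < kappa < 2)
    (S : set K[i]) (hSfin : finite_set S) (hSap : aperiodic f S)
    (hCS : Crit_star f `<=` @fin K @` S)
    (hSJ : S `<=` (@fin K @^-1` J_ f) `\` B2_nbhd (PCV f) (8 * R)) :
  exists2 r0 : K, 0 < r0 &
  forall r : K, 0 < r <= R -> r <= r0 ->
  exists U : K[i] -> set (Sigma u * K[i]),
  [/\ nice_family f R S U,
      (* (A) *)
      forall s, S s ->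
        [set: Sigma u] `*` B2 s r `<=` U s /\
        U s `<=` [set: Sigma u] `*` B2 s (kappa * r) &
      (* (B) *)
      forall a b (rho : seq 'I_u * (K[i] -> sphere K)),
        S a -> S b -> HIB f R b rho -> (1 <= size rho.1)%N ->
        pull_back rho (U b) `<=` in_sphere (U a) ->
        forall z, B2 b (2 * R) z ->
          rho.2 z <> infty /\
          `|derive1 (@finpart K \o rho.2 : K[i] -> K[i]) z| <= 4^-1].
Proof.
have [fa _ _] := hTNR; have [_ _ es] := hRstar; have /andP[R0 _] := hR.
have /andP[k1 k2] := hkappa.
have far b z : S b -> disc b (8 * R) z -> ~ PCV f (fin z).
  move=> /hSJ[_ nb] zb zP; apply: nb; exists z => //.
  by apply/B2E; rewrite cmodBC.
have far' b z : S b -> disc b R z -> ~ PCV f (fin z).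
  by move=> Sb zb; apply: (far b z Sb); move: zb; rewrite /disc /=; lra.
have [M M0 SM] := finite_bounded hSfin.
have [d d0 sepd] := finite_separated hSfin.
have [eB eB0 contr] := HIB_contraction R0 M0 fa.
(* The last bound makes the diameter of a pull-back less than
   [(kappa - 1) * r]: by the Schwarz lemma the branch is Lipschitz at the centre
   with constant [2 * eta / R]. *)
pose eta := Num.min eB (Num.min R ((kappa - 1) * R / 16)).
have eta0 : 0 < eta.
  by rewrite !lt_min eB0 R0 divr_gt0 // mulr_gt0 // subr_gt0.
have eta1 : eta <= eB by rewrite ge_min lexx.
have eta2 : eta <= R by rewrite !ge_min lexx !orbT.
have eta3 : eta <= (kappa - 1) * R / 16 by rewrite !ge_min lexx !orbT.
have [N long] := long_branch_near es hR M0 eta0.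
have [r2 r20 short] := short_word N hSfin hSap.
exists (Num.min (Num.min (eta / 4) (r2 / 2)) (Num.min (R / 2) (d / 4))).
  by rewrite !lt_min !divr_gt0.
move=> r /andP[r0 rR]; rewrite !le_min => /andP[/andP[re rr2] /andP[rR2 rd]].
pose rr := kappa * r.
have rrr : r < rr by rewrite /rr; nra.
have rr2r : rr < 2 * r by rewrite /rr; nra.
have rrR : rr <= R by lra.
have near a b w h z1 y1 : S a -> S b -> w <> [::] -> branch f w h (disc b R) ->
    disc b rr z1 -> h z1 = fin y1 -> disc a rr y1 ->
    forall z, disc b R z -> exists2 y, h z = fin y & cmod (y - a) < eta.
  move=> Sa Sb w0 hb z1D hz1 y1D.
  have {}z1D : cmod (z1 - b) < rr := z1D; have {}y1D : cmod (y1 - a) < rr := y1D.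
  have z1R : disc b R z1 by rewrite /disc /=; lra.
  have wN : (N <= size w)%N.
    rewrite leqNgt; apply/negP => wN.
    apply: (short a b w y1 z1 Sa Sb w0 wN); [lra|lra|].
    by rewrite -hz1 (hb _ z1R).2.
  apply: (long b w h a z1 y1 _ hb wN (SM _ Sa) z1R hz1); last lra.
  by have [] := hSJ b Sb.
have near' a b w h z1 y1 : S a -> S b -> w <> [::] -> branch f w h (disc b R) ->
    disc b rr z1 -> h z1 = fin y1 -> disc a rr y1 ->
    forall z, disc b R z -> exists2 y, h z = fin y & disc a R y.
  move=> Sa Sb w0 hb z1D hz1 y1D z /(near a b w h z1 y1 Sa Sb w0 hb z1D hz1 y1D).
  by move=> [y hy ya]; exists y => //; rewrite /disc /=; lra.
have contract a b w h z1 y1 : S a -> S b -> w <> [::] -> branch f w h (disc b R) ->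
    disc b rr z1 -> h z1 = fin y1 -> disc a rr y1 ->
    forall z z', disc b rr z -> disc b rr z' ->
    cmod (finpart (h z) - finpart (h z')) < rr - r.
  move=> Sa Sb w0 hb z1D hz1 y1D z z' zD z'D.
  have na := near a b w h z1 y1 Sa Sb w0 hb z1D hz1 y1D.
  have lip := branch_lip R0 eta0 w0 hb (fun z => far' b z Sb) na.
  have key x : disc b rr x -> cmod (finpart (h x) - finpart (h b)) <= (rr - r) / 4.
    move=> xD; have {}xD : cmod (x - b) < rr := xD.
    have xR : disc b R x by rewrite /disc /=; lra.
    apply: le_trans (lip _ xR) _.
    rewrite mulrA ler_pdivrMr //.
    have : eta * cmod (x - b) <= (kappa - 1) * R / 16 * (2 * r).
      by apply: ler_pM => //; [exact: ltW|exact: cmod_ge0|lra].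
    rewrite /rr; lra.
  have := cmodDB (finpart (h z)) (finpart (h z')) (finpart (h b)).
  rewrite (cmodBC (finpart (h b))).
  have := key z zD; have := key z' z'D; lra.
have sep a b z : S a -> S b -> disc a rr z -> disc b rr z -> a = b.
  move=> Sa Sb; rewrite /disc /= => za zb; apply: sepd => //.
  by have := cmodDB a b z; rewrite (cmodBC a z); lra.
exists (nice_set f R r S); split; first split.
- move=> s Ss; apply: bigcup_open => n _.
  exact: (stage_open rrr rrR far' near' contract).
- move=> a b Sa Sb [[om z] [za zb]].
  have [_ zaD] := nice_set_bound rrr contract Sa za.
  have [_ zbD] := nice_set_bound rrr contract Sb zb.
  exact: (sep a b z).
- move=> s Ss _ [[om z] zs <-] /=; apply/B2E.
  have [_ zD] := nice_set_bound rrr contract Ss zs.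
  by have {}zD : cmod (z - s) < rr := zD; lra.
- move=> a b [w h] Sa Sb hb.
  have [E|/set0P[p [[x [n _ xn] xp] [y [m _ ym] yp]]]] :=
    eqVneq (in_sphere (nice_set f R r S a) `&`
      pull_back (w, h) (nice_set f R r S b)) set0; first by left.
  have hb' : branch f w h (disc b R) by apply: (HIB_branch _ hb); lra.
  right; apply: (pull_back_nested r0 rrr rrR sep far' near' contract (N := m + n)
    (m := m) (n := n)) => //.
  by exists p; split; [exists x|exists y].
- move=> s Ss; split=> [[om z] [_ /= /B2E zr]|x xs].
    exact: base_nice_set.
  have [_ xD] := nice_set_bound rrr contract Ss xs.
  by split=> //; apply/B2E.
- move=> a b [w h] Sa Sb hb w1 sub z zD.
  have w0 : w <> [::] by move=> w0; move: w1; rewrite /= w0.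
  have hb' : branch f w h (disc b R) by apply: (HIB_branch _ hb); lra.
  pose om : Sigma u := fun=> Ordinal hu.
  have bb : disc b r b by rewrite /disc /= subrr cmod0.
  have /sub : pull_back (w, h) (nice_set f R r S b) (prepend w om, h b).
    by exists (om, b) => //; exact: base_nice_set.
  case=> -[om' y] ya [_ hby].
  have yD := (nice_set_bound rrr contract Sa ya).2.
  have bD : disc b rr b by rewrite /disc /= subrr cmod0; lra.
  have na := near a b w h b y Sa Sb w0 hb' bD (esym hby) yD.
  apply: (contr a b w h (SM _ Sa) w0 hb).
  - by move=> x; exact: far.
  - by move=> x; exact: far.
  - by move=> x /na[y' hx y'a]; exists y' => //; exact: lt_le_trans eta1.
  - by move/B2E: zD.
Qed.
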